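(* Let $c>0$, $m\ge 0$, $\alpha\in[0,\pi/2]$, let $D_0$ be the half-line Dirac operator with boundary condition $\psi_1(0)\cos\alpha-\psi_2(0)\sin\alpha=0$ and let $V$ be a (not necessarily Hermitian) potential, both as described in the context. Put $v:=\|V\|_1/c$ and assume $v<1/\sqrt2$. Then any eigenvalue $z\in\mathbb{C}\setminus\sigma(D_0)$ of $D_0+V$ is contained in the union of the two closed disks in $\mathbb{C}$ with centres $\pm mc^2x_0$ and radii $mc^2r_0$, where $$x_0:=1+\frac{2v^4}{1-2v^2},\qquad r_0:=2v^2\,\frac{1-v^2}{1-2v^2},$$ and these two disks are disjoint (when $m>0$). In particular, if $m=0$, then the spectrum of $D_0+V$ is $\mathbb{R}$.
   Context: $\mathbb{R}_+=(0,\infty)$. For $c>0$, $m\ge0$ and $\alpha\in[0,\pi/2]$, $D_0$ is the self-adjoint operator in $L^2(\mathbb{R}_+,\mathbb{C}^2)$ acting as $$D_0=\begin{pmatrix} mc^2 & -c\,\frac{d}{dx}\\ c\,\frac{d}{dx} & -mc^2\end{pmatrix}$$ on the domain of all $\psi=(\psi_1,\psi_2)^t\in H^1(\mathbb{R}_+,\mathbb{C}^2)$ with $\psi_1(0)\cos\alpha-\psi_2(0)\sin\alpha=0$. Its spectrum is $\sigma(D_0)=(-\infty,-mc^2]\cup[mc^2,\infty)$. The potential $V:[0,\infty)\to\mathrm{Mat}(2,\mathbb{C})$ is a complex $2\times2$-matrix-valued function, smooth on $[0,\infty)$ and with compact support in $[0,\infty)$; $V$ acts as a multiplication operator and $D_0+V$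 is the operator sum, with the same domain as $D_0$. We write $\|V\|_1:=\int_0^\infty\|V(x)\|\,dx$, where $\|V(x)\|$ is the operator norm on $\mathbb{C}^2$. *)

(* Defs.v *)
From HB Require Import structures.
From mathcomp Require Import all_boot all_order all_algebra.
From mathcomp Require Import all_classical all_reals all_analysis.
From mathcomp Require Import complex.
Set Implicit Arguments.
Unset Strict Implicit.
Unset Printing Implicit Defensive.
Import Order.TTheory GRing.Theory Num.Theory.
Import numFieldNormedType.Exports.
Local Open Scope classical_set_scope.
Local Open Scope complex_scope.
Local Open Scope ring_scope.

(* Functions on the half-line (0, oo) are represented by functions on R whose
   values outside (0, oo) (for continuous functions, outside [0, oo)) are
   irrelevant. Elements of L^2 are represented by functions, equality in L^2
   being equality almost everywhere on (0, oo). *)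

Definition halfline (R : realType) : set R := `]0, +oo[.

Definition halfline_closed (R : realType) : set R := `[0, +oo[.

Definition entrywise (R : realType) (p q : nat) (P : (R -> R) -> Prop)
    (F : R -> 'M[R[i]]_(p, q)) : Prop :=
  forall i j, P (fun x => complex.Re (F x i j))
           /\ P (fun x => complex.Im (F x i j)).

Definition vnorm (R : realType) (u : 'cV[R[i]]_2) : R :=
  Num.sqrt (\sum_i Normc.normc (u i 0) ^+ 2).

Definition opnorm (R : realType) (A : 'M[R[i]]_2) : R :=
  sup [set vnorm (A *m u) | u in [set u | vnorm u <= 1]].

Definition eq_ae (R : realType) (f g : R -> 'cV[R[i]]_2) : Prop :=
  {ae @lebesgue_measure R, forall x, halfline x -> f x = g x}.

Definition L2 (R : realType) (f : R -> 'cV[R[i]]_2) : Prop :=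
  entrywise (measurable_fun (@halfline R)) f /\
  (\int[@lebesgue_measure R]_(x in @halfline R)
      (vnorm (f x) ^+ 2)%:E < +oo)%E.

Definition L2norm (R : realType) (f : R -> 'cV[R[i]]_2) : R :=
  Num.sqrt (\int[@lebesgue_measure R]_(x in @halfline R) (vnorm (f x) ^+ 2)).

(* C^1 functions with compact support in the open half-line, the test functions
   in Brezis' definition of Sobolev spaces on an interval; they determine the
   same weak derivatives as C^oo functions with compact support. *)
Definition test_function (R : realType) (phi : R -> R) : Prop :=
  [/\ forall x, derivable phi x 1,
      continuous (derive1 phi)
    & exists a b : R, 0 < a /\ forall x, ~ (a <= x <= b) -> phi x = 0].

Definition weak_derivative (R : realType) (f g : R -> R) : Prop :=
  forall phi, test_function phi ->
    \int[@lebesgue_measure R]_(x in @halfline R) (f x * derive1 phi x) =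
    - \int[@lebesgue_measure R]_(x in @halfline R) (g x * phi x).

(* psi is in H^1(R_+, C^2) and its derivative there is dpsi. *)
Definition H1_derivative (R : realType) (psi dpsi : R -> 'cV[R[i]]_2) : Prop :=
  [/\ L2 psi, L2 dpsi &
   forall i,
     weak_derivative (fun x => complex.Re (psi x i 0))
                     (fun x => complex.Re (dpsi x i 0)) /\
     weak_derivative (fun x => complex.Im (psi x i 0))
                     (fun x => complex.Im (dpsi x i 0))].

(* a is the boundary value psi(0): the value at 0 of the representative of psi
   that is continuous on [0, oo). *)
Definition boundary_value (R : realType) (psi : R -> 'cV[R[i]]_2)
    (a : 'cV[R[i]]_2) : Prop :=
  exists psic : R -> 'cV[R[i]]_2,
    [/\ entrywise (fun f => {within @halfline_closed R, continuous f}) psic,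
        eq_ae psi psic
      & psic 0 = a].

(* Unbounded operators in L^2(R_+, C^2) are given by their graphs: T psi phi
   means that psi is in the domain of T and that T maps psi to phi. *)
Definition operator (R : realType) : Type :=
  (R -> 'cV[R[i]]_2) -> (R -> 'cV[R[i]]_2) -> Prop.

Definition dirac_halfline (R : realType) (c m alpha : R) : operator R :=
  fun psi phi =>
    L2 phi /\
    exists dpsi a, [/\
      H1_derivative psi dpsi,
      boundary_value psi a,
      a 0 0 * (cos alpha)%:C - a 1 0 * (sin alpha)%:C = 0 &
      {ae @lebesgue_measure R, forall x, halfline x ->
         phi x 0 0 = (m * c ^+ 2)%:C * psi x 0 0 - c%:C * dpsi x 1 0 /\
         phi x 1 0 = c%:C * dpsi x 0 0 - (m * c ^+ 2)%:C * psi x 1 0}].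

Definition add_potential (R : realType) (T : operator R)
    (V : R -> 'M[R[i]]_2) : operator R :=
  fun psi phi =>
    L2 phi /\
    exists phi0, T psi phi0 /\ eq_ae phi (fun x => phi0 x + V x *m psi x).

Definition eigenvalue_of (R : realType) (T : operator R) (z : R[i]) : Prop :=
  exists psi, T psi (fun x => z *: psi x) /\ ~ eq_ae psi (fun=> 0).

(* T - z maps the domain of T bijectively onto L^2, with bounded inverse (the
   bound contains the injectivity). *)
Definition resolvent_set (R : realType) (T : operator R) : set R[i] :=
  [set z |
    (forall g, L2 g -> exists psi, T psi (fun x => z *: psi x + g x)) /\
    exists M : R, forall psi phi, T psi phi ->
      L2norm psi <= M * L2norm (fun x => phi x - z *: psi x)].

Definition spectrum (R : realType) (T : operator R) : set R[i] :=
  ~` resolvent_set T.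

(* The derivatives of all orders exist on (0, oo) and, together with f itself,
   extend continuously to [0, oo). *)
Definition smooth_halfline (R : realType) (f : R -> R) : Prop :=
  {within @halfline_closed R, continuous f} /\
  forall n : nat,
    (forall x, 0 < x -> derivable (derive1n n f) x 1) /\
    cvg (derive1n n f x @[x --> 0^'+]).

(* Smooth with compact support on [0, oo); V need not vanish at 0. *)
Definition potential (R : realType) (V : R -> 'M[R[i]]_2) : Prop :=
  entrywise (@smooth_halfline R) V /\
  exists b : R, forall x, b < x -> V x = 0.

Definition norm1 (R : realType) (V : R -> 'M[R[i]]_2) : R :=
  \int[@lebesgue_measure R]_(x in @halfline R) opnorm (V x).

Definition closed_disk (R : realType) (a r : R) : set R[i] :=
  [set z | Normc.normc (z - a%:C) <= r].

(* Main.v *)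
Require Import Defs.
From mathcomp Require Import all_boot all_order all_algebra.
From mathcomp Require Import all_classical all_reals all_analysis.
From mathcomp Require Import complex.
From mathcomp Require Import measurable_realfun.
From mathcomp Require Import ring lra.
Import Order.TTheory GRing.Theory Num.Theory.
Import numFieldNormedType.Exports.
Local Open Scope classical_set_scope.
Local Open Scope complex_scope.
Local Open Scope ring_scope.

(** Write M = m c^2 and, for z outside the spectrum of D_0, let k be the root of c^2 k^2 = z^2 - M^2 with
Im k > 0, and zeta = (z + M)/(ck). The equation (D_0 - z) psi = h is a first-order linear system on the
half-line. It has a solution w that decays like exp(-Im k x) at infinity and a solution u that satisfies the
boundary condition at 0; by the Lagrange identity their Wronskian W with each other is constant, and
variation of constants expresses every square integrable solution through the kernel
u(min(x,y)) w(max(x,y))^T / (c W) (lemmas green_solution and green_representation).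

The heart of the matter is the pointwise estimate of this kernel by K/c * exp(-Im k |x - y|) with
K^2 = 1 + max(|zeta|^2, |zeta|^-2), proved in green_pair_exists. It rests on Im (1/zeta) >= 0 together with
sin alpha, cos alpha >= 0: they make the reflected wave in u no larger than the incident one, uniformly in
alpha. An eigenfunction solves the system with h = - V psi, so that its supremum is at most
K v times itself (a_priori_bound). Hence K v >= 1 for an eigenvalue. As |zeta|^2 = |z + M| / |z - M|, this
says that one of these two distances is at least (1 - v^2)/v^2 times the other, and by Apollonius the points
with this property form the two disks (apollonius_disk). They are disjoint because x_0 - r_0 = 1 - 2 v^2 > 0.

If m = 0, then |zeta| = 1, K^2 = 2 and K v < 1 for every non-real z. The resolvent equation
psi = G (g - V psi), with G the integral operator of the kernel, is then a contraction for the supremum norm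
and is solved by iteration (neumann_fixpoint); the same a priori estimate bounds the supremum of the solution
by the L^2 norm of g, and the identity for the derivative of Im (conj psi_1 psi_2), whose boundary term at 0
vanishes because alpha is real, turns this into an L^2 bound (energy_bound). Conversely a real z with
z^2 >= M^2 belongs to the spectrum of D_0 and of D_0 + V: plane waves cut off far from the support of V form
a Weyl sequence (weyl_sequence). For D_0 this is also what shows that a z outside the spectrum admits k.

Elements of H^1 enter through absolutely continuous functions, that is, indefinite integrals of locally
integrable functions (primitive). They obey the product rule, by Fubini's theorem on a triangle (primitiveM),
so that they have weak derivatives (primitive_weak), and conversely the lemma of du Bois-Reymond shows that a
weakly differentiable function with a continuous representative is of this kind (weak_primitive). *)

Set Implicit Arguments.
Unset Strict Implicit.
Unset Printing Implicit Defensive.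

(** * Integrable functions *)

Section Primitive.
Variable R : realType.
Implicit Types (f g h : R -> R) (a b x : R).
Local Notation mu := (@lebesgue_measure R).
Local Notation intg D f := (mu.-integrable D (EFin \o f)).

Lemma integrable_ext D f g : measurable D -> (forall x, D x -> f x = g x) ->
  intg D f -> intg D g.
Proof.
move=> mD fg; apply: eq_integrable => // x /set_mem Dx /=.
by rewrite fg.
Qed.

Lemma integrable_add D f g : measurable D ->
  intg D f -> intg D g -> intg D (fun x => f x + g x).
Proof.
move=> mD fi gi; have := integrableD mD fi gi.
by apply: eq_integrable => // x _.
Qed.

Lemma integrable_opp D f : measurable D ->
  intg D f -> intg D (fun x => - f x).
Proof.
move=> mD fi; have := integrableN fi.
by apply: eq_integrable => // x _.
Qed.

Lemma integrable_sub D f g : measurable D ->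
  intg D f -> intg D g -> intg D (fun x => f x - g x).
Proof. by move=> mD fi gi; apply: integrable_add => //; apply: integrable_opp. Qed.

Lemma integrable_scale D k f : measurable D ->
  intg D f -> intg D (fun x => k * f x).
Proof.
move=> mD fi; have := integrableZl mD k fi.
by apply: eq_integrable => // x _.
Qed.

Lemma integrable_le D f g : measurable D -> measurable_fun D f ->
  (forall x, D x -> `|f x| <= g x) -> intg D g -> intg D f.
Proof.
move=> mD mf fg; apply: le_integrable => //; first exact/measurable_EFinP.
move=> x Dx /=; rewrite lee_fin (le_trans (fg x Dx)) // ler_norm //.
Qed.

Lemma integrable_measurable D f : intg D f -> measurable_fun D f.
Proof. by case/integrableP => /measurable_EFinP. Qed.

Lemma integrable_norm D f : measurable D -> intg D f -> intg D (fun x => `|f x|).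
Proof.
move=> mD fi; have := integrable_abse fi.
by apply: eq_integrable => // x _.
Qed.

Lemma integrable_cst D a : measurable D -> (mu D < +oo)%E ->
  intg D (fun=> a).
Proof.
move=> mD fD; apply: measurable_bounded_integrable => //.
exists `|a|; split; first exact: num_real.
by move=> M aM x _ /=; apply: ltW.
Qed.

(** Both iterated integrals exist because the weight |G s H t| has the finite double integral
|G|_1 |H|_1. *)
Lemma fubini_weighted (G H : R -> R) (A : set (R * R)) :
  intg setT G -> intg setT H -> measurable A ->
  (\int[mu]_s \int[mu]_t (G s * H t * \1_A (s, t))%:E =
   \int[mu]_t \int[mu]_s (G s * H t * \1_A (s, t))%:E)%E.
Proof.
move=> iG iH mA.
pose K p : R := G p.1 * H p.2 * \1_A p.
have mK : measurable_fun setT K.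
  apply: measurable_funM; last exact: measurable_indic.
  apply: measurable_funM.
    by apply: measurableT_comp => //; exact: integrable_measurable iG.
  by apply: measurableT_comp => //; exact: integrable_measurable iH.
have iK : (mu \x mu)%E.-integrable setT (EFin \o K).
  apply/integrable12ltyP; first exact/measurable_EFinP.
  have /integrableP[_ lG] := iG; have /integrableP[_ lH] := iH.
  apply: (@le_lt_trans _ _ (\int[mu]_x (`|(G x)%:E| * \int[mu]_y `|(H y)%:E|))%E).
    apply: ge0_le_integral => //=.
    - by move=> x _; apply: integral_ge0.
    - apply: (measurable_fun_fubini_tonelli_F (m2 := mu) (fun p : R * R => `|K p|%:E)%E) => //.
        by apply/measurable_EFinP; apply: measurableT_comp.
    - apply: emeasurable_funM => //.
      apply/measurable_EFinP; apply: measurableT_comp => //.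
      exact: integrable_measurable iG.
    - move=> x _; rewrite -ge0_integralZl//; last first.
        by apply/measurable_EFinP; apply: measurableT_comp => //; exact: integrable_measurable iH.
      apply: ge0_le_integral => //=.
      + apply/measurable_EFinP; apply: measurableT_comp => //.
        exact: (measurableT_comp mK (measurable_pair1 x)).
      + apply: measurable_funeM.
        by apply/measurable_EFinP; apply: measurableT_comp => //; exact: integrable_measurable iH.
      + move=> y _; rewrite -EFinM lee_fin /K !normrM ler_piMr//.
        by rewrite /indic; case: (_ \in _); rewrite ?normr1 ?normr0.
  rewrite ge0_integralZr//; last 2 first.
    by apply/measurable_EFinP; apply: measurableT_comp => //; exact: integrable_measurable iG.
    exact: integral_ge0.
  rewrite lte_mul_pinfty//; first exact: integral_ge0.
  by rewrite ge0_fin_numE//; exact: integral_ge0.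
exact: Fubini iK.
Qed.

(** Both sides integrate g s * h t over the triangle 0 < t <= s <= X; for fixed t the variable s ranges
over [t, X]. *)
Lemma Rintegral_fubini_triangle X g h : 0 <= X ->
  intg `]0, X]%classic g -> intg `]0, X]%classic h ->
  \int[mu]_(s in `]0, X]) (g s * \int[mu]_(t in `]0, s]) h t) =
  \int[mu]_(t in `]0, X]) (h t * (\int[mu]_(s in `]0, X]) g s - \int[mu]_(s in `]0, t]) g s)).
Proof.
move=> X0 ig ih.
pose I : set R := `]0, X]%classic.
have mI : measurable I by exact: measurable_itv.
pose G := g \_ I; pose H := h \_ I.
have iG : intg setT G.
  by rewrite /G -restrict_EFin; apply/integrable_restrict => //=; rewrite setTI.
have iH : intg setT H.
  by rewrite /H -restrict_EFin; apply/integrable_restrict => //=; rewrite setTI.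
pose A := [set p : R * R | p.2 <= p.1].
have mA : measurable A.
  by have := measurable_fun_le measurableT (@measurable_snd _ _ R R) (@measurable_fst _ _ R R);
    rewrite setTI.
pose K p : R := G p.1 * H p.2 * \1_A p.
have inner1 s : (\int[mu]_t (K (s, t))%:E = (G s * \int[mu]_(t in `]0, s]) h t)%:E)%E.
  have [Is|nIs] := pselect (I s); last first.
    have G0 : G s = 0 by rewrite /G patchE memNset.
    rewrite G0 mul0r.
    by under eq_integral do rewrite /K /= G0 !mul0r; rewrite integral0.
  have ss : `]0, s]%classic `<=` I.
    by apply: subset_itvl; move: Is; rewrite /I/= in_itv/= bnd_simp => /andP[].
  have ihs : intg `]0, s]%classic h by apply: integrableS ih.
  rewrite EFinM /Rintegral fineK; last exact: integrable_fin_num.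
  rewrite integral_mkcond -integralZl//; last first.
    by apply/integrable_restrict => //=; rewrite setTI.
  apply: eq_integral => t _; rewrite /K /= /H restrict_EFin -EFinM !patchE -mulrA; congr (_ * _)%:E.
  rewrite indicE; have [ts|ts] := boolP (t \in `]0, s]%classic).
    have It : t \in I by apply/mem_set/ss/set_mem.
    have At : (s, t) \in A.
      by apply/mem_set; move: ts => /set_mem; rewrite /A/= in_itv/= => /andP[].
    by rewrite It At mulr1.
  have [It|It] := boolP (t \in I); last by rewrite mul0r.
  rewrite memNset ?mulr0// /A/= => tls; move/negP: ts; apply; apply/mem_set.
  by move: It => /set_mem; rewrite /I/= !in_itv/= tls => /andP[-> _].
have inner2 t : (\int[mu]_s (K (s, t))%:E = (H t * (\int[mu]_(s in I) g s - \int[mu]_(s in `]0,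
  t]) g s))%:E)%E.
  have [It|nIt] := pselect (I t); last first.
    have H0 : H t = 0 by rewrite /H patchE memNset.
    rewrite H0 mul0r.
    by under eq_integral do rewrite /K /= H0 mulr0 !mul0r; rewrite integral0.
  have /andP[t0 tX] : (0 < t) && (t <= X) by move: It; rewrite /I/= in_itv.
  have ig' : intg `]t, X]%classic g.
    by apply: integrableS ig => //; apply: subset_itvr; rewrite bnd_simp ltW.
  rewrite Rintegral_itvB ?bnd_simp//; last exact: ltW.
  rewrite Rintegral_itv_obnd_cbnd//.
  have ig'' : intg `[t, X]%classic g.
    by apply: integrableS ig => //; apply: subset_itvr; rewrite bnd_simp.
  rewrite EFinM /Rintegral fineK; last exact: integrable_fin_num.
  rewrite integral_mkcond -integralZl//; last first.
    by apply/integrable_restrict => //=; rewrite setTI.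
  apply: eq_integral => s _; rewrite /K /= /G restrict_EFin -EFinM !patchE.
  rewrite (mulrC _ (H t)) -mulrA; congr (_ * _)%:E.
  rewrite indicE; have [ts|ts] := boolP (s \in `[t, X]%classic).
    move: ts => /set_mem; rewrite /= in_itv/= => /andP[ts sX].
    have Is : s \in I.
      by apply/mem_set; rewrite /I/= in_itv/= sX andbT; exact: lt_le_trans t0 ts.
    have At : (s, t) \in A by exact/mem_set.
    by rewrite Is At mulr1.
  have [Is|Is] := boolP (s \in I); last by rewrite mul0r.
  rewrite memNset ?mulr0// /A/= => tls; move/negP: ts; apply; apply/mem_set.
  by move: Is => /set_mem; rewrite /I/= !in_itv/= tls => /andP[_ ->].
rewrite /Rintegral integral_mkcond [in RHS]integral_mkcond; congr fine.
transitivity (\int[mu]_s \int[mu]_t (K (s, t))%:E)%E.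
  apply: eq_integral => s _; rewrite inner1 restrict_EFin; congr EFin.
  by rewrite /G !patchE; case: ifP => // _; rewrite mul0r.
rewrite (fubini_weighted iG iH mA); apply: eq_integral => t _; rewrite inner2 restrict_EFin;
  congr EFin.
by rewrite /H !patchE; case: ifP => // _; rewrite mul0r.
Qed.
Lemma ae_imply (P Q : R -> Prop) : (forall x, P x -> Q x) ->
  {ae mu, forall x, P x} -> {ae mu, forall x, Q x}.
Proof. by move=> PQ; apply: filterS => //; exact: (ae_filter_ringOfSetsType mu). Qed.

Lemma ae_imply2 (P Q S : R -> Prop) : (forall x, P x -> Q x -> S x) ->
  {ae mu, forall x, P x} -> {ae mu, forall x, Q x} -> {ae mu, forall x, S x}.
Proof. by move=> PQ; apply: filterS2 => //; exact: (ae_filter_ringOfSetsType mu). Qed.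
End Primitive.

(** * Absolutely continuous functions on the half-line *)

Section Prim.
Variable R : realType.
Implicit Types (f g h : R -> R) (a b x : R).
Local Notation mu := (@lebesgue_measure R).
Local Notation intg D f := (mu.-integrable D (EFin \o f)).

Lemma lebesgue_segment_lty a x : (mu `]a, x] < +oo)%E.
Proof. by rewrite lebesgue_measure_itv /=; case: ifP => _; rewrite ?ltry -?EFinB ?ltry. Qed.

Lemma halfline_segment x : `]0, x]%classic `<=` @halfline R.
Proof. exact: subset_itvl. Qed.

Lemma measurable_halfline : measurable (@halfline R).
Proof. exact: measurable_itv. Qed.

Lemma within_halfline_segments f :
  (forall b, 0 < b -> {within `[0, b], continuous f}) ->
  {within @halfline_closed R, continuous f}.
Proof.
move=> cf; apply/continuous_within_itvcyP; split.
  move=> x; rewrite in_itv/= andbT => x0.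
  apply: (@within_continuous_continuous R R _ 0 (x + 1)); first by lra.
    by apply: cf; lra.
  by rewrite in_itv/=; apply/andP; split; lra.
by have /continuous_within_itvP-/(_ ltr01)[] := cf 1 ltr01.
Qed.

Lemma within_halfline_segment f b : {within @halfline_closed R, continuous f} ->
  {within `[0, b], continuous f}.
Proof. by apply: continuous_subspaceW; exact: subset_itvl. Qed.

Lemma within_halfline_integrable f b : {within @halfline_closed R, continuous f} ->
  intg `]0, b]%classic f.
Proof.
move=> cf; apply: (@integrableS _ _ _ mu `[0, b]%classic) => //.
  exact: subset_itv_oc_cc.
by apply: continuous_compact_integrable; [exact: segment_compact|exact: within_halfline_segment].
Qed.

Lemma within_halfline_measurable f : {within @halfline_closed R, continuous f} ->
  measurable_fun (@halfline R) f.
Proof.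
move=> cf; apply: (@measurable_funS _ _ _ _ (@halfline_closed R)).
- exact: measurable_itv.
- by apply: subset_itvr; rewrite bnd_simp.
- by apply: subspace_continuous_measurable_fun => //; exact: measurable_itv.
Qed.

Lemma integrable_halfline_supp (f : R -> R) X : {within @halfline_closed R, continuous f} ->
  (forall x, X < x -> f x = 0) -> intg (@halfline R) f.
Proof.
move=> cf f0.
have /integrableP[m i] := @within_halfline_integrable f X cf.
have mf := within_halfline_measurable cf.
apply/integrableP; split; first exact/measurable_EFinP.
apply: le_lt_trans i; rewrite integral_mkcond [leRHS]integral_mkcond le_eqVlt; apply/orP; left;
  apply/eqP.
apply: eq_integral => x _; rewrite !patchE.
have [xb|bx] := leP x X.
  by rewrite !mem_setE /halfline !in_itv/= xb andbT.
by rewrite /= f0// normr0 !if_same.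
Qed.

Lemma within_halfline_ge0 f x : {within @halfline_closed R, continuous f} ->
  0 < x -> {for x, continuous f}.
Proof.
move=> /continuous_within_itvcyP[cf _] x0; apply: cf.
by rewrite in_itv/= andbT.
Qed.

Lemma Rintegral_segment0 g : \int[mu]_(t in `]0, 0]) g t = 0.
Proof. by rewrite set_itv_ge ?bnd_simp// Rintegral_set0. Qed.

Definition locally_integrable g := forall x, intg `]0, x]%classic g.

(** Absolute continuity on every [0, x], with derivative g. The values of f on the negative axis are left
free, as functions on the half-line are represented by functions on R. *)
Definition primitive f g :=
  locally_integrable g /\
  forall x, 0 <= x -> f x = f 0 + \int[mu]_(t in `]0, x]) g t.

Lemma Rintegral_halfline_supp X g : (forall x, X < x -> g x = 0) ->
  \int[mu]_(x in @halfline R) g x = \int[mu]_(x in `]0, X]) g x.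
Proof.
move=> g0; rewrite Rintegral_mkcond [in RHS]Rintegral_mkcond.
apply: eq_Rintegral => x _; rewrite !patchE.
have [xX|xX] := leP x X; last by rewrite g0// !if_same.
by rewrite !mem_setE /halfline !in_itv/= xX andbT.
Qed.

Lemma primitive_integral g : locally_integrable g ->
  primitive (fun x => \int[mu]_(t in `]0, x]) g t) g.
Proof.
move=> ig; split=> // x _.
by rewrite Rintegral_segment0 add0r.
Qed.

Lemma primitive_continuous f g : primitive f g ->
  {within @halfline_closed R, continuous f}.
Proof.
move=> [ig fE]; apply: within_halfline_segments => b b0.
have ig0 : intg `[0, b]%classic g.
  have /integrableP[mg gl] := ig b; apply/integrableP; split.
    by apply/measurable_EFinP/measurable_fun_itv_obnd_cbndP/measurable_EFinP.
  rewrite -integral_itv_obnd_cbnd//; apply: measurableT_comp => //.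
have cF := parameterized_integral_continuous (ltW b0) ig0.
have : {within `[0, b], continuous (fun x => f 0 + parameterized_integral mu 0 x g)}.
  by move=> x; apply: cvgD; [exact: cvg_cst|exact: cF].
apply: subspace_eq_continuous => x /set_mem; rewrite /= in_itv/= => /andP[x0 xb].
by rewrite /from_subspace (fE x x0) Rintegral_itv_obnd_cbnd.
Qed.

Lemma primitive_eq_fun f f' g : (forall x, 0 <= x -> f x = f' x) ->
  primitive f g -> primitive f' g.
Proof. by move=> ff' [ig fE]; split=> // x x0; rewrite -!ff'// fE. Qed.

Lemma primitive_eq f g g' : (forall x, 0 < x -> g x = g' x) ->
  primitive f g -> primitive f g'.
Proof.
move=> gg' [ig fE]; split=> [x|x x0].
  apply: integrable_ext (ig x) => // y; rewrite /= in_itv/= => /andP[y0 _].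
  exact: gg'.
rewrite fE//; congr (_ + _); apply: eq_Rintegral => y /set_mem.
by rewrite /= in_itv/= => /andP[y0 _]; exact: gg'.
Qed.

Lemma primitiveD f g h k : primitive f g -> primitive h k ->
  primitive (fun x => f x + h x) (fun x => g x + k x).
Proof.
move=> [ig fE] [ik hE]; split=> [x|x x0]; first exact: integrable_add.
by rewrite fE// hE// RintegralD//; ring.
Qed.

Lemma primitiveZ a f g : primitive f g ->
  primitive (fun x => a * f x) (fun x => a * g x).
Proof.
move=> [ig fE]; split=> [x|x x0]; first exact: integrable_scale.
by rewrite fE// RintegralZl//; ring.
Qed.

Lemma primitiveN f g : primitive f g -> primitive (fun x => - f x) (fun x => - g x).
Proof.
move=> /(primitiveZ (-1)).
by congr primitive; apply/funext => x; rewrite mulN1r.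
Qed.

Lemma primitiveB f g h k : primitive f g -> primitive h k ->
  primitive (fun x => f x - h x) (fun x => g x - k x).
Proof. by move=> fg /primitiveN; exact: primitiveD. Qed.

Lemma locally_integrable_mul g h : locally_integrable g ->
  {within @halfline_closed R, continuous h} -> locally_integrable (fun x => g x * h x).
Proof.
move=> ig ch x.
have [B hB] : exists B, forall y, y \in `[0, x] -> `|h y| <= B.
  have : compact (h @` `[0, x]).
    by apply: continuous_compact; [exact: within_halfline_segment|exact: segment_compact].
  move/compact_bounded => [B [_ /(_ (B + 1))]] hB; exists (B + 1) => y y0x.
  by apply: hB; [lra|exists y].
apply: (@integrable_le _ _ _ (fun y => B * `|g y|)) => //.
- apply: measurable_funM; first exact: integrable_measurable (ig x).
  apply: measurable_funS (within_halfline_measurable ch); first exact: measurable_itv.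
  exact: halfline_segment.
- move=> y; rewrite /= in_itv/= => /andP[y0 yx].
  by rewrite normrM mulrC ler_wpM2r// hB// in_itv/= yx ltW.
- by apply: integrable_scale => //; apply: integrable_norm.
Qed.

(** After splitting off the initial values f 0 and h 0, the integral of the two terms of the product rule
is the integral of g s * k t over two complementary triangles of the square [0, X]^2. *)
Lemma primitiveM f g h k : primitive f g -> primitive h k ->
  primitive (fun x => f x * h x) (fun x => g x * h x + f x * k x).
Proof.
move=> pf ph; have cf := primitive_continuous pf; have ch := primitive_continuous ph.
have [ig fE] := pf; have [ik hE] := ph.
have igh := locally_integrable_mul ig ch.
have ifk : locally_integrable (fun x => f x * k x).
  by move=> x; apply: integrable_ext (locally_integrable_mul ik cf x) => // y _; rewrite mulrC.
split=> [x|X X0]; first exact: integrable_add.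
rewrite RintegralD//.
pose G x := \int[mu]_(t in `]0, x]) g t; pose K x := \int[mu]_(t in `]0, x]) k t.
have cG : {within @halfline_closed R, continuous G}.
  by apply: (@primitive_continuous _ g); exact: primitive_integral.
have cK : {within @halfline_closed R, continuous K}.
  by apply: (@primitive_continuous _ k); exact: primitive_integral.
have igK : locally_integrable (fun x => g x * K x) by exact: locally_integrable_mul.
have ikG : locally_integrable (fun x => k x * G x) by exact: locally_integrable_mul.
have E1 : \int[mu]_(t in `]0, X]) (g t * h t) = h 0 * G X + \int[mu]_(t in `]0, X]) (g t * K t).
  rewrite -RintegralZl// -RintegralD//; last exact: integrable_scale.
  apply: eq_Rintegral => y /set_mem; rewrite /= in_itv/= => /andP[y0 _].
  by rewrite (hE y (ltW y0)); rewrite /K; ring.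
have E2 : \int[mu]_(t in `]0, X]) (f t * k t) = f 0 * K X + \int[mu]_(t in `]0, X]) (k t * G t).
  rewrite -RintegralZl// -RintegralD//; last exact: integrable_scale.
  apply: eq_Rintegral => y /set_mem; rewrite /= in_itv/= => /andP[y0 _].
  by rewrite (fE y (ltW y0)); rewrite /G; ring.
rewrite E1 E2 (Rintegral_fubini_triangle X0 (ig X) (ik X)).
have -> : \int[mu]_(t in `]0, X]) (k t * (\int[mu]_(s in `]0, X]) g s - \int[mu]_(s in `]0,
  t]) g s))
  = G X * K X - \int[mu]_(t in `]0, X]) (k t * G t).
  rewrite -RintegralZl// -RintegralB//; last exact: integrable_scale.
  by apply: eq_Rintegral => y _; rewrite /G; ring.
by rewrite (fE X X0) (hE X X0) -/(G X) -/(K X); ring.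
Qed.

Lemma primitive_derive f g : (forall x, is_derive x 1 f (g x)) -> continuous g ->
  primitive f g.
Proof.
move=> df cg.
have cf : continuous f.
  by move=> x; apply: differentiable_continuous; apply/derivable1_diffP; have [] := df x.
have cgw : {within @halfline_closed R, continuous g} by apply: continuous_subspaceT.
split=> [x|x]; first exact: within_halfline_integrable.
rewrite le_eqVlt => /predU1P[<-|x0].
  by rewrite Rintegral_segment0 addr0.
rewrite Rintegral_itv_obnd_cbnd; last exact: within_halfline_integrable.
rewrite /Rintegral (@continuous_FTC2 _ g f 0 x)//=.
- by ring.
- exact: continuous_subspaceT.
- split.
  + by move=> y _; have [] := df y.
  + by apply: cvg_at_right_filter; exact: cf.
  + by apply: cvg_at_left_filter; exact: cf.
- by move=> y _; rewrite derive1E; apply: derive_val.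
Qed.

Lemma primitive_cst a : primitive (fun=> a) (fun=> 0).
Proof. by apply: primitive_derive => x; exact: cvg_cst. Qed.

Lemma test_function_primitive phi : test_function phi -> primitive phi (derive1 phi).
Proof.
move=> [dphi cphi _]; apply: primitive_derive => // x.
by apply: DeriveDef => //; rewrite derive1E.
Qed.

Lemma test_function_support phi : test_function phi -> phi 0 = 0 /\
  exists X, 0 < X /\ forall x, X <= x -> phi x = 0 /\ derive1 phi x = 0.
Proof.
move=> [_ _ [a [b [a0 phi0]]]]; split; first by apply: phi0; lra.
exists (`|b| + 1); split=> [|x xX]; first by have := normr_ge0 b; lra.
have bx : b < x by have := ler_norm b; lra.
split; first by apply: phi0; lra.
rewrite derive1E; have -> : 'D_1 phi x = 'D_1 (cst 0 : R -> R) x.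
  apply: near_eq_derive; near=> y; apply: phi0.
  suff : b < y by lra.
  by near: y; exact: lt_nbhsr.
exact: derive_cst.
Unshelve. all: by end_near. Qed.

(** The product f * phi is absolutely continuous and vanishes at 0 and beyond the support of phi, so its
derivative has integral 0. *)
Lemma primitive_weak f g : primitive f g -> weak_derivative f g.
Proof.
move=> pf phi tphi; have pphi := test_function_primitive tphi.
have [phi0 [X [X0 phiX]]] := test_function_support tphi.
have [_ /(_ X (ltW X0))] := primitiveM pf pphi.
rewrite phi0 (phiX X (lexx _)).1 !mulr0 add0r.
have cf := primitive_continuous pf; have cphi := primitive_continuous pphi.
have igp := locally_integrable_mul pf.1 cphi.
rewrite RintegralD//; last first.
  by apply: integrable_ext (locally_integrable_mul pphi.1 cf X) => // y _; rewrite mulrC.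
rewrite !(@Rintegral_halfline_supp X); first by lra.
- by move=> x /ltW/phiX[-> _]; rewrite mulr0.
- by move=> x /ltW/phiX[_ ->]; rewrite mulr0.
Qed.
End Prim.

(** * The lemma of du Bois-Reymond *)

Section DuBoisReymond.
Variable R : realType.
Implicit Types (f g h : R -> R) (a b d x y : R).
Local Notation mu := (@lebesgue_measure R).
Local Notation intg D f := (mu.-integrable D (EFin \o f)).

(** The difference quotient with increment h is within |h| of 2|x|, also across the kink at 0. Second
differences of this function give the C^1 piecewise quadratic test functions used below. *)
Lemma is_derive_mul_norm x : is_derive x 1 (fun y : R => y * `|y|) (2 * `|x|).
Proof.
have bnd (h : R) : `|(x + h) * `|x + h| - x * `|x| - h * (2 * `|x|)| <= h ^+ 2.
  rewrite ler_norml.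
  case: (lerP 0 x) => x0; case: (lerP 0 (x + h)) => xh0;
  rewrite ?(ger0_norm x0) ?(ger0_norm xh0) ?(ltr0_norm x0) ?(ltr0_norm xh0); apply/andP; split; nra.
suff : h^-1 *: ((x + h) * `|x + h| - x * `|x|) @[h --> 0^'] --> (2 * `|x| : R).
  move=> cv; apply: DeriveDef.
    apply/cvg_ex; exists (2 * `|x|) => /=.
    move: cv; apply: cvg_trans; apply: near_eq_cvg; near=> h.
    by rewrite /= /GRing.scale/= mulr1 (addrC h).
  rewrite /derive; apply/cvg_lim => //.
  move: cv; apply: cvg_trans; apply: near_eq_cvg; near=> h.
  by rewrite /= /GRing.scale/= mulr1 (addrC h).
apply/cvgrPdist_le => /= e e0; near=> h.
have h0 : h != 0 by near: h; exact: nbhs_dnbhs_neq.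
have he : `|h| <= e.
  near: h; apply: dnbhs0_le => //.
have -> : 2 * `|x| - h^-1 *: ((x + h) * `|x + h| - x * `|x|) =
  - (h^-1 * ((x + h) * `|x + h| - x * `|x| - h * (2 * `|x|))).
  by rewrite /GRing.scale/=; field.
rewrite normrN normrM; apply: le_trans he.
rewrite normfV -[leRHS](mulKf (x := `|h|)) ?normr_eq0// ler_pM2l ?invr_gt0 ?normr_gt0//.
by rewrite -expr2 real_normK ?num_real.
Unshelve. all: by end_near. Qed.

(** The piecewise linear tent max (0, 1 - |x|), written as a second difference of |x|. *)
Definition hat x := (`|x + 1| - 2 * `|x| + `|x - 1|) / 2.

(** The antiderivative of the tent that is 0 for x <= -1 and 1 for x >= 1. *)
Definition smooth_step x :=
  ((x + 1) * `|x + 1| - 2 * (x * `|x|) + (x - 1) * `|x - 1|) / 4 + 1 / 2.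

Lemma hat_ge0 x : 0 <= hat x.
Proof. by rewrite /hat; case: (ger0P (x + 1)); case: (ger0P x); case: (ger0P (x - 1)) => *;
  lra. Qed.

Lemma hat_le1 x : hat x <= 1.
Proof. by rewrite /hat; case: (ger0P (x + 1)); case: (ger0P x); case: (ger0P (x - 1)) => *;
  lra. Qed.

Lemma hat_eq0 x : 1 <= `|x| -> hat x = 0.
Proof. by rewrite /hat; case: (ger0P (x + 1)); case: (ger0P x); case: (ger0P (x - 1)) => *;
  lra. Qed.

Lemma hat_continuous : continuous hat.
Proof.
move=> x; apply: cvgM; last exact: cvg_cst.
apply: cvgD; first apply: cvgB.
- by apply: (@continuous_comp _ _ _ (fun x : R => x + 1) Num.norm) ; [apply: cvgD;
  [exact: cvg_id|exact: cvg_cst]|exact: norm_continuous].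
- by apply: cvgM; [exact: cvg_cst|exact: norm_continuous].
- by apply: (@continuous_comp _ _ _ (fun x : R => x - 1) Num.norm) ; [apply: cvgD;
  [exact: cvg_id|exact: cvg_cst]|exact: norm_continuous].
Qed.

Lemma smooth_step_eq0 x : x <= -1 -> smooth_step x = 0.
Proof. by rewrite /smooth_step; case: (ger0P (x + 1)); case: (ger0P x);
  case: (ger0P (x - 1)) => *; nra. Qed.

Lemma smooth_step_eq1 x : 1 <= x -> smooth_step x = 1.
Proof. by rewrite /smooth_step; case: (ger0P (x + 1)); case: (ger0P x);
  case: (ger0P (x - 1)) => *; nra. Qed.

Lemma is_derive_smooth_step x : is_derive x 1 smooth_step (hat x).
Proof.
have d0 := is_derive_mul_norm x.
have dp : is_derive x 1 (fun y : R => (y + 1) * `|y + 1|) (2 * `|x + 1|).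
  have d1 : is_derive x 1 (fun y : R => y + 1) 1.
    by apply: is_derive_eq; rewrite addr0.
  have := @is_derive1_comp _ (fun y : R => y * `|y|) (fun y =>
    y + 1) x _ _ (is_derive_mul_norm (x + 1)) d1.
  by rewrite mulr1.
have dm : is_derive x 1 (fun y : R => (y - 1) * `|y - 1|) (2 * `|x - 1|).
  have d1 : is_derive x 1 (fun y : R => y - 1) 1.
    by apply: is_derive_eq; rewrite subr0.
  have := @is_derive1_comp _ (fun y : R => y * `|y|) (fun y =>
    y - 1) x _ _ (is_derive_mul_norm (x - 1)) d1.
  by rewrite mulr1.
have := is_deriveD (is_deriveZ (4^-1) (is_deriveD (is_deriveB dp (is_deriveZ 2 d0)) dm))
  (is_derive_cst (1 / 2 : R) x 1).
rewrite addr0 => D.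
have -> : smooth_step = (4^-1 \*: (((fun y : R => (y + 1) * `|y + 1|) - 2 \*: (fun y : R =>
  y * `|y|)) + (fun y : R => (y - 1) * `|y - 1|)) + cst (1 / 2)).
  by apply/funext => y; rewrite /smooth_step/= !fctE/= /GRing.scale/=; ring.
by apply: is_derive_eq; rewrite /hat /GRing.scale/=; field.
Qed.

Definition step d a x := smooth_step ((x - a) / d).

Definition bump d a x := hat ((x - a) / d) / d.

Lemma is_derive_step d a x : is_derive x 1 (step d a) (bump d a x).
Proof.
have d1 : is_derive x 1 (fun y : R => (y - a) / d) (d^-1).
  have -> : (fun y : R => (y - a) / d) = (d^-1 \*: (fun y : R => y - a)).
    by apply/funext => y; rewrite mulrC.
  by apply: is_derive_eq; rewrite /GRing.scale/= subr0 mulr1.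
have := @is_derive1_comp _ smooth_step (fun y => (y - a) / d) x _ _ (is_derive_smooth_step _) d1.
exact.
Qed.

Lemma bump_continuous d a : continuous (bump d a).
Proof.
move=> x; apply: cvgM; last exact: cvg_cst.
apply: (@continuous_comp _ _ _ (fun x => (x - a) / d) hat); last exact: hat_continuous.
by apply: cvgM; [apply: cvgB; [exact: cvg_id|exact: cvg_cst]|exact: cvg_cst].
Qed.

Lemma bump_ge0 d a x : 0 < d -> 0 <= bump d a x.
Proof. by move=> d0; rewrite divr_ge0 ?hat_ge0// ltW. Qed.

Lemma bump_eq0 d a x : 0 < d -> d <= `|x - a| -> bump d a x = 0.
Proof.
move=> d0 dx; rewrite /bump hat_eq0 ?mul0r//.
by rewrite normrM normfV (gtr0_norm d0) ler_pdivlMr// mul1r.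
Qed.

Lemma step_eq0 d a x : 0 < d -> x <= a - d -> step d a x = 0.
Proof. by move=> d0 xa; rewrite /step smooth_step_eq0// ler_pdivrMr//; lra. Qed.

Lemma step_eq1 d a x : 0 < d -> a + d <= x -> step d a x = 1.
Proof. by move=> d0 xa; rewrite /step smooth_step_eq1// ler_pdivlMr//; lra. Qed.

Lemma primitive_step d a : primitive (step d a) (bump d a).
Proof. by apply: primitive_derive; [exact: is_derive_step|exact: bump_continuous]. Qed.

Lemma derive1_stepB d a b : derive1 (fun x => step d a x - step d b x) = fun x =>
  bump d a x - bump d b x.
Proof.
apply/funext => x; rewrite derive1E.
have := is_deriveB (is_derive_step d a x) (is_derive_step d b x).
by move=> D; rewrite (@derive_val _ _ _ _ _ _ _ D).
Qed.

Lemma test_function_stepB d a b : 0 < d -> d < a -> d < b ->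
  test_function (fun x => step d a x - step d b x).
Proof.
move=> d0 da db; split.
- move=> x; have := is_deriveB (is_derive_step d a x) (is_derive_step d b x).
  by move=> D; apply: ex_derive.
- rewrite derive1_stepB => x.
  by apply: cvgB; exact: bump_continuous.
- exists (Num.min a b - d), (Num.max a b + d); split; first by rewrite subr_gt0 lt_min da.
  move=> x /negP; rewrite negb_and -!ltNge => /orP[xa|xb].
    have : x + d < Num.min a b by lra.
    by rewrite lt_min => /andP[? ?]; rewrite !step_eq0 ?subrr//; lra.
  have : Num.max a b < x - d by lra.
  by rewrite gt_max => /andP[? ?]; rewrite !step_eq1 ?subrr//; lra.
Qed.

(** The bumps have integral 1 and shrink to the point a, so they form an approximate identity. *)
Lemma bump_mean f a X e : {within @halfline_closed R, continuous f} ->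
  0 < a -> a < X -> 0 < e ->
  \forall d \near 0^'+, `|\int[mu]_(x in `]0, X]) (f x * bump d a x) - f a| <= e.
Proof.
move=> cf a0 aX e0.
have /cvgrPdist_le/(_ e e0)/nbhs_ballP[r /= r0 fr] := within_halfline_ge0 cf a0.
near=> d.
have d0 : 0 < d by [].
have da : d < a by near: d; exact: nbhs_right_lt.
have daX : d < X - a by near: d; apply: nbhs_right_lt; rewrite subr_gt0.
have dr : d < r by near: d; exact: nbhs_right_lt.
have cb : {within @halfline_closed R, continuous (bump d a)}.
  by apply: continuous_subspaceT; exact: bump_continuous.
have ib : intg `]0, X]%classic (bump d a) by exact: within_halfline_integrable.
have b1 : \int[mu]_(x in `]0, X]) bump d a x = 1.
  have := (primitive_step d a).2 X (ltW (lt_trans a0 aX)).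
  by rewrite step_eq1//; last lra; rewrite step_eq0//; [lra|lra].
have ifb : intg `]0, X]%classic (fun x => f x * bump d a x).
  apply: integrable_ext (locally_integrable_mul (primitive_step d a).1 cf X) => // y _.
  by rewrite mulrC.
have -> : f a = \int[mu]_(x in `]0, X]) (f a * bump d a x).
  by rewrite RintegralZl// b1 mulr1.
rewrite -RintegralB//; last exact: integrable_scale.
have -> : e = \int[mu]_(x in `]0, X]) (e * bump d a x).
  by rewrite RintegralZl// b1 mulr1.
have idiff : intg `]0, X]%classic (fun x => f x * bump d a x - f a * bump d a x).
  by apply: integrable_sub => //; exact: integrable_scale.
apply: (le_trans (le_normr_Rintegral _ _)) => //.
apply: le_Rintegral => //.
- exact: integrable_norm.
- exact: integrable_scale.
move=> x _; rewrite -mulrBl normrM (ger0_norm (bump_ge0 _ _ d0)).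
have [xd|dx] := ltP `|x - a| d; last by rewrite bump_eq0// !mulr0.
apply: ler_wpM2r; first exact: bump_ge0.
by rewrite distrC; apply: fr; rewrite /ball/= distrC; lra.
Unshelve. all: by end_near. Qed.

(** The test function step d a - step d b has the derivative bump d a - bump d b; as d tends to 0 the
hypothesis becomes f a - f b = 0. *)
Lemma du_bois_reymond f : {within @halfline_closed R, continuous f} ->
  (forall phi, test_function phi -> \int[mu]_(x in @halfline R) (f x * derive1 phi x) = 0) ->
  forall x, 0 <= x -> f x = f 0.
Proof.
move=> cf f0.
have pos a b : 0 < a -> 0 < b -> f a = f b.
  move=> a0 b0; apply/eqP; rewrite -subr_eq0 -normr_eq0 eq_le normr_ge0 andbT.
  apply/ler_addgt0Pl => e e0; rewrite addr0.
  pose X := Num.max a b + 1.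
  have aX : a < X by have : a <= Num.max a b; [rewrite le_max lexx|rewrite /X; lra].
  have bX : b < X by have : b <= Num.max a b; [rewrite le_max lexx orbT|rewrite /X; lra].
  have e2 : 0 < e / 2 by lra.
  near (0 : R)^'+ => d.
  have d0 : 0 < d by [].
  have da : d < a by near: d; exact: nbhs_right_lt.
  have db : d < b by near: d; exact: nbhs_right_lt.
  have d1 : d < 1 by near: d; exact: nbhs_right_lt.
  have Ea : `|\int[mu]_(x in `]0, X]) (f x * bump d a x) - f a| <= e / 2.
    by near: d; exact: bump_mean.
  have Eb : `|\int[mu]_(x in `]0, X]) (f x * bump d b x) - f b| <= e / 2.
    by near: d; exact: bump_mean.
  have ifb c : intg `]0, X]%classic (fun x => f x * bump d c x).
    apply: integrable_ext (locally_integrable_mul (primitive_step d c).1 cf X) => // y _.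
    by rewrite mulrC.
  have := f0 _ (test_function_stepB d0 da db).
  rewrite derive1_stepB (@Rintegral_halfline_supp _ X); last first.
    move=> x Xx; have a1X : a + 1 <= X by rewrite /X lerD2r le_max lexx.
    have b1X : b + 1 <= X by rewrite /X lerD2r le_max lexx orbT.
    by rewrite !bump_eq0 ?subrr ?mulr0//; rewrite ger0_norm; lra.
  under eq_Rintegral do rewrite mulrBr.
  rewrite RintegralB// => /eqP; rewrite subr_eq0 => /eqP Eab.
  by move: Ea Eb; rewrite Eab !ler_norml => /andP[? ?] /andP[? ?]; apply/andP; split; lra.
move=> x; rewrite le_eqVlt => /predU1P[<-//|x0].
have /continuous_within_itvcyP[_ c0] := cf.
apply/esym; apply: (cvg_unique _ c0) => //.
apply: cvg_trans (@cvg_cst _ (f x) _ (0 : R)^'+ _).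
by apply: near_eq_cvg; near=> y; apply: pos.
Unshelve. all: by end_near. Qed.

(** The integral of g over (0, x] has the same weak derivative as the continuous representative fc, so the
two differ by a constant. *)
Lemma weak_primitive f fc g : measurable_fun (@halfline R) f ->
  {within @halfline_closed R, continuous fc} ->
  {ae mu, forall x, halfline x -> f x = fc x} ->
  locally_integrable g -> weak_derivative f g -> primitive fc g.
Proof.
move=> mf cf ffc ig wfg.
pose F x := \int[mu]_(t in `]0, x]) g t.
have pF : primitive F g by exact: primitive_integral.
have cF := primitive_continuous pF.
suff fcF : forall x, 0 <= x -> fc x - F x = fc 0 - F 0.
  split=> // x x0; have := fcF x x0.
  by rewrite {2}/F Rintegral_segment0 -/(F x); lra.
apply: (@du_bois_reymond (fun x => fc x - F x)) => [y|phi tphi].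
  by apply: cvgB; [exact: cf|exact: cF].
have pphi := test_function_primitive tphi.
have [phi0 [X [X0 phiX]]] := test_function_support tphi.
have ic h : {within @halfline_closed R, continuous h} ->
  intg `]0, X]%classic (fun x => h x * derive1 phi x).
  move=> ch; apply: integrable_ext (locally_integrable_mul pphi.1 ch X) => // y _.
  by rewrite mulrC.
rewrite (@Rintegral_halfline_supp _ X); last first.
  by move=> x /ltW/phiX[_ ->]; rewrite mulr0.
under eq_Rintegral do rewrite mulrBl.
rewrite RintegralB//; [|exact: ic|exact: ic].
have := primitive_weak pF tphi; rewrite -(wfg _ tphi).
rewrite [in LHS](@Rintegral_halfline_supp _ X); last first.
  by move=> x /ltW/phiX[_ ->]; rewrite mulr0.
move=> ->; apply/eqP; rewrite subr_eq0; apply/eqP.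
rewrite -(@Rintegral_halfline_supp _ X); last first.
  by move=> x /ltW/phiX[_ ->]; rewrite mulr0.
have mphi : measurable_fun (@halfline R) (derive1 phi).
  by apply: measurable_funTS; apply: continuous_measurable_fun; case: tphi.
rewrite /Rintegral; congr fine; apply: ae_eq_integral.
- exact: measurable_halfline.
- by apply/measurable_EFinP; apply: measurable_funM => //; exact: within_halfline_measurable.
- by apply/measurable_EFinP; apply: measurable_funM.
- by apply: ae_imply ffc => x fx hx; rewrite fx.
Qed.

End DuBoisReymond.

(** * Complex plane vectors and 2x2 matrices *)

Section ComplexVectors.
Variable R : realType.
Local Notation C := R[i].
Local Notation nc := (@Normc.normc R).
Implicit Types (a b : C) (u v w : 'cV[C]_2) (A B : 'M[C]_2).

Lemma ReD a b : complex.Re (a + b) = complex.Re a + complex.Re b.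
Proof. by case: a b => [? ?] [? ?]. Qed.
Lemma ImD a b : complex.Im (a + b) = complex.Im a + complex.Im b.
Proof. by case: a b => [? ?] [? ?]. Qed.
Lemma ReN a : complex.Re (- a) = - complex.Re a.
Proof. by case: a. Qed.
Lemma ImN a : complex.Im (- a) = - complex.Im a.
Proof. by case: a. Qed.
Lemma ReM a b : complex.Re (a * b) = complex.Re a * complex.Re b - complex.Im a * complex.Im b.
Proof. by case: a b => [? ?] [? ?]. Qed.
Lemma ImM a b : complex.Im (a * b) = complex.Re a * complex.Im b + complex.Im a * complex.Re b.
Proof. by case: a b => [? ?] [? ?]. Qed.
Definition ReImE := (ReD, ImD, ReN, ImN, ReM, ImM).

Lemma complex_eq a b : complex.Re a = complex.Re b -> complex.Im a = complex.Im b -> a = b.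
Proof. by case: a b => [? ?] [? ?] /= -> ->. Qed.

Lemma nc_ge0 a : 0 <= nc a.
Proof. by case: a => x y; exact: sqrtr_ge0. Qed.

Lemma sqr_nc a : nc a ^+ 2 = complex.Re a ^+ 2 + complex.Im a ^+ 2.
Proof. by case: a => x y; rewrite /= sqr_sqrtr// addr_ge0// sqr_ge0. Qed.

Lemma nc_eq0 a : (nc a == 0) = (a == 0).
Proof.
apply/eqP/eqP => [|->]; first exact: Normc.eq0_normc.
exact: Normc.normc0.
Qed.

Lemma nc_gt0 a : (0 < nc a) = (a != 0).
Proof. by rewrite lt_neqAle nc_ge0 andbT eq_sym nc_eq0. Qed.

Lemma nc_realM (x : R) a : nc (x%:C * a) = `|x| * nc a.
Proof. by rewrite Normc.normcM /= expr0n/= addr0 sqrtr_sqr. Qed.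

Lemma nc_real (x : R) : nc x%:C = `|x|.
Proof. by rewrite /= expr0n/= addr0 sqrtr_sqr. Qed.

Lemma normr_Re_le a : `|complex.Re a| <= nc a.
Proof.
rewrite -(ler_sqr (normr_ge0 _) (nc_ge0 _)) sqr_nc real_normK ?num_real//.
by rewrite lerDl sqr_ge0.
Qed.

Lemma normr_Im_le a : `|complex.Im a| <= nc a.
Proof.
rewrite -(ler_sqr (normr_ge0 _) (nc_ge0 _)) sqr_nc real_normK ?num_real//.
by rewrite lerDr sqr_ge0.
Qed.

Lemma nc_le_ReIm a : nc a <= `|complex.Re a| + `|complex.Im a|.
Proof.
rewrite -ler_sqr ?nnegrE ?nc_ge0 ?addr_ge0// sqr_nc.
rewrite -(real_normK (num_real (complex.Re a))) -(real_normK (num_real (complex.Im a))).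
have := normr_ge0 (complex.Re a); have := normr_ge0 (complex.Im a).
by nra.
Qed.

Lemma Re_mul_le a b : complex.Re a * complex.Re b + complex.Im a * complex.Im b <= nc a * nc b.
Proof.
apply: (le_trans (ler_norm _)).
rewrite -ler_sqr ?nnegrE ?mulr_ge0 ?nc_ge0//.
rewrite exprMn !sqr_nc real_normK ?num_real//.
have := sqr_ge0 (complex.Re a * complex.Im b - complex.Im a * complex.Re b); nra.
Qed.

Definition dotv u v : C := u 0 0 * v 0 0 + u 1 0 * v 1 0.
Definition cross u v : C := u 0 0 * v 1 0 - u 1 0 * v 0 0.

Lemma ord2_ind (P : 'I_2 -> Prop) : P 0 -> P 1 -> forall i, P i.
Proof.
move=> P0 P1 [[|[|n]] hi] //; first by rewrite (_ : Ordinal hi = 0)//; exact/val_inj.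
by rewrite (_ : Ordinal hi = 1)//; exact/val_inj.
Qed.

Lemma cV2P u v : u 0 0 = v 0 0 -> u 1 0 = v 1 0 -> u = v.
Proof. by move=> e0 e1; apply/matrixP => i j; rewrite (ord1 j); elim/ord2_ind: i. Qed.

Lemma sqr_vnorm u : vnorm u ^+ 2 = nc (u 0 0) ^+ 2 + nc (u 1 0) ^+ 2.
Proof.
rewrite /vnorm sqr_sqrtr; last by rewrite sumr_ge0// => i _; rewrite sqr_ge0.
rewrite big_ord_recl big_ord1; congr (_ + nc (u _ _) ^+ 2).
exact/val_inj.
Qed.

Lemma vnorm_ge0 u : 0 <= vnorm u.
Proof. exact: sqrtr_ge0. Qed.

Lemma vnormE u : vnorm u = Num.sqrt (nc (u 0 0) ^+ 2 + nc (u 1 0) ^+ 2).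
Proof. by rewrite -sqr_vnorm sqrtr_sqr ger0_norm// vnorm_ge0. Qed.

Lemma vnorm_le u (B : R) : 0 <= B -> nc (u 0 0) ^+ 2 + nc (u 1 0) ^+ 2 <= B ^+ 2 -> vnorm u <= B.
Proof. by move=> B0 uB; rewrite -ler_sqr ?nnegrE ?vnorm_ge0// sqr_vnorm. Qed.

Lemma vnorm0 : vnorm (0 : 'cV[C]_2) = 0.
Proof. by rewrite vnormE !mxE Normc.normc0 expr0n/= addr0 sqrtr0. Qed.

Lemma vnorm_eq0 u : vnorm u = 0 -> u = 0.
Proof.
move=> u0; have := sqr_vnorm u; rewrite u0 expr0n/= => /esym/eqP.
rewrite paddr_eq0 ?sqr_ge0// !sqrf_eq0 !nc_eq0 => /andP[/eqP ? /eqP ?].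
by apply: cV2P; rewrite !mxE.
Qed.

Lemma vnormZ a u : vnorm (a *: u) = nc a * vnorm u.
Proof.
rewrite !vnormE !mxE !Normc.normcM !exprMn -mulrDr sqrtrM ?sqr_ge0//.
by rewrite sqrtr_sqr ger0_norm// nc_ge0.
Qed.

Lemma vnormN u : vnorm (- u) = vnorm u.
Proof. by rewrite -scaleN1r vnormZ normcN Normc.normc1 mul1r. Qed.

Lemma nc_comp0 u : nc (u 0 0) <= vnorm u.
Proof.
rewrite -ler_sqr ?nnegrE ?nc_ge0 ?vnorm_ge0// sqr_vnorm lerDl sqr_ge0//.
Qed.

Lemma nc_comp1 u : nc (u 1 0) <= vnorm u.
Proof.
rewrite -ler_sqr ?nnegrE ?nc_ge0 ?vnorm_ge0// sqr_vnorm lerDr sqr_ge0//.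
Qed.

Lemma cauchy_schwarz2 (x y z t : R) : 0 <= x -> 0 <= y -> 0 <= z -> 0 <= t ->
  (x * z + y * t) ^+ 2 <= (x ^+ 2 + y ^+ 2) * (z ^+ 2 + t ^+ 2).
Proof. by have := sqr_ge0 (x * t - y * z); nra. Qed.

Lemma vnormD u v : vnorm (u + v) <= vnorm u + vnorm v.
Proof.
apply: vnorm_le; first by rewrite addr_ge0// vnorm_ge0.
rewrite !mxE.
have h0 := le_normcD (u 0 0) (v 0 0); have h1 := le_normcD (u 1 0) (v 1 0).
have k0 : nc (u 0 0 + v 0 0) ^+ 2 <= (nc (u 0 0) + nc (v 0 0)) ^+ 2.
  by rewrite ler_sqr ?nnegrE ?addr_ge0 ?nc_ge0.
have k1 : nc (u 1 0 + v 1 0) ^+ 2 <= (nc (u 1 0) + nc (v 1 0)) ^+ 2.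
  by rewrite ler_sqr ?nnegrE ?addr_ge0 ?nc_ge0.
apply: (le_trans (lerD k0 k1)); rewrite !sqrrD !sqr_vnorm.
have : nc (u 0 0) * nc (v 0 0) + nc (u 1 0) * nc (v 1 0) <= vnorm u * vnorm v.
  rewrite -ler_sqr ?nnegrE ?addr_ge0 ?mulr_ge0 ?nc_ge0 ?vnorm_ge0// exprMn !sqr_vnorm.
  by apply: cauchy_schwarz2; exact: nc_ge0.
lra.
Qed.

Lemma vnormB u v : vnorm (u - v) <= vnorm u + vnorm v.
Proof. by rewrite -(vnormN v); exact: vnormD. Qed.

Lemma nc_dotv u v : nc (dotv u v) <= vnorm u * vnorm v.
Proof.
apply: (le_trans (le_normcD _ _)).
rewrite -ler_sqr ?nnegrE ?addr_ge0 ?mulr_ge0 ?nc_ge0 ?vnorm_ge0// exprMn !sqr_vnorm !Normc.normcM.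
by apply: cauchy_schwarz2; exact: nc_ge0.
Qed.

Lemma nc_cross u v : nc (cross u v) <= vnorm u * vnorm v.
Proof.
apply: (le_trans (le_normcD _ _)); rewrite normcN.
rewrite -ler_sqr ?nnegrE ?addr_ge0 ?mulr_ge0 ?nc_ge0 ?vnorm_ge0// exprMn !sqr_vnorm !Normc.normcM.
rewrite (addrC (nc (v 0 0) ^+ 2)).
by apply: cauchy_schwarz2; exact: nc_ge0.
Qed.

Lemma mulmx2E A u i : (A *m u) i 0 = A i 0 * u 0 0 + A i 1 * u 1 0.
Proof.
rewrite mxE big_ord_recl big_ord1; congr (_ + A _ _ * u _ _); exact/val_inj.
Qed.

(** A crude bound of the operator norm, enough for its finiteness and continuity. *)
Definition entry_sum A : R := nc (A 0 0) + nc (A 0 1) + (nc (A 1 0) + nc (A 1 1)).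

Lemma entry_sum_ge0 A : 0 <= entry_sum A.
Proof. by rewrite !addr_ge0// nc_ge0. Qed.

Lemma vnorm_le_sum u : vnorm u <= nc (u 0 0) + nc (u 1 0).
Proof.
apply: vnorm_le; first by rewrite addr_ge0// nc_ge0.
have := nc_ge0 (u 0 0); have := nc_ge0 (u 1 0); nra.
Qed.

Lemma vnorm_mulmx_entry_sum A u : vnorm (A *m u) <= entry_sum A * vnorm u.
Proof.
apply: (le_trans (vnorm_le_sum _)); rewrite !mulmx2E /entry_sum mulrDl.
apply: lerD; apply: (le_trans (le_normcD _ _)); rewrite !Normc.normcM mulrDl;
  by apply: lerD; apply: ler_wpM2l; rewrite ?nc_ge0 ?nc_comp0 ?nc_comp1.
Qed.

Lemma opnorm_has_sup A : has_sup [set vnorm (A *m u) | u in [set u | vnorm u <= 1]].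
Proof.
split; first by exists (vnorm (A *m 0)), 0 => //=; rewrite vnorm0 ler01.
exists (entry_sum A) => _ [u /= u1 <-]; apply: (le_trans (vnorm_mulmx_entry_sum _ _)).
by rewrite ler_piMr// entry_sum_ge0.
Qed.

Lemma opnorm_ub A u : vnorm u <= 1 -> vnorm (A *m u) <= opnorm A.
Proof. by move=> u1; apply: ub_le_sup; [case: (opnorm_has_sup A)|exists u]. Qed.

Lemma opnorm_le A (B : R) : (forall u, vnorm u <= 1 -> vnorm (A *m u) <= B) -> opnorm A <= B.
Proof.
move=> AB; apply: ge_sup; first by case: (opnorm_has_sup A).
by move=> _ [u /= u1 <-]; exact: AB.
Qed.

Lemma opnorm_ge0 A : 0 <= opnorm A.
Proof. by apply: le_trans (opnorm_ub A (u := 0) _); rewrite ?vnorm_ge0// vnorm0 ler01. Qed.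

Lemma vnorm_mulmx A u : vnorm (A *m u) <= opnorm A * vnorm u.
Proof.
have [/vnorm_eq0 ->|u0] := eqVneq (vnorm u) 0.
  by rewrite mulmx0 vnorm0 mulr0.
have up : 0 < vnorm u by rewrite lt_neqAle eq_sym u0 vnorm_ge0.
rewrite -ler_pdivrMr// mulrC.
have -> : (vnorm u)^-1 * vnorm (A *m u) = vnorm (A *m ((vnorm u)^-1%:C *: u)).
  by rewrite -scalemxAr vnormZ nc_real ger0_norm// invr_ge0 ltW.
apply: opnorm_ub; rewrite vnormZ nc_real ger0_norm ?mulVf//.
by rewrite invr_ge0 ltW.
Qed.

Lemma opnorm_le_entry_sum A : opnorm A <= entry_sum A.
Proof.
apply: opnorm_le => u u1; apply: (le_trans (vnorm_mulmx_entry_sum _ _)).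
by rewrite ler_piMr// entry_sum_ge0.
Qed.

Lemma opnorm0 : opnorm (0 : 'M[C]_2) = 0.
Proof.
apply/eqP; rewrite eq_le opnorm_ge0 andbT.
by apply: opnorm_le => u _; rewrite mul0mx vnorm0.
Qed.

Lemma opnorm_dist A B : opnorm A - opnorm B <= entry_sum (A - B).
Proof.
rewrite lerBlDl; apply: opnorm_le => u u1.
have -> : A = B + (A - B) by rewrite addrC subrK.
rewrite mulmxDl; apply: (le_trans (vnormD _ _)); apply: lerD; first exact: opnorm_ub.
rewrite (addrC B) addrK.
by apply: le_trans (opnorm_ub _ u1) _; exact: opnorm_le_entry_sum.
Qed.
End ComplexVectors.

(** * Complex-valued functions of a real variable *)

Section ComplexPrimitive.
Variable R : realType.
Local Notation C := R[i].
Local Notation nc := (@Normc.normc R).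
Local Notation mu := (@lebesgue_measure R).
Local Notation intg D f := (mu.-integrable D (EFin \o f)).
Implicit Types (f g h k : R -> C) (a b : C) (D : set R) (x : R).

Definition cprim f g :=
  primitive (fun x => complex.Re (f x)) (fun x => complex.Re (g x)) /\
  primitive (fun x => complex.Im (f x)) (fun x => complex.Im (g x)).

Definition cint D f : C := (\int[mu]_(x in D) complex.Re (f x)) +i* (\int[mu]_(x in D) complex.Im
  (f x)).

Definition cintegrable D f :=
  intg D (fun x => complex.Re (f x)) /\ intg D (fun x => complex.Im (f x)).

Definition cmeasurable D f :=
  measurable_fun D (fun x => complex.Re (f x)) /\ measurable_fun D (fun x => complex.Im (f x)).

Definition ccontinuous f :=
  {within @halfline_closed R, continuous (fun x => complex.Re (f x))} /\
  {within @halfline_closed R, continuous (fun x => complex.Im (f x))}.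

Lemma cprim_eq_fun f f' g : (forall x, 0 <= x -> f x = f' x) -> cprim f g -> cprim f' g.
Proof. by move=> ff' [pr pi]; split;
  [apply: primitive_eq_fun pr|apply: primitive_eq_fun pi] => x x0; rewrite ff'. Qed.

Lemma cprim_eq f g g' : (forall x, 0 < x -> g x = g' x) -> cprim f g -> cprim f g'.
Proof. by move=> gg' [pr pi]; split; [apply: primitive_eq pr|apply: primitive_eq pi] => x x0;
  rewrite gg'. Qed.

Lemma cprim_cst a : cprim (fun=> a) (fun=> 0).
Proof. by split; exact: primitive_cst. Qed.

Lemma cprimD f g h k : cprim f g -> cprim h k -> cprim (fun x => f x + h x) (fun x => g x + k x).
Proof.
move=> [fr fi] [hr hi]; split.
  have := primitiveD fr hr; congr primitive; apply/funext => x; exact/esym/ReD.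
have := primitiveD fi hi; congr primitive; apply/funext => x; exact/esym/ImD.
Qed.

Lemma cprimN f g : cprim f g -> cprim (fun x => - f x) (fun x => - g x).
Proof.
move=> [fr fi]; split.
  have := primitiveN fr; congr primitive; apply/funext => x; exact/esym/ReN.
have := primitiveN fi; congr primitive; apply/funext => x; exact/esym/ImN.
Qed.

Lemma cprimB f g h k : cprim f g -> cprim h k -> cprim (fun x => f x - h x) (fun x => g x - k x).
Proof. by move=> fg /cprimN; exact: cprimD. Qed.

Lemma cprimM f g h k : cprim f g -> cprim h k ->
  cprim (fun x => f x * h x) (fun x => g x * h x + f x * k x).
Proof.
move=> [fr fi] [hr hi]; split.
  have := primitiveB (primitiveM fr hr) (primitiveM fi hi).
  by congr primitive; apply/funext => x; rewrite !ReImE//; ring.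
have := primitiveD (primitiveM fr hi) (primitiveM fi hr).
by congr primitive; apply/funext => x; rewrite !ReImE//; ring.
Qed.

Lemma cprimZ a f g : cprim f g -> cprim (fun x => a * f x) (fun x => a * g x).
Proof.
move=> fg; apply: cprim_eq (cprimM (cprim_cst a) fg) => x _.
by rewrite mul0r add0r.
Qed.

Lemma cprim_continuous f g : cprim f g -> ccontinuous f.
Proof. by move=> [fr fi]; split;
  [exact: primitive_continuous fr|exact: primitive_continuous fi]. Qed.

Lemma ccontinuous_measurable f : ccontinuous f -> cmeasurable (@halfline R) f.
Proof. by move=> [fr fi]; split; exact: within_halfline_measurable. Qed.

Lemma cmeasurableD D f g : cmeasurable D f -> cmeasurable D g -> cmeasurable D (fun x => f x + g x).
Proof.
move=> [fr fi] [gr gi]; split.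
  by under eq_fun do rewrite ReD; exact: measurable_funD.
by under eq_fun do rewrite ImD; exact: measurable_funD.
Qed.

Lemma cmeasurableN D f : cmeasurable D f -> cmeasurable D (fun x => - f x).
Proof.
move=> [fr fi]; split.
  by under eq_fun do rewrite ReN; apply: measurableT_comp.
by under eq_fun do rewrite ImN; apply: measurableT_comp.
Qed.

Lemma cmeasurableM D f g : cmeasurable D f -> cmeasurable D g -> cmeasurable D (fun x => f x * g x).
Proof.
move=> [fr fi] [gr gi]; split.
  by under eq_fun do rewrite ReM; apply: measurable_funB; exact: measurable_funM.
by under eq_fun do rewrite ImM; apply: measurable_funD; exact: measurable_funM.
Qed.

Lemma cmeasurable_cst D a : cmeasurable D (fun=> a).
Proof. by split; exact: measurable_cst. Qed.

Lemma cmeasurableS D D' f : measurable D' -> D `<=` D' -> cmeasurable D' f -> cmeasurable D f.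
Proof. by move=> mD' DD' [fr fi]; split; [apply: measurable_funS fr|apply: measurable_funS fi]. Qed.

Lemma measurable_sqr_nc D f : cmeasurable D f -> measurable_fun D (fun x => nc (f x) ^+ 2).
Proof.
move=> [fr fi]; under eq_fun do rewrite sqr_nc.
by apply: measurable_funD; exact: measurable_funX.
Qed.

Lemma measurable_sqrt_comp D (f : R -> R) : measurable_fun D f ->
  measurable_fun D (fun x => Num.sqrt (f x)).
Proof.
by move=> mf; apply: (measurableT_comp (f := @Num.sqrt R)) => //;
  apply: continuous_measurable_fun; exact: sqrt_continuous.
Qed.

Lemma measurable_vnorm D (f : R -> 'cV[C]_2) :
  cmeasurable D (fun x => f x 0 0) -> cmeasurable D (fun x => f x 1 0) ->
  measurable_fun D (fun x => vnorm (f x)).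
Proof.
move=> f0 f1; under eq_fun do rewrite vnormE.
by apply: measurable_sqrt_comp; apply: measurable_funD; exact: measurable_sqr_nc.
Qed.

Lemma continuous_vnorm (f : R -> 'cV[C]_2) :
  ccontinuous (fun x => f x 0 0) -> ccontinuous (fun x => f x 1 0) ->
  {within @halfline_closed R, continuous (fun x => vnorm (f x))}.
Proof.
move=> [f0r f0i] [f1r f1i].
have -> : (fun x => vnorm (f x)) = (fun x => Num.sqrt (
  (complex.Re (f x 0 0) * complex.Re (f x 0 0) + complex.Im (f x 0 0) * complex.Im (f x 0 0)) +
  (complex.Re (f x 1 0) * complex.Re (f x 1 0) + complex.Im (f x 1 0) * complex.Im (f x 1 0)))).
  by apply/funext => x; rewrite vnormE !sqr_nc -!expr2.
move=> x; apply: continuous_cvg; first exact: sqrt_continuous.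
by apply: cvgD; apply: cvgD; apply: cvgM; (exact: f0r || exact: f0i || exact: f1r || exact: f1i).
Qed.

Lemma cintegrable_le D f (g : R -> R) : measurable D -> cmeasurable D f ->
  (forall x, D x -> nc (f x) <= g x) -> intg D g -> cintegrable D f.
Proof.
move=> mD [fr fi] fg ig; split; apply: (@integrable_le _ _ _ g) => // x Dx.
  exact: le_trans (normr_Re_le _) (fg x Dx).
exact: le_trans (normr_Im_le _) (fg x Dx).
Qed.

(** The integrand is projected onto the direction of its integral, which loses no constant; estimating real
and imaginary parts separately would spoil the radius of the disks. *)
Lemma nc_cint_le D f (g : R -> R) : measurable D -> cintegrable D f ->
  intg D g -> (forall x, D x -> nc (f x) <= g x) -> nc (cint D f) <= \int[mu]_(x in D) g x.
Proof.
move=> mD [ifr ifi] ig fg.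
set I := cint D f.
have [->|I0] := eqVneq (nc I) 0.
  by apply: Rintegral_ge0 => x Dx; apply: le_trans (fg x Dx); exact: nc_ge0.
have Ip : 0 < nc I by rewrite lt_neqAle eq_sym I0 nc_ge0.
rewrite -(ler_pM2l Ip) -expr2 sqr_nc -RintegralZl//.
rewrite !expr2 {2 4}/I /cint /= -!RintegralZl// -RintegralD//; try exact: integrable_scale.
apply: le_Rintegral => //.
- by apply: integrable_add => //; exact: integrable_scale.
- exact: integrable_scale.
- move=> x Dx; apply: (le_trans (Re_mul_le I (f x))).
  by apply: ler_wpM2l; [exact: nc_ge0|exact: fg].
Qed.

Lemma cintegrableS D D' f : measurable D -> measurable D' -> D `<=` D' ->
  cintegrable D' f -> cintegrable D f.
Proof. by move=> mD mD' DD' [fr fi]; split; [apply: integrableS fr|apply: integrableS fi]. Qed.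

Lemma cprim_cint f : (forall x, cintegrable `]0, x] f) -> cprim (fun x => cint `]0, x] f) f.
Proof. by move=> fi; split; apply: primitive_integral => x; case: (fi x). Qed.

Lemma cint_tail f x : 0 <= x -> cintegrable (@halfline R) f ->
  cint (@halfline R) f - cint `]0, x] f = cint `]x, +oo[ f.
Proof.
move=> x0 [fr fi]; apply: complex_eq; rewrite !ReImE /=; exact: Rintegral_itvB.
Qed.

Lemma cprim_eval f g x : cprim f g -> 0 <= x ->
  cintegrable `]0, x] g /\ f x = f 0 + cint `]0, x] g.
Proof.
move=> [[ir er] [ii ei]] x0; split; first by split; [exact: ir|exact: ii].
by apply: complex_eq; rewrite !ReImE /=; [exact: er|exact: ei].
Qed.

(** The function x |-> exp (l x), built from the real exponential and circular functions. *)
Definition cexp (l : C) (x : R) : C :=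
  (expR (complex.Re l * x))%:C * (cos (complex.Im l * x) +i* sin (complex.Im l * x)).

Lemma nc_cexp l x : nc (cexp l x) = expR (complex.Re l * x).
Proof.
by rewrite nc_realM /= cos2Dsin2 sqrtr1 mulr1 ger0_norm// expR_ge0.
Qed.

Lemma cexp0 l : cexp l 0 = 1.
Proof. by apply: complex_eq; rewrite /cexp !ReImE/= !mulr0 expR0 cos0 sin0; ring. Qed.

Lemma cexpN l x : cexp l x * cexp (- l) x = 1.
Proof.
rewrite /cexp ReN ImN !mulNr expRN cosN sinN.
have e0 : expR (complex.Re l * x) != 0 by rewrite gt_eqF// expR_gt0.
have := cos2Dsin2 (complex.Im l * x) => cs.
apply: complex_eq; rewrite !ReImE/=; last by field.
rewrite -[RHS]cs.
by field.
Qed.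

Lemma cprim_cexp l : cprim (cexp l) (fun x => l * cexp l x).
Proof.
have d1 (r x : R) : is_derive x 1 (fun y : R => r * y) r.
  have -> : (fun y : R => r * y) = (r \*: (fun y : R => y)) by [].
  by apply: is_derive_eq; rewrite /GRing.scale/= mulr1.
have de x : is_derive x 1 (fun y =>
  expR (complex.Re l * y)) (complex.Re l * expR (complex.Re l * x)).
  by have := @is_derive1_comp _ expR _ x _ _ (is_derive_expR _) (d1 (complex.Re l) x);
    rewrite mulrC.
have dc x : is_derive x 1 (fun y =>
  cos (complex.Im l * y)) (- (complex.Im l * sin (complex.Im l * x))).
  have := @is_derive1_comp _ cos _ x _ _ (is_derive_cos _) (d1 (complex.Im l) x).
  by rewrite mulNr mulrC.
have ds x : is_derive x 1 (fun y => sin (complex.Im l * y)) (complex.Im l * cos (complex.Im l * x)).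
  by have := @is_derive1_comp _ sin _ x _ _ (is_derive_sin _) (d1 (complex.Im l) x); rewrite mulrC.
have cont (f g : R -> R) : (forall x, is_derive x 1 f (g x)) -> continuous f.
  by move=> df x; apply: differentiable_continuous; apply/derivable1_diffP; have [] := df x.
have cz (r : R) (f : R -> R) : continuous f -> continuous (fun x => r * f x).
  by move=> cf x; apply: cvgM; [exact: cvg_cst|exact: cf].
have ce := cont _ _ de; have cc := cont _ _ dc; have cs := cont _ _ ds.
have pe : primitive (fun y => expR (complex.Re l * y)) (fun x =>
  complex.Re l * expR (complex.Re l * x)).
  by apply: primitive_derive => //; exact: cz.
have pc : primitive (fun y => cos (complex.Im l * y)) (fun x =>
  - (complex.Im l * sin (complex.Im l * x))).
  by apply: primitive_derive => // x; apply: cvgN; exact: cz.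
have ps : primitive (fun y => sin (complex.Im l * y)) (fun x =>
  complex.Im l * cos (complex.Im l * x)).
  by apply: primitive_derive => //; exact: cz.
split.
  have := primitiveM pe pc.
  by congr primitive; apply/funext => x; rewrite /cexp !ReImE/=; ring.
have := primitiveM pe ps.
by congr primitive; apply/funext => x; rewrite /cexp !ReImE/=; ring.
Qed.

End ComplexPrimitive.

(** * Square integrable functions and exponential kernels *)

Section SquareIntegrable.
Variable R : realType.
Local Notation C := R[i].
Local Notation nc := (@Normc.normc R).
Local Notation mu := (@lebesgue_measure R).
Local Notation intg D f := (mu.-integrable D (EFin \o f)).
Local Notation H := (@halfline R).
Implicit Types (f g h : R -> 'cV[C]_2).

Lemma L2P f : L2 f <-> [/\ cmeasurable H (fun x => f x 0 0), cmeasurable H (fun x => f x 1 0) &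
  intg H (fun x => vnorm (f x) ^+ 2)].
Proof.
split=> [[mf fi]|[m0 m1 /integrableP[_ fi]]].
  have m0 : cmeasurable H (fun x => f x 0 0) by exact: mf.
  have m1 : cmeasurable H (fun x => f x 1 0) by exact: mf.
  split=> //; apply/integrableP; split.
    by apply/measurable_EFinP; apply: measurable_funX; exact: measurable_vnorm.
  apply: le_lt_trans fi; apply: ge0_le_integral => //.
  - exact: measurable_halfline.
  - apply: measurableT_comp => //; apply/measurable_EFinP; apply: measurable_funX;
    exact: measurable_vnorm.
  - apply/measurable_EFinP; apply: measurable_funX; exact: measurable_vnorm.
  - by move=> x _ /=; rewrite lee_fin ger0_norm// sqr_ge0.
split.
  by move=> i j; rewrite (ord1 j); elim/ord2_ind: i.
apply: le_lt_trans fi; apply: ge0_le_integral => //.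
- exact: measurable_halfline.
- by move=> x _; rewrite lee_fin sqr_ge0.
- apply/measurable_EFinP; apply: measurable_funX; exact: measurable_vnorm.
- apply: measurableT_comp => //; apply/measurable_EFinP; apply: measurable_funX;
  exact: measurable_vnorm.
- by move=> x _ /=; rewrite lee_fin ger0_norm// sqr_ge0.
Qed.

Lemma L2_measurable_vnorm f : L2 f -> measurable_fun H (fun x => vnorm (f x)).
Proof. by move=> /L2P[? ? _]; exact: measurable_vnorm. Qed.

Lemma L2_le f (g : R -> R) : cmeasurable H (fun x => f x 0 0) -> cmeasurable H (fun x => f x 1 0) ->
  intg H g -> (forall x, H x -> vnorm (f x) ^+ 2 <= g x) -> L2 f.
Proof.
move=> m0 m1 ig fg; apply/L2P; split=> //.
apply: (integrable_le _ _ _ ig); first exact: measurable_halfline.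
  by apply: measurable_funX; exact: measurable_vnorm.
by move=> x Hx; rewrite ger0_norm ?sqr_ge0//; exact: fg.
Qed.

Lemma L2D f g : L2 f -> L2 g -> L2 (fun x => f x + g x).
Proof.
move=> /L2P[f0 f1 fi] /L2P[g0 g1 gi].
apply: (@L2_le _ (fun x => 2 * (vnorm (f x) ^+ 2 + vnorm (g x) ^+ 2))).
- by under eq_fun do rewrite mxE; exact: cmeasurableD.
- by under eq_fun do rewrite mxE; exact: cmeasurableD.
- apply: integrable_scale; first exact: measurable_halfline.
  by apply: integrable_add => //; exact: measurable_halfline.
- move=> x _; apply: (@le_trans _ _ ((vnorm (f x) + vnorm (g x)) ^+ 2)).
    by rewrite ler_sqr ?nnegrE ?addr_ge0 ?vnorm_ge0// vnormD.
  by have := sqr_ge0 (vnorm (f x) - vnorm (g x)); nra.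
Qed.

Lemma L2Z (a : C) f : L2 f -> L2 (fun x => a *: f x).
Proof.
move=> /L2P[f0 f1 fi].
apply: (@L2_le _ (fun x => nc a ^+ 2 * vnorm (f x) ^+ 2)).
- by under eq_fun do rewrite mxE; apply: cmeasurableM => //; exact: cmeasurable_cst.
- by under eq_fun do rewrite mxE; apply: cmeasurableM => //; exact: cmeasurable_cst.
- by apply: integrable_scale => //; exact: measurable_halfline.
- by move=> x _; rewrite vnormZ exprMn.
Qed.

Lemma L2N f : L2 f -> L2 (fun x => - f x).
Proof. by move=> /(L2Z (-1)); under eq_fun do rewrite scaleN1r. Qed.

Lemma L2B f g : L2 f -> L2 g -> L2 (fun x => f x - g x).
Proof. by move=> fl /L2N; exact: L2D. Qed.

Lemma L20 : L2 (fun=> 0 : 'cV[C]_2).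
Proof.
apply: (@L2_le _ (fun=> 0)).
- by under eq_fun do rewrite mxE; exact: cmeasurable_cst.
- by under eq_fun do rewrite mxE; exact: cmeasurable_cst.
- by apply: integrable0.
- by move=> x _; rewrite vnorm0 expr0n.
Qed.

Lemma sqr_L2norm f : L2norm f ^+ 2 = \int[mu]_(x in H) (vnorm (f x) ^+ 2).
Proof. by rewrite sqr_sqrtr// Rintegral_ge0// => x _; exact: sqr_ge0. Qed.

Lemma L2norm_ge0 f : 0 <= L2norm f.
Proof. exact: sqrtr_ge0. Qed.

Lemma L2_integrable_vnorm f x : L2 f -> intg `]0, x]%classic (fun y => vnorm (f y)).
Proof.
move=> fl; have /L2P[f0 f1 fi] := fl.
apply: (@integrable_le _ _ _ (fun y => 1 + vnorm (f y) ^+ 2)) => //.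
- apply: measurable_funS (L2_measurable_vnorm fl); first exact: measurable_halfline.
  exact: halfline_segment.
- move=> y _; rewrite ger0_norm ?vnorm_ge0//.
  by have := sqr_ge0 (vnorm (f y) - 1/2); nra.
- apply: integrable_add => //; last first.
    by apply: integrableS fi => //; [exact: measurable_halfline|exact: halfline_segment].
  by apply: integrable_cst => //; exact: lebesgue_segment_lty.
Qed.

Lemma cmeasurable_dotv D f g : cmeasurable D (fun x => f x 0 0) ->
  cmeasurable D (fun x => f x 1 0) ->
  cmeasurable D (fun x => g x 0 0) -> cmeasurable D (fun x => g x 1 0) ->
  cmeasurable D (fun x => dotv (f x) (g x)).
Proof. by move=> *; apply: cmeasurableD; apply: cmeasurableM. Qed.

Lemma expR_integrable (r x : R) : 0 < r -> intg `]x, +oo[%classic (fun y => expR (- r * y)) /\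
  \int[mu]_(y in `]x, +oo[) expR (- r * y) = expR (- r * x) / r.
Proof.
move=> r0.
pose F y : R := - (r^-1 * expR (- r * y)).
have dF (y : R) : is_derive y 1 F (expR (- r * y)).
  have d1 : is_derive y 1 (fun y : R => - r * y) (- r).
    have -> : (fun y : R => - r * y) = ((- r) \*: (fun y : R => y)) by [].
    by apply: is_derive_eq; rewrite /GRing.scale/= mulr1.
  have d2 := @is_derive1_comp _ expR _ y _ _ (is_derive_expR _) d1.
  have -> : F = - (r^-1 \*: (expR \o (fun y : R => - r * y))) by [].
  by apply: is_derive_eq; rewrite /GRing.scale/=; field; rewrite gt_eqF.
have ce : continuous (fun y : R => expR (- r * y)).
  move=> y; apply: continuous_comp; last exact: continuous_expR.
  by apply: cvgM; [exact: cvg_cst|exact: cvg_id].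
have cF : continuous F.
  by move=> y; apply: differentiable_continuous; apply/derivable1_diffP; have [] := dF y.
have Foo : F y @[y --> +oo] --> 0.
  rewrite -oppr0; apply: cvgN; rewrite -(mulr0 r^-1); apply: cvgM; first exact: cvg_cst.
  have -> : (fun y => expR (- r * y)) = (fun y => expR (- (r * y))).
    by apply/funext => y; rewrite mulNr.
  apply: (cvg_comp (fun y => r * y) (fun y => expR (- y))); last exact: cvgr_expR.
  by apply: gt0_cvgMry => //; exact: cvg_id.
have E := @ge0_continuous_FTC2y R (fun y => expR (- r * y)) F x 0 (fun _ _ => expR_ge0 _)
  (continuous_subspaceT ce) Foo (fun y _ =>
    @ex_derive _ _ _ _ _ _ _ (dF y)) (cvg_at_right_filter (cF x)).
have {}E : (\int[mu]_(y in `[x, +oo[) (expR (- r * y))%:E = (expR (- r * x) / r)%:E)%E.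
  rewrite E; last by move=> y _; rewrite derive1E; exact: derive_val.
  by rewrite /F -EFinD; congr EFin; rewrite add0r opprK mulrC.
have me D : measurable_fun D (fun y => expR (- r * y)).
  by apply: measurable_funTS; exact: continuous_measurable_fun.
have E' : (\int[mu]_(y in `]x, +oo[) (expR (- r * y))%:E = (expR (- r * x) / r)%:E)%E.
  by rewrite integral_itv_obnd_cbnd//; apply/measurable_EFinP.
split; last by rewrite /Rintegral E'.
apply/integrableP; split; first by apply/measurable_EFinP; exact: me.
under eq_integral do rewrite /= ger0_norm ?expR_ge0//.
by rewrite E' ltry.
Unshelve. all: by end_near. Qed.

(** The bound is uniform in x, which is what makes the resolvent bounded from L^2 to the bounded
functions. *)
Lemma decay_integrable (r x : R) : 0 < r -> 0 <= x ->
  intg H (fun y => expR (- r * `|x - y|)) /\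
  \int[mu]_(y in H) expR (- r * `|x - y|) <= 2 / r.
Proof.
move=> r0 x0; have [i1 E1] := expR_integrable x r0; have [i0 _] := expR_integrable 0 r0.
have cn : continuous (fun y : R => expR (- r * `|x - y|)).
  move=> y; apply: continuous_comp; last exact: continuous_expR.
  apply: cvgM; first exact: cvg_cst.
  apply: (@continuous_comp _ _ _ (fun y => x - y) Num.norm); last exact: norm_continuous.
  by apply: cvgB; [exact: cvg_cst|exact: cvg_id].
have i : intg H (fun y => expR (- r * `|x - y|)).
  apply: (@integrable_le _ _ _ (fun y => expR (r * x) * expR (- r * y))).
  - exact: measurable_halfline.
  - by apply: measurable_funTS; exact: continuous_measurable_fun.
  - move=> y _; rewrite ger0_norm ?expR_ge0// -expRD ler_expR.
    by have := ler_norm (y - x); rewrite distrC; nra.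
  - by apply: integrable_scale => //; exact: measurable_halfline.
split=> //.
have iS : intg `]0, x]%classic (fun y => expR (- r * `|x - y|)).
  by apply: integrableS i => //; [exact: measurable_halfline|exact: halfline_segment].
have := @Rintegral_itvB R _ (BRight 0) +oo%O x i.
rewrite !bnd_simp => /(_ x0 isT) E.
have {}E : \int[mu]_(y in H) expR (- r * `|x - y|) = \int[mu]_(t in `]0, x]) expR (- r * `|x - t|) +
  \int[mu]_(x0 in `]x, +oo[) expR (- r * `|x - x0|) by rewrite -E /halfline; ring.
have E2 : \int[mu]_(y in `]x, +oo[) expR (- r * `|x - y|) = r^-1.
  transitivity (\int[mu]_(y in `]x, +oo[) (expR (r * x) * expR (- r * y))).
    apply: eq_Rintegral => y /set_mem; rewrite /= in_itv/= andbT => xy.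
    by rewrite -expRD ltr0_norm ?subr_lt0//; congr expR; ring.
  rewrite RintegralZl// E1 mulrA -expRD.
  have -> : r * x + - r * x = 0 by ring.
  by rewrite expR0 mul1r.
have E3 : \int[mu]_(y in `]0, x]) expR (- r * `|x - y|) <= r^-1.
  pose F (y : R) := r^-1 * expR (r * (y - x)).
  have dF (y : R) : is_derive y 1 F (expR (r * (y - x))).
    have d1 : is_derive y 1 (fun y : R => r * (y - x)) r.
      have -> : (fun y : R => r * (y - x)) = (r \*: (fun y : R => y - x)) by [].
      by apply: is_derive_eq; rewrite /GRing.scale/= subr0 mulr1.
    have d2 := @is_derive1_comp _ expR _ y _ _ (is_derive_expR _) d1.
    have -> : F = (r^-1 \*: (expR \o (fun y : R => r * (y - x)))) by [].
    by apply: is_derive_eq; rewrite /GRing.scale/=; field; rewrite gt_eqF.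
  have ce : continuous (fun y : R => expR (r * (y - x))).
    move=> y; apply: continuous_comp; last exact: continuous_expR.
    by apply: cvgM; [exact: cvg_cst|apply: cvgB; [exact: cvg_id|exact: cvg_cst]].
  have [_ /(_ x x0)] := primitive_derive dF ce.
  rewrite /F subrr mulr0 expR0 mulr1 => E3.
  have -> : \int[mu]_(y in `]0, x]) expR (- r * `|x - y|) = \int[mu]_(t in `]0,
    x]) expR (r * (t - x)).
    apply: eq_Rintegral => y /set_mem; rewrite /= in_itv/= => /andP[_ yx].
    by rewrite ger0_norm ?subr_ge0//; congr expR; ring.
  have : 0 <= r^-1 * expR (r * (0 - x)) by rewrite mulr_ge0 ?invr_ge0 ?expR_ge0// ltW.
  lra.
rewrite E E2; have -> : 2 / r = r^-1 + r^-1 by field; rewrite gt_eqF.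
by rewrite lerD2r.
Qed.

(** The Cauchy-Schwarz inequality, obtained from 2 e |h| <= t e^2 + |h|^2 / t for all t > 0. *)
Lemma decay_L2 (r x : R) h : 0 < r -> 0 <= x -> L2 h ->
  intg H (fun y => expR (- r * `|x - y|) * vnorm (h y)) /\
  \int[mu]_(y in H) (expR (- r * `|x - y|) * vnorm (h y)) <= L2norm h / Num.sqrt r.
Proof.
move=> r0 x0 hl; have /L2P[h0 h1 hi] := hl.
have r2 : 0 < 2 * r by lra.
have [ie Ee] := decay_integrable r2 x0.
have mH := @measurable_halfline R.
have me : measurable_fun H (fun y => expR (- r * `|x - y|)).
  apply: integrable_measurable; exact: (decay_integrable r0 x0).1.
have sq y : expR (- (2 * r) * `|x - y|) = expR (- r * `|x - y|) ^+ 2.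
  by rewrite expr2 -expRD; congr expR; ring.
have bnd t y : 0 < t -> 2 * (expR (- r * `|x - y|) * vnorm (h y)) <=
   t * expR (- (2 * r) * `|x - y|) + t^-1 * vnorm (h y) ^+ 2.
  move=> t0; rewrite sq.
  set a := expR _; set b := vnorm _; rewrite -(ler_pM2l t0).
  have -> : t * (t * a ^+ 2 + t^-1 * b ^+ 2) = t ^+ 2 * a ^+ 2 + b ^+ 2.
    by field; rewrite gt_eqF.
  by have := sqr_ge0 (t * a - b); nra.
have i : intg H (fun y => expR (- r * `|x - y|) * vnorm (h y)).
  apply: (@integrable_le _ _ _ (fun y =>
    1 * expR (- (2 * r) * `|x - y|) + 1^-1 * vnorm (h y) ^+ 2)) => //.
  - by apply: measurable_funM => //; exact: L2_measurable_vnorm.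
  - move=> y _; rewrite ger0_norm ?mulr_ge0 ?expR_ge0 ?vnorm_ge0//.
    have := bnd 1 y ltr01; have : 0 <= expR (- r * `|x - y|) * vnorm (h y).
      by rewrite mulr_ge0 ?expR_ge0 ?vnorm_ge0.
    lra.
  - by apply: integrable_add => //; exact: integrable_scale.
split=> //.
set S := \int[mu]_(y in H) (_ * _).
have S0 : 0 <= S by apply: Rintegral_ge0 => y _; rewrite mulr_ge0 ?expR_ge0 ?vnorm_ge0.
have key t : 0 < t -> 2 * S <= t / r + t^-1 * L2norm h ^+ 2.
  move=> t0; rewrite /S -RintegralZl//.
  apply: (@le_trans _ _ (\int[mu]_(y in H) (t * expR (- (2 * r) * `|x - y|) +
    t^-1 * vnorm (h y) ^+ 2))).
    apply: le_Rintegral => //; first exact: integrable_scale.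
      by apply: integrable_add => //; exact: integrable_scale.
    by move=> y _; exact: bnd.
  rewrite RintegralD//; try exact: integrable_scale.
  rewrite !RintegralZl// sqr_L2norm lerD2r; apply: ler_wpM2l; first exact: ltW.
  apply: (le_trans Ee); have -> : 2 / (2 * r) = r^-1 by field; rewrite gt_eqF.
  exact: lexx.
rewrite ler_pdivlMr ?sqrtr_gt0//.
rewrite -ler_sqr ?nnegrE ?mulr_ge0 ?sqrtr_ge0 ?L2norm_ge0//.
rewrite exprMn sqr_sqrtr; last exact: ltW.
have [->|Sn0] := eqVneq S 0; first by rewrite expr0n/= mul0r sqr_ge0.
have Sp : 0 < S by rewrite lt_neqAle eq_sym Sn0.
have := key (S * r) (mulr_gt0 Sp r0).
rewrite mulfK ?gt_eqF//.
move=> kS; have : S <= L2norm h ^+ 2 / (S * r) by lra.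
by rewrite ler_pdivlMr ?mulr_gt0// expr2 mulrA.
Qed.
End SquareIntegrable.

(** * Solutions of the free Dirac system *)

Section FreeSolutions.
Variable R : realType.
Local Notation C := R[i].
Local Notation nc := (@Normc.normc R).
Implicit Types (c M alpha : R) (z k : C) (psi h u w : R -> 'cV[C]_2).

(** The equation (D_0 - z) psi = h with M = m c^2, solved for the derivatives of the components. *)
Definition dirac_solution c M z h psi :=
  cprim (fun x => psi x 0 0) (fun x => c%:C^-1 * ((z + M%:C) * psi x 1 0 + h x 1 0)) /\
  cprim (fun x => psi x 1 0) (fun x => c%:C^-1 * ((M%:C - z) * psi x 0 0 - h x 0 0)).

Lemma dirac_solutionD c M z h h' psi psi' :
  dirac_solution c M z h psi -> dirac_solution c M z h' psi' ->
  dirac_solution c M z (fun x => h x + h' x) (fun x => psi x + psi' x).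
Proof.
move=> [p0 p1] [q0 q1]; split; under eq_fun do rewrite mxE.
  by apply: cprim_eq (cprimD p0 q0) => x _; rewrite !mxE; ring.
by apply: cprim_eq (cprimD p1 q1) => x _; rewrite !mxE; ring.
Qed.

Definition vec2 (p q : C) : 'cV[C]_2 := \col_i (if i == 0 then p else q).

Lemma dirac_solution_exp c M z l p q : (0 < c)%R ->
  l * c%:C * p = (z + M%:C) * q -> l * c%:C * q = (M%:C - z) * p ->
  dirac_solution c M z (fun=> 0) (fun x => cexp l x *: vec2 p q).
Proof.
move=> c0 e0 e1; have cC : c%:C != 0 :> C by rewrite eq_complex/= eqxx andbT gt_eqF.
split; under eq_fun do rewrite !mxE/=.
  have := cprimM (cprim_cexp l) (cprim_cst p).
  apply: cprim_eq => x _; rewrite !mxE/= mulr0 !addr0.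
  rewrite [(z + _) * _]mulrCA -e0; field.
  exact: cC.
have := cprimM (cprim_cexp l) (cprim_cst q).
apply: cprim_eq => x _; rewrite !mxE/= mulr0 addr0 subr0.
rewrite [(_ - z) * _]mulrCA -e1; field.
exact: cC.
Qed.

(** The Lagrange identity: the terms without h cancel because the matrix of the system has trace 0. *)
Lemma cross_cprim c M z h u psi : c%:C != 0 :> C ->
  dirac_solution c M z (fun=> 0) u -> dirac_solution c M z h psi ->
  cprim (fun x => cross (u x) (psi x)) (fun x => - (c%:C^-1 * dotv (u x) (h x))).
Proof.
move=> c0 [u0 u1] [p0 p1].
apply: cprim_eq (cprimB (cprimM u0 p1) (cprimM u1 p0)) => x _.
by rewrite !mxE /dotv; ring.
Qed.

(** Three vectors in a plane are linearly dependent. With v and u two solutions of the homogeneous system,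
this recovers w from its Wronskians with them. *)
Lemma cross_plucker (u v w : 'cV[C]_2) : cross v u *: w = cross v w *: u - cross u w *: v.
Proof. by apply: cV2P; rewrite !mxE /cross; ring. Qed.

(** A solution u that satisfies the boundary condition, a decaying solution w, their Wronskian W, and the
pointwise bound K exp (- kappa (y - x)) of the Green kernel that the rest of the argument uses. *)
Record green_pair c M alpha z (kappa K : R) u w (W : C) : Prop := GreenPair {
  gp_u : dirac_solution c M z (fun=> 0) u;
  gp_w : dirac_solution c M z (fun=> 0) w;
  gp_u0 : u 0 0 0 = (sin alpha)%:C;
  gp_u1 : u 0 1 0 = (cos alpha)%:C;
  gp_cross : forall x, cross (w x) (u x) = W;
  gp_W0 : W != 0;
  gp_kappa : 0 < kappa;
  gp_decay : exists A : R, 0 <= A /\ forall x, 0 <= x -> vnorm (w x) <= A * expR (- kappa * x);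
  gp_bound : forall x y, 0 <= x -> x <= y ->
    vnorm (u x) * vnorm (w y) <= K * nc W * expR (- kappa * (y - x)) }.

(** Replace both weights t and 1 by their maximum and use the parallelogram identity. *)
Lemma parallelogram_le (p q : C) (t : R) : 0 <= t -> nc p <= nc q ->
  t * nc (p + q) ^+ 2 + nc (p - q) ^+ 2 <= 4 * Num.max t 1 * nc q ^+ 2.
Proof.
move=> t0 pq.
have E : nc (p + q) ^+ 2 + nc (p - q) ^+ 2 = 2 * (nc p ^+ 2 + nc q ^+ 2).
  by rewrite !sqr_nc !ReImE; ring.
have m1 : 1 <= Num.max t 1 by rewrite le_max lexx orbT.
have mt : t <= Num.max t 1 by rewrite le_max lexx.
have pq2 : nc p ^+ 2 <= nc q ^+ 2 by rewrite ler_sqr ?nnegrE ?nc_ge0.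
have := sqr_ge0 (nc (p + q)); have := sqr_ge0 (nc (p - q)); nra.
Qed.

Lemma sqr_vnorm_vec2 (a p q : C) : vnorm (a *: vec2 p q) ^+ 2 = nc a ^+ 2 * (nc p ^+ 2 + nc q ^+ 2).
Proof. by rewrite vnormZ exprMn sqr_vnorm !mxE. Qed.

Lemma normc_i : nc 'i = 1.
Proof. by rewrite /= expr0n/= expr1n add0r sqrtr1. Qed.

Lemma sin_cos_ge0 alpha : 0 <= alpha <= pi / 2 -> 0 <= sin alpha /\ 0 <= cos alpha.
Proof.
move=> /andP[a0 api]; have := pi_ge0 R => p0; split.
  by apply: sin_ge0_pi; apply/andP; split; lra.
by apply: cos_ge0_pihalf; apply/andP; split; lra.
Qed.

(** With e(x) = exp (i k x), take w = e (zeta, i) and u = a e (zeta, i) + b e^-1 (zeta, -i), where a and b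
are fixed by the boundary values of u. Then W = - 2 i zeta b, and the estimate of |u(x)| |w(y)| / |W| by
K exp (- Im k (y - x)) needs |a| <= |b|. Since 2 a = eta sin alpha - i cos alpha and
2 b = eta sin alpha + i cos alpha with eta = 1 / zeta, this amounts to
sin alpha cos alpha Im eta >= 0. The number t is |zeta|^2. *)
Lemma green_pair_exists c M alpha z k : 0 < c -> 0 <= M -> 0 <= alpha <= pi / 2 ->
  c%:C ^+ 2 * k ^+ 2 = z ^+ 2 - M%:C ^+ 2 -> 0 < complex.Im k ->
  exists u w W t, [/\ 0 < t, t * nc (z - M%:C) = nc (z + M%:C), z - M%:C != 0 &
    green_pair c M alpha z (complex.Im k) (Num.sqrt (1 + Num.max t t^-1)) u w W].
Proof.
move=> c0 M0 abnd kz k0.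
have cC : c%:C != 0 :> C by rewrite eq_complex/= eqxx andbT gt_eqF.
have kn0 : k != 0 by apply/eqP => k00; move: k0; rewrite k00 /= ltxx.
have ckn0 : c%:C * k != 0 by rewrite mulf_neq0.
pose zeta := (z + M%:C) / (c%:C * k).
pose eta := (z - M%:C) / (c%:C * k).
have zetaM : c%:C * k * zeta = z + M%:C by rewrite /zeta mulrC divfK.
have etaM : c%:C * k * eta = z - M%:C by rewrite /eta mulrC divfK.
clearbody zeta eta.
have zeE : zeta * eta = 1.
  apply: (mulfI (mulf_neq0 ckn0 ckn0)).
  transitivity ((c%:C * k * zeta) * (c%:C * k * eta)); first by ring.
  rewrite zetaM etaM mulr1 -expr2 exprMn kz; ring.
have zeta0 : zeta != 0 by apply/eqP => e; move/eqP: zeE; rewrite e mul0r eq_sym oner_eq0.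
have eta0 : eta != 0 by apply/eqP => e; move/eqP: zeE; rewrite e mulr0 eq_sym oner_eq0.
have etaV : eta = zeta^-1 by apply: (mulfI zeta0); rewrite zeE divff.
have zM0 : z - M%:C != 0 by rewrite -etaM mulf_neq0.
have [s0 C0] := sin_cos_ge0 abnd.
set s := sin alpha in s0 *; set ca := cos alpha in C0 *.
have sc1 : s ^+ 2 + ca ^+ 2 = 1 by rewrite addrC; exact: cos2Dsin2.
(* zeta - eta = 2 M / (c k) has nonpositive imaginary part, and zeta = 1 / eta has the
   imaginary part of eta with the opposite sign. *)
have Imeta : 0 <= complex.Im eta.
  have E : c%:C * k * (zeta - eta) = (2 * M)%:C.
    by rewrite mulrBr zetaM etaM; apply: complex_eq; rewrite !ReImE/=; ring.
  have [E1 E2] : complex.Re (c%:C * k * (zeta - eta)) =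
    2 * M /\ complex.Im (c%:C * k * (zeta - eta)) = 0.
    by rewrite E.
  have [F1 F2] : complex.Re (zeta * eta) = 1 /\ complex.Im (zeta * eta) = 0 by rewrite zeE.
  move: E1 E2 F1 F2 k0; rewrite !ReImE/=.
  move: (complex.Re zeta) (complex.Im zeta) (complex.Re eta) (complex.Im eta) (complex.Re k)
    (complex.Im k) => zr zi er ei kr ki.
  move=> E1 E2 F1 F2 ki0.
  have di : (kr ^+ 2 + ki ^+ 2) * (zi - ei) * c = - (2 * M) * ki.
    have := congr1 ( *%R ki) E1; have := congr1 ( *%R kr) E2; lra.
  have eE : zi * (er ^+ 2 + ei ^+ 2) = - ei.
    have : (zr * ei + zi * er) * er - (zr * er - zi * ei) * ei = - ei by rewrite F1 F2; ring.
    by move=> <-; ring.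
  rewrite leNgt; apply/negP => ei0.
  have zi0 : 0 < zi.
    by rewrite ltNge; apply/negP => zi0; have := sqr_ge0 er; have := sqr_ge0 ei; nra.
  have k2 : 0 < (kr ^+ 2 + ki ^+ 2) * c by rewrite mulr_gt0// ltr_wpDl ?sqr_ge0// exprn_gt0.
  have : 0 < (kr ^+ 2 + ki ^+ 2) * c * (zi - ei) by rewrite mulr_gt0//; lra.
  by nra.
pose a := 2^-1 * (s%:C * eta - 'i * ca%:C).
pose b := 2^-1 * (s%:C * eta + 'i * ca%:C).
pose u x := cexp ('i * k) x *: vec2 (a * zeta) (a * 'i) +
  cexp (- ('i * k)) x *: vec2 (b * zeta) (b * - 'i).
pose w x := cexp ('i * k) x *: vec2 zeta 'i.
pose W := - (2 * 'i * zeta * b).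
pose t := nc zeta ^+ 2.
have t0 : 0 < t by rewrite exprn_gt0// nc_gt0.
have ii : 'i * 'i = -1 :> C by rewrite -expr2 sqr_i.
exists u, w, W, t.
have nab : nc a <= nc b.
  rewrite -ler_sqr ?nnegrE ?nc_ge0// !Normc.normcM !exprMn ler_wpM2l ?sqr_ge0//.
  rewrite !sqr_nc !ReImE/=.
  have := mulr_ge0 (mulr_ge0 s0 C0) Imeta; lra.
have b0 : b != 0.
  apply/eqP => b0; have : nc (2 * b) ^+ 2 = 0 by rewrite b0 mulr0 Normc.normc0 expr0n.
  rewrite /b mulVKf ?pnatr_eq0// sqr_nc !ReImE/=.
  have : complex.Re eta ^+ 2 + complex.Im eta ^+ 2 != 0 by rewrite -sqr_nc sqrf_eq0 nc_eq0.
  move: (complex.Re eta) (complex.Im eta) Imeta => x y y0 xy0 E.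
  have sy := mulr_ge0 s0 y0.
  have E2 : (s * x) ^+ 2 + (s * y + ca) ^+ 2 = 0 by rewrite -[RHS]E; ring.
  move/eqP: E2; rewrite paddr_eq0 ?sqr_ge0// !sqrf_eq0 => /andP[/eqP sx].
  rewrite paddr_eq0// => /andP[/eqP sy0 /eqP ca0].
  move: xy0; suff -> : x ^+ 2 + y ^+ 2 =
    (s * x) ^+ 2 + (s * y) ^+ 2 by rewrite sx sy0 expr0n/= addr0 eqxx.
  rewrite !exprMn -mulrDr; move: sc1; rewrite ca0 expr0n/= addr0 => ->; ring.
split=> //.
- rewrite -zetaM -etaM !Normc.normcM etaV Normc.normcV /t; field.
  by rewrite nc_eq0.
split.
- have -> : (fun=> 0 : 'cV[C]_2) = (fun x : R => 0 + 0) by apply/funext => x; rewrite addr0.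
  apply: dirac_solutionD; apply: dirac_solution_exp => //.
  + by rewrite -zetaM; ring.
  + have -> : M%:C - z = - (c%:C * k * eta) by rewrite etaM opprB.
    transitivity (- (c%:C * k * a * 1)); last by rewrite -zeE; ring.
    by rewrite -[1 in RHS]opprK -ii; ring.
  + by rewrite -zetaM; ring.
  + have -> : M%:C - z = - (c%:C * k * eta) by rewrite etaM opprB.
    transitivity (- (c%:C * k * b * 1)); last by rewrite -zeE; ring.
    by rewrite -[1 in RHS]opprK -ii; ring.
- apply: dirac_solution_exp => //.
  + by rewrite -zetaM; ring.
  + have -> : M%:C - z = - (c%:C * k * eta) by rewrite etaM opprB.
    transitivity (- (c%:C * k * 1)); last by rewrite -zeE; ring.
    by rewrite -[1 in RHS]opprK -ii; ring.
- rewrite /u !mxE/= !cexp0 !mul1r.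
  transitivity (s%:C * (zeta * eta)); last by rewrite zeE mulr1.
  by rewrite /a /b; field.
- rewrite /u !mxE/= !cexp0 !mul1r.
  transitivity (- ('i * 'i) * ca%:C); last by rewrite ii opprK mul1r.
  by rewrite /a /b; field.
- move=> x; rewrite /cross /u /w !mxE/= /W.
  transitivity (- (2 * 'i * zeta * b) * (cexp ('i * k) x * cexp (- ('i * k)) x)); first by ring.
  by rewrite cexpN mulr1.
- have i0 : 'i != 0 :> C by rewrite -nc_eq0 normc_i oner_eq0.
  by rewrite oppr_eq0; do !apply: mulf_neq0 => //; rewrite pnatr_eq0.
- exact: k0.
- exists (vnorm (vec2 zeta 'i)); split; first exact: vnorm_ge0.
  move=> x _; rewrite vnormZ nc_cexp mulrC ReM/=.
  by have -> : (0 * complex.Re k - 1 * complex.Im k) * x = - complex.Im k * x by ring.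
- move=> x y x0 xy.
  have ReI : complex.Re ('i * k) = - complex.Im k by rewrite ReM/=; ring.
  set e := cexp ('i * k) x; set e' := cexp (- ('i * k)) x.
  have ne : nc e = expR (- complex.Im k * x) by rewrite nc_cexp ReI.
  have ne' : nc e' = expR (complex.Im k * x) by rewrite nc_cexp ReN ReI opprK.
  have U : vnorm (u x) ^+ 2 = t * nc (a * e + b * e') ^+ 2 + nc (a * e - b * e') ^+ 2.
    rewrite sqr_vnorm /u !mxE/= -/e -/e' /t -!exprMn -!Normc.normcM; congr (nc _ ^+ 2 + _);
      first by ring.
    transitivity (nc ('i * (a * e - b * e')) ^+ 2); first by congr (nc _ ^+ 2); ring.
    by rewrite Normc.normcM normc_i mul1r.
  have V : vnorm (w y) ^+ 2 = expR (- complex.Im k * y) ^+ 2 * (t + 1).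
    by rewrite sqr_vnorm_vec2 nc_cexp ReI normc_i expr1n.
  have ab : nc (a * e) <= nc (b * e').
    rewrite (Normc.normcM a e) (Normc.normcM b e') ne ne'; apply: ler_pM;
      rewrite ?nc_ge0 ?expR_ge0//.
    by rewrite ler_expR; nra.
  have := parallelogram_le (ltW t0) ab; rewrite -U => U'.
  have K0 : 0 <= 1 + Num.max t t^-1.
    by rewrite addr_ge0// le_max (ltW t0).
  rewrite -ler_sqr ?nnegrE ?mulr_ge0 ?vnorm_ge0 ?sqrtr_ge0 ?nc_ge0 ?expR_ge0//.
  rewrite !exprMn V (sqr_sqrtr K0).
  have -> : nc W ^+ 2 = 4 * t * nc b ^+ 2.
    have n2 : nc (2 : C) = 2.
      have -> : (2 : C) = (2 : R)%:C by rewrite rmorph_nat.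
      by rewrite nc_real ger0_norm.
    by rewrite normcN !Normc.normcM normc_i n2 /t; ring.
  have -> : expR (- complex.Im k * (y - x)) = expR (- complex.Im k * y) * expR (complex.Im k * x).
    by rewrite -expRD; congr expR; ring.
  rewrite exprMn.
  have -> : (1 + Num.max t t^-1) * (4 * t * nc b ^+ 2) = 4 * (Num.max t 1 * (t + 1)) * nc b ^+ 2.
    have tm : (1 + Num.max t t^-1) * t = Num.max t 1 * (t + 1).
      have [t1|t1] := leP 1 t.
        rewrite max_l; first by ring.
        by rewrite (le_trans _ t1)// invf_le1.
      rewrite max_r; last by rewrite (le_trans (ltW t1))// invf_ge1// ltW.
      by field; rewrite gt_eqF.
    by rewrite -tm; ring.
  move: U'; rewrite (Normc.normcM b e') ne' exprMn => U'.
  have e2 : 0 <= expR (- complex.Im k * y) ^+ 2 * (t +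
    1) by rewrite mulr_ge0 ?sqr_ge0// ltW// addr_gt0.
  apply: le_trans (ler_wpM2r e2 U') _.
  by rewrite le_eqVlt; apply/orP; left; apply/eqP; ring.
Qed.
End FreeSolutions.

(** * Green's formula *)

Section Green.
Variable R : realType.
Local Notation C := R[i].
Local Notation nc := (@Normc.normc R).
Local Notation mu := (@lebesgue_measure R).
Local Notation intg D f := (mu.-integrable D (EFin \o f)).
Local Notation H := (@halfline R).

Lemma nc_cint_le_scale D (f : R -> C) (g : R -> R) (r : R) : 0 <= r -> measurable D ->
  cintegrable D f ->
  intg D g -> (forall x, D x -> r * nc (f x) <= g x) -> r * nc (cint D f) <= \int[mu]_(x in D) g x.
Proof.
rewrite le_eqVlt => /predU1P[<- mD fi gi fg|r0 mD fi gi fg].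
  by rewrite mul0r; apply: Rintegral_ge0 => x Dx; apply: le_trans (fg x Dx); rewrite mul0r.
rewrite mulrC -ler_pdivlMr// mulrC -RintegralZl//; apply: nc_cint_le => //.
  exact: integrable_scale.
by move=> x Dx; rewrite mulrC ler_pdivlMr// mulrC; exact: fg.
Qed.

Lemma not_integrable_lower_bound (g : R -> R) (X e : R) : 0 < e -> 0 <= X ->
  (forall x, X < x -> e <= g x) -> (forall x, 0 <= g x) -> ~ intg H g.
Proof.
move=> e0 X0 eg g0 ig.
pose I := \int[mu]_(x in H) g x.
have I0 : 0 <= I by apply: Rintegral_ge0.
pose Y := X + (I + 1) / e.
have XY : X < Y by rewrite /Y ltrDl divr_gt0// ltr_wpDl.
have sub : `]X, Y]%classic `<=` H.
  by move=> x; rewrite /halfline /= !in_itv/= andbT => /andP[Xx _]; exact: le_lt_trans Xx.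
have igY : intg `]X, Y]%classic g by apply: integrableS ig => //; exact: measurable_halfline.
have : \int[mu]_(x in `]X, Y]) e <= \int[mu]_(x in `]X, Y]) g x.
  apply: le_Rintegral => //.
    by apply: integrable_cst => //; exact: lebesgue_segment_lty.
  by move=> x; rewrite /= in_itv/= => /andP[Xx _]; exact: eg.
have mXY : mu `]X, Y]%classic = (Y - X)%:E.
  by rewrite lebesgue_measure_itv/= lte_fin XY EFinB.
have -> : \int[mu]_(x in `]X, Y]) e = I + 1.
  rewrite Rintegral_cst//; apply: etrans (congr1 (fun t => e * fine t) mXY) _.
  by rewrite /Y/=; field; rewrite gt_eqF.
have : \int[mu]_(x in `]X, Y]) g x <= I.
  rewrite /I /Rintegral fine_le//.
  - exact: integrable_fin_num.
  - by apply: integrable_fin_num => //; exact: measurable_halfline.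
  apply: ge0_subset_integral => //.
  - exact: measurable_halfline.
  - by apply/measurable_EFinP; exact: integrable_measurable ig.
  - by move=> x _; rewrite lee_fin.
lra.
Qed.

Variables (c M alpha : R) (z : C) (kappa K : R) (u w : R -> 'cV[C]_2) (W : C).
Hypothesis c0 : 0 < c.
Hypothesis G : green_pair c M alpha z kappa K u w W.
Implicit Types (h psi : R -> 'cV[C]_2) (x y : R).

Let mH : measurable H := @measurable_halfline R.

Let cC : c%:C != 0 :> C.
Proof. by rewrite eq_complex/= eqxx andbT gt_eqF. Qed.

Let ncV : nc c%:C^-1 = c^-1.
Proof. by rewrite Normc.normcV nc_real gtr0_norm. Qed.

Lemma dirac_solution_continuous h psi : dirac_solution c M z h psi ->
  ccontinuous (fun x => psi x 0 0) /\ ccontinuous (fun x => psi x 1 0).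
Proof. by move=> [p0 p1]; split; [exact: cprim_continuous p0|exact: cprim_continuous p1]. Qed.

Lemma dirac_solution_measurable h psi : dirac_solution c M z h psi ->
  cmeasurable H (fun x => psi x 0 0) /\ cmeasurable H (fun x => psi x 1 0).
Proof. by move=> /dirac_solution_continuous[? ?]; split; exact: ccontinuous_measurable. Qed.

Lemma dotv_solution_measurable h h' psi : dirac_solution c M z h' psi -> L2 h ->
  cmeasurable H (fun x => dotv (psi x) (h x)).
Proof.
by move=> /dirac_solution_measurable[? ?] /L2P[? ? _]; exact: cmeasurable_dotv.
Qed.

Lemma decaying_integrable h : L2 h -> cintegrable H (fun y => dotv (w y) (h y)).
Proof.
move=> hl; have [A [A0 wA]] := gp_decay G.
apply: (@cintegrable_le _ _ _ (fun y => A * (expR (- kappa * `|0 - y|) * vnorm (h y)))) => //.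
- exact: dotv_solution_measurable (gp_w G) hl.
- move=> y; rewrite /halfline /= in_itv/= andbT => y0.
  apply: (le_trans (nc_dotv _ _)); rewrite mulrA; apply: ler_wpM2r; first exact: vnorm_ge0.
  by rewrite sub0r normrN gtr0_norm//; apply: wA; exact: ltW.
- by apply: integrable_scale => //; apply: (decay_L2 (gp_kappa G) _ hl).1.
Qed.

Lemma solution_locally_integrable h h' psi x : dirac_solution c M z h' psi -> L2 h ->
  cintegrable `]0, x] (fun y => dotv (psi y) (h y)).
Proof.
move=> sp hl; have [k0 k1] := dirac_solution_continuous sp.
apply: (@cintegrable_le _ _ _ (fun y => vnorm (h y) * vnorm (psi y))) => //.
- by apply: cmeasurableS (dotv_solution_measurable sp hl) => //; exact: halfline_segment.
- by move=> y _; rewrite mulrC; exact: nc_dotv.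
- apply: locally_integrable_mul; last exact: continuous_vnorm.
  by move=> y; exact: L2_integrable_vnorm.
Qed.

(** Variation of constants with the coefficient of u vanishing at infinity and that of w vanishing at 0. *)
Definition green h x : 'cV[C]_2 :=
  let wh y := dotv (w y) (h y) in
  W^-1 *: ((c%:C^-1 * (cint H wh - cint `]0, x] wh)) *: u x
           + (c%:C^-1 * cint `]0, x] (fun y => dotv (u y) (h y))) *: w x).

Lemma green_solution h : L2 h -> dirac_solution c M z h (green h).
Proof.
move=> hl; have [u0 u1] := gp_u G; have [w0 w1] := gp_w G.
have W0 := gp_W0 G; have Wx := gp_cross G.
pose q x := c%:C^-1 * (cint H (fun y => dotv (w y) (h y)) - cint `]0, x] (fun y =>
  dotv (w y) (h y))).
pose p x := c%:C^-1 * cint `]0, x] (fun y => dotv (u y) (h y)).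
have pq : cprim q (fun x => c%:C^-1 * (0 - dotv (w x) (h x))).
  apply: cprimZ; apply: cprimB; first exact: cprim_cst.
  by apply: cprim_cint => x; exact: solution_locally_integrable (gp_w G) hl.
have pp : cprim p (fun x => c%:C^-1 * dotv (u x) (h x)).
  apply: cprimZ.
  by apply: cprim_cint => x; exact: solution_locally_integrable (gp_u G) hl.
split.
  have -> : (fun x => green h x 0 0) = (fun x => W^-1 * (q x * u x 0 0 + p x * w x 0 0)).
    by apply/funext => x; rewrite !mxE.
  apply: cprim_eq (cprimZ W^-1 (cprimD (cprimM pq u0) (cprimM pp w0))) => x _.
  rewrite /green !mxE -/(q x) -/(p x).
  transitivity (c%:C^-1 * ((z + M%:C) * (W^-1 * (q x * u x 1 0 + p x * w x 1 0)) +
    W^-1 * cross (w x) (u x) * h x 1 0)).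
    by rewrite /dotv /cross; ring.
  by rewrite Wx mulVf// mul1r.
have -> : (fun x => green h x 1 0) = (fun x => W^-1 * (q x * u x 1 0 + p x * w x 1 0)).
  by apply/funext => x; rewrite !mxE.
apply: cprim_eq (cprimZ W^-1 (cprimD (cprimM pq u1) (cprimM pp w1))) => x _.
rewrite /green !mxE -/(q x) -/(p x).
transitivity (c%:C^-1 * ((M%:C - z) * (W^-1 * (q x * u x 0 0 +
  p x * w x 0 0)) - W^-1 * cross (w x) (u x) * h x 0 0)).
  by rewrite /dotv /cross; ring.
by rewrite Wx mulVf// mul1r.
Qed.

Lemma cint_segment0 (f : R -> C) : cint `]0, 0] f = 0.
Proof. by rewrite /cint !Rintegral_segment0. Qed.

Lemma green_boundary h : green h 0 0 0 * (cos alpha)%:C - green h 0 1 0 * (sin alpha)%:C = 0.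
Proof. by rewrite /green !cint_segment0 !mxE (gp_u0 G) (gp_u1 G); ring. Qed.

(** The two integrals in green run over y > x and y <= x, so together they give the integral of the kernel
bound over the half-line. *)
Lemma green_bound h x : L2 h -> 0 <= x ->
  vnorm (green h x) <= K / c * \int[mu]_(y in H) (expR (- kappa * `|x - y|) * vnorm (h y)).
Proof.
move=> hl x0.
have W0 : 0 < nc W by rewrite nc_gt0; exact: gp_W0 G.
have [ie _] := decay_L2 (gp_kappa G) x0 hl.
pose g y := K * nc W * (expR (- kappa * `|x - y|) * vnorm (h y)).
have ig : intg H g by exact: integrable_scale.
have sub1 : `]x, +oo[%classic `<=` H by apply: subset_itvr; rewrite bnd_simp.
have sub2 := @halfline_segment R x.
have ig1 : intg `]x, +oo[%classic g by apply: integrableS ig.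
have ig2 : intg `]0, x]%classic g by apply: integrableS ig.
rewrite -(ler_pM2l W0).
have -> : nc W * vnorm (green h x) = vnorm (W *: green h x) by rewrite vnormZ.
rewrite /green scalerA mulfV ?(gp_W0 G)// scale1r cint_tail//; last exact: decaying_integrable.
apply: (le_trans (vnormD _ _)); rewrite !vnormZ !Normc.normcM ncV.
have -> : nc W * (K / c * \int[mu]_(y in H) (expR (- kappa * `|x - y|) * vnorm (h y))) =
  c^-1 * \int[mu]_(y in H) g y.
  by rewrite /g RintegralZl//; ring.
have -> : \int[mu]_(y in H) g y = \int[mu]_(y in `]x, +oo[) g y + \int[mu]_(y in `]0, x]) g y.
  have <- := @Rintegral_itvB R g (BRight 0) +oo%O x ig _ _; rewrite ?bnd_simp//.
  by rewrite subrK.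
rewrite mulrDr; apply: lerD; rewrite -mulrA; apply: ler_wpM2l; rewrite ?invr_ge0 ?(ltW c0)// mulrC;
  apply: nc_cint_le_scale; rewrite ?vnorm_ge0//.
- by apply: cintegrableS (decaying_integrable hl).
- move=> y; rewrite /= in_itv/= andbT => xy.
  apply: le_trans (ler_wpM2l (vnorm_ge0 _) (nc_dotv _ _)) _.
  rewrite /g !mulrA; apply: ler_wpM2r; first exact: vnorm_ge0.
  by rewrite ltr0_norm ?subr_lt0// opprB; apply: (gp_bound G) => //; exact: ltW.
- exact: solution_locally_integrable (gp_u G) hl.
- move=> y; rewrite /= in_itv/= => /andP[y0 yx].
  apply: le_trans (ler_wpM2l (vnorm_ge0 _) (nc_dotv _ _)) _.
  rewrite /g !mulrA; apply: ler_wpM2r; first exact: vnorm_ge0.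
  by rewrite ger0_norm ?subr_ge0// mulrC; apply: (gp_bound G) => //; exact: ltW.
Qed.

Lemma boundary_cross psi :
  psi 0 0 0 * (cos alpha)%:C - psi 0 1 0 * (sin alpha)%:C = 0 -> cross (u 0) (psi 0) = 0.
Proof. by rewrite /cross (gp_u0 G) (gp_u1 G) => E; apply/eqP; rewrite -oppr_eq0; apply/eqP;
  rewrite -[RHS]E; ring. Qed.

(** By the Lagrange identity the Wronskian of w and psi has a limit d at infinity. If d were not 0, then
|psi| would be bounded below near infinity, because w is bounded there; this contradicts square
integrability. *)
Lemma cross_decaying h psi : L2 h -> L2 psi -> dirac_solution c M z h psi ->
  cross (w 0) (psi 0) = c%:C^-1 * cint H (fun y => dotv (w y) (h y)).
Proof.
move=> hl pl sp; have k0 := gp_kappa G; have [A [A0 wA]] := gp_decay G.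
have iw := decaying_integrable hl.
set f := fun y => dotv (w y) (h y) in iw *.
apply/eqP; rewrite -subr_eq0; apply/eqP; set d := _ - _.
have [//|d0] := eqVneq d 0; exfalso.
have dp : 0 < nc d by rewrite nc_gt0.
have E x : 0 <= x -> cross (w x) (psi x) = d + c%:C^-1 * cint `]x, +oo[ f.
  move=> x0; have [_ ->] := cprim_eval (cross_cprim cC (gp_w G) sp) x0.
  have -> : cint `]0, x] (fun y => - (c%:C^-1 * dotv (w y) (h y))) = - (c%:C^-1 * cint `]0, x] f).
    have P1 := cprimN (cprimZ c%:C^-1 (cprim_cint (fun x =>
      solution_locally_integrable x (gp_w G) hl))).
    have [_] := cprim_eval P1 x0; rewrite /= cint_segment0 mulr0 oppr0 add0r.
    by move=> ->.
  by rewrite -cint_tail// /d; ring.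
have k2 : 0 < kappa / 2 by lra.
have [ie _] := decay_L2 k2 (lexx 0) hl.
set T := \int[mu]_(y in H) (expR (- (kappa / 2) * `|0 - y|) * vnorm (h y)).
have T0 : 0 <= T by apply: Rintegral_ge0 => y _; rewrite mulr_ge0 ?expR_ge0 ?vnorm_ge0.
have tail x : 0 <= x -> nc (cint `]x, +oo[ f) <= A * expR (- (kappa / 2) * x) * T.
  move=> x0.
  have sub1 : `]x, +oo[%classic `<=` H by apply: subset_itvr; rewrite bnd_simp.
  have igx : intg `]x, +oo[%classic (fun y =>
    expR (- (kappa / 2) * `|0 - y|) * vnorm (h y)) by apply: integrableS ie.
  apply: (@le_trans _ _ (\int[mu]_(y in `]x,
    +oo[) (A * expR (- (kappa / 2) * x) * (expR (- (kappa / 2) * `|0 - y|) * vnorm (h y))))).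
    apply: nc_cint_le => //; first by apply: cintegrableS iw.
      exact: integrable_scale.
    move=> y; rewrite /= in_itv/= andbT => xy.
    apply: le_trans (nc_dotv _ _) _.
    rewrite !mulrA; apply: ler_wpM2r; first exact: vnorm_ge0.
    apply: le_trans (wA y _) _; first exact: ltW (le_lt_trans x0 xy).
    rewrite -mulrA; apply: ler_wpM2l => //.
    rewrite -expRD ler_expR sub0r normrN ger0_norm; last exact: ltW (le_lt_trans x0 xy).
    by nra.
  rewrite RintegralZl//; apply: ler_wpM2l; first by rewrite mulr_ge0// expR_ge0.
  rewrite /T /Rintegral fine_le//.
  - exact: integrable_fin_num.
  - exact: integrable_fin_num.
  apply: ge0_subset_integral => //.
  - by apply/measurable_EFinP; exact: integrable_measurable ie.
  - by move=> y _; rewrite lee_fin mulr_ge0 ?expR_ge0 ?vnorm_ge0.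
(* From X on, the remaining integral contributes at most half of |d|. *)
pose B := c^-1 * A * T.
have B0 : 0 <= B by apply: mulr_ge0 => //; apply: mulr_ge0 => //; rewrite invr_ge0; exact: ltW.
pose X := 2 * B / (nc d * (kappa / 2)).
have X0 : 0 <= X by apply: divr_ge0; apply: mulr_ge0 => //; exact: ltW.
have low x : X < x -> nc d / 2 <= (A + 1) * vnorm (psi x).
  move=> Xx; have x0 : 0 <= x by exact: ltW (le_lt_trans X0 Xx).
  have eX : B * expR (- (kappa / 2) * x) <= nc d / 2.
    rewrite mulNr expRN ler_pdivrMr ?expR_gt0//.
    have e1 := expR_ge1Dx (kappa / 2 * x).
    have : 2 * B <= nc d * (kappa / 2) * x.
      by rewrite -ler_pdivrMl ?mulr_gt0// mulrC; exact: ltW.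
    by nra.
  have n1 : nc d <= nc (cross (w x) (psi x)) + c^-1 * nc (cint `]x, +oo[ f).
    have -> : d = cross (w x) (psi x) - c%:C^-1 * cint `]x, +oo[ f by rewrite E// addrK.
    by apply: (le_trans (le_normcD _ _)); rewrite normcN Normc.normcM ncV.
  have n2 : c^-1 * nc (cint `]x, +oo[ f) <= B * expR (- (kappa / 2) * x).
    have -> : B * expR (- (kappa / 2) * x) =
      c^-1 * (A * expR (- (kappa / 2) * x) * T) by rewrite /B; ring.
    by apply: ler_wpM2l; [rewrite invr_ge0 ltW|exact: tail].
  have n3 : nc (cross (w x) (psi x)) <= (A + 1) * vnorm (psi x).
    apply: le_trans (nc_cross _ _) _; apply: ler_wpM2r; first exact: vnorm_ge0.
    apply: le_trans (wA x x0) _.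
    have : expR (- kappa * x) <= 1 by rewrite -expR0 ler_expR; nra.
    have := expR_ge0 (- kappa * x); nra.
  lra.
have A1 : 0 < A + 1 by lra.
apply: (@not_integrable_lower_bound (fun x =>
  vnorm (psi x) ^+ 2) X ((nc d / 2 / (A + 1)) ^+ 2)) => //.
- by rewrite exprn_gt0// !divr_gt0.
- move=> x Xx; rewrite ler_sqr ?nnegrE ?vnorm_ge0//; last by rewrite !divr_ge0// ltW.
  by rewrite ler_pdivrMr// [leRHS]mulrC; exact: low.
- by move=> x; exact: sqr_ge0.
- by have /L2P[] := pl.
Qed.

(** The Wronskian of u and psi vanishes at 0 by the boundary condition, that of w and psi vanishes at
infinity, and both have known derivatives; psi is a combination of u and w with these coefficients. *)
Lemma green_representation h psi : L2 h -> L2 psi -> dirac_solution c M z h psi ->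
  psi 0 0 0 * (cos alpha)%:C - psi 0 1 0 * (sin alpha)%:C = 0 ->
  forall x, 0 <= x -> psi x = green h x.
Proof.
move=> hl pl sp bc x x0.
have iu := fun x => solution_locally_integrable x (gp_u G) hl.
have iw := fun x => solution_locally_integrable x (gp_w G) hl.
have Eu : cross (u x) (psi x) = - (c%:C^-1 * cint `]0, x] (fun y => dotv (u y) (h y))).
  have [_ ->] := cprim_eval (cross_cprim cC (gp_u G) sp) x0.
  rewrite (boundary_cross bc) add0r.
  have [_] := cprim_eval (cprimN (cprimZ c%:C^-1 (cprim_cint iu))) x0.
  by rewrite /= cint_segment0 mulr0 oppr0 add0r => ->.
have Ew : cross (w x) (psi x) = c%:C^-1 * (cint H (fun y =>
  dotv (w y) (h y)) - cint `]0, x] (fun y => dotv (w y) (h y))).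
  have [_ ->] := cprim_eval (cross_cprim cC (gp_w G) sp) x0.
  rewrite (cross_decaying hl pl sp) mulrBr; congr (_ + _).
  have [_] := cprim_eval (cprimN (cprimZ c%:C^-1 (cprim_cint iw))) x0.
  by rewrite /= cint_segment0 mulr0 oppr0 add0r => ->.
rewrite /green -Ew -[_ * cint _ (fun y =>
  dotv (u y) _)]opprK -Eu scaleNr -cross_plucker (gp_cross G).
by rewrite scalerA mulVf ?scale1r// (gp_W0 G).
Qed.
End Green.

(** * The domain of the Dirac operator *)

Section Domain.
Variable R : realType.
Local Notation C := R[i].
Local Notation nc := (@Normc.normc R).
Local Notation mu := (@lebesgue_measure R).
Local Notation intg D f := (mu.-integrable D (EFin \o f)).
Local Notation H := (@halfline R).
Implicit Types (psi phi h : R -> 'cV[C]_2) (z : C).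

Lemma primitive_ae (f g g' : R -> R) : measurable_fun H g' ->
  {ae mu, forall x, H x -> g x = g' x} -> primitive f g -> primitive f g'.
Proof.
move=> mg' gg' [ig fE].
have ae (x : R) : {ae mu, forall y, `]0, x]%classic y -> (g y)%:E = (g' y)%:E}.
  by apply: ae_imply gg' => y gy yx; rewrite gy//; exact: halfline_segment yx.
have mg (x : R) : measurable_fun `]0, x]%classic g' by apply: measurable_funS mg' => //;
  [exact: measurable_halfline|exact: halfline_segment].
split=> [x|x x0].
  have /integrableP[m1 l1] := ig x.
  have m2 : measurable_fun `]0, x]%classic (EFin \o g') by apply/measurable_EFinP; exact: mg.
  apply/integrableP; split=> //.
  apply: le_lt_trans l1; rewrite le_eqVlt; apply/orP; left; apply/eqP.
  apply: ae_eq_integral => //.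
  - exact: measurableT_comp.
  - exact: measurableT_comp.
  - by apply: ae_imply (ae x) => y gy yx /=; have [->] := gy yx.
rewrite fE//; congr (_ + fine _); apply: ae_eq_integral => //.
- by have /integrableP[] := ig x.
- by apply/measurable_EFinP; exact: mg.
- exact: ae.
Qed.

Lemma cprim_ae (f g g' : R -> C) : cmeasurable H g' ->
  {ae mu, forall x, H x -> g x = g' x} -> cprim f g -> cprim f g'.
Proof.
move=> [mr mi] gg' [pr pi]; split.
  by apply: primitive_ae pr => //; apply: ae_imply gg' => x gx hx; rewrite gx.
by apply: primitive_ae pi => //; apply: ae_imply gg' => x gx hx; rewrite gx.
Qed.

Lemma L2_ae psi phi : eq_ae psi phi ->
  cmeasurable H (fun x => phi x 0 0) -> cmeasurable H (fun x => phi x 1 0) -> L2 psi -> L2 phi.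
Proof.
move=> e m0 m1 /L2P[p0 p1 /integrableP[mi li]]; apply/L2P; split=> //.
have mv : measurable_fun H (fun x => vnorm (phi x) ^+ 2) by apply: measurable_funX;
  exact: measurable_vnorm.
apply/integrableP; split; first exact/measurable_EFinP.
apply: le_lt_trans li; rewrite le_eqVlt; apply/orP; left; apply/eqP.
apply: ae_eq_integral.
- exact: measurable_halfline.
- by apply: measurableT_comp => //; exact/measurable_EFinP.
- exact: measurableT_comp.
- by apply: ae_imply e => x e hx /=; rewrite e.
Qed.

Lemma L2norm_ae psi phi : eq_ae psi phi -> L2 psi -> L2 phi -> L2norm psi = L2norm phi.
Proof.
move=> e pl fl; rewrite /L2norm; congr Num.sqrt; rewrite /Rintegral; congr fine.
apply: ae_eq_integral.
- exact: measurable_halfline.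
- by apply/measurable_EFinP; apply: measurable_funX; exact: L2_measurable_vnorm.
- by apply/measurable_EFinP; apply: measurable_funX; exact: L2_measurable_vnorm.
- by apply: ae_imply e => x e hx /=; rewrite e.
Qed.

Lemma L2_locally_integrable h (i : 'I_2) : L2 h ->
  locally_integrable (fun x => complex.Re (h x i 0)) /\ locally_integrable (fun x =>
    complex.Im (h x i 0)).
Proof.
move=> hl; have [mh _] := hl; have [mr mi] := mh i 0.
have nle x : nc (h x i 0) <= vnorm (h x).
  by elim/ord2_ind: i {mr mi}; [exact: nc_comp0|exact: nc_comp1].
split=> x; apply: (integrable_le _ _ _ (L2_integrable_vnorm x hl)) => //.
- by apply: measurable_funS mr; [exact: measurable_halfline|exact: halfline_segment].
- by move=> y _; exact: le_trans (normr_Re_le _) (nle y).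
- by apply: measurable_funS mi; [exact: measurable_halfline|exact: halfline_segment].
- by move=> y _; exact: le_trans (normr_Im_le _) (nle y).
Qed.

(** On the continuous representative the weak derivatives become derivatives of absolutely continuous
functions. Subtracting z psi on both sides brings the spectral parameter into the system. *)
Lemma dirac_domain_solution (c m alpha : R) z psi phi : 0 < c ->
  dirac_halfline c m alpha psi phi ->
  exists psic, [/\ eq_ae psi psic, L2 psi, L2 psic,
    psic 0 0 0 * (cos alpha)%:C - psic 0 1 0 * (sin alpha)%:C = 0 &
    dirac_solution c (m * c ^+ 2) z (fun x => phi x - z *: psic x) psic].
Proof.
move=> c0 [phil [dpsi [a [[psil dl wd] [psic [cc e <-]] bc Eq]]]].
have cC : c%:C != 0 :> C by rewrite eq_complex/= eqxx andbT gt_eqF.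
exists psic.
have cm i : cmeasurable H (fun x => psic x i 0) by apply: ccontinuous_measurable; exact: cc.
have pcl : L2 psic by exact: L2_ae e (cm 0) (cm 1) psil.
have pr i : cprim (fun x => psic x i 0) (fun x => dpsi x i 0).
  have [mp _] := psil; have [ir ii] := L2_locally_integrable i dl.
  split.
  - apply: (@weak_primitive _ (fun x => complex.Re (psi x i 0))) => //.
    + exact: (mp i 0).1.
    + exact: (cc i 0).1.
    + by apply: ae_imply e => x e hx; rewrite e.
    + exact: (wd i).1.
  - apply: (@weak_primitive _ (fun x => complex.Im (psi x i 0))) => //.
    + exact: (mp i 0).2.
    + exact: (cc i 0).2.
    + by apply: ae_imply e => x e hx; rewrite e.
    + exact: (wd i).2.
have [ml _] := phil.
split=> //; split.
- apply: cprim_ae (pr 0).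
  + apply: cmeasurableM; first exact: cmeasurable_cst.
    apply: cmeasurableD; first by apply: cmeasurableM; [exact: cmeasurable_cst|exact: cm].
    under eq_fun do rewrite !mxE.
    apply: cmeasurableD; first exact: ml.
    by apply: cmeasurableN; apply: cmeasurableM; [exact: cmeasurable_cst|exact: cm].
  + apply: ae_imply2 Eq e => x Eqx ex hx; rewrite !mxE.
    have [_ ->] := Eqx hx; rewrite ex//; field; exact: cC.
- apply: cprim_ae (pr 1).
  + apply: cmeasurableM; first exact: cmeasurable_cst.
    apply: cmeasurableD; first by apply: cmeasurableM; [exact: cmeasurable_cst|exact: cm].
    apply: cmeasurableN; under eq_fun do rewrite !mxE.
    apply: cmeasurableD; first exact: ml.
    by apply: cmeasurableN; apply: cmeasurableM; [exact: cmeasurable_cst|exact: cm].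
  + apply: ae_imply2 Eq e => x Eqx ex hx; rewrite !mxE.
    have [-> _] := Eqx hx; rewrite ex//; field; exact: cC.
Qed.

Lemma solution_dirac_domain (c m alpha : R) z psi h : 0 < c -> L2 psi -> L2 h ->
  psi 0 0 0 * (cos alpha)%:C - psi 0 1 0 * (sin alpha)%:C = 0 ->
  dirac_solution c (m * c ^+ 2) z h psi ->
  dirac_halfline c m alpha psi (fun x => z *: psi x + h x).
Proof.
move=> c0 pl hl bc sp; set M := m * c ^+ 2 in sp.
have cC : c%:C != 0 :> C by rewrite eq_complex/= eqxx andbT gt_eqF.
split; first by apply: L2D => //; exact: L2Z.
have [k0 k1] := dirac_solution_continuous sp; have [p0 p1] := sp.
have /L2P[m0 m1 _] := pl; have /L2P[n0 n1 _] := hl.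
pose dpsi x : 'cV[C]_2 := vec2 (c%:C^-1 * ((z + M%:C) * psi x 1 0 + h x 1 0))
   (c%:C^-1 * ((M%:C - z) * psi x 0 0 - h x 0 0)).
exists dpsi, (psi 0); split=> //.
- split=> //.
    have -> : dpsi = fun x => c%:C^-1 *: (vec2 ((z + M%:C) * psi x 1 0) ((M%:C - z) * psi x 0 0) +
      vec2 (h x 1 0) (- h x 0 0)).
      by apply/funext => x; apply: cV2P; rewrite !mxE/=.
    apply: L2Z; apply: L2D.
      apply: (@L2_le _ _ (fun x => (nc (z + M%:C) ^+ 2 + nc (M%:C - z) ^+ 2) * vnorm (psi x) ^+ 2)).
      - by under eq_fun do rewrite mxE/=; apply: cmeasurableM => //; exact: cmeasurable_cst.
      - by under eq_fun do rewrite mxE/=; apply: cmeasurableM => //; exact: cmeasurable_cst.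
      - apply: integrable_scale; first exact: measurable_halfline.
        by have /L2P[] := pl.
      - move=> x _; rewrite !sqr_vnorm !mxE/= !Normc.normcM !exprMn.
        have := mulr_ge0 (sqr_ge0 (nc (z + M%:C))) (sqr_ge0 (nc (psi x 0 0))).
        have := mulr_ge0 (sqr_ge0 (nc (M%:C - z))) (sqr_ge0 (nc (psi x 1 0))).
        lra.
    apply: (@L2_le _ _ (fun x => vnorm (h x) ^+ 2)).
    - by under eq_fun do rewrite mxE/=.
    - by under eq_fun do rewrite mxE/=; exact: cmeasurableN.
    - by have /L2P[] := hl.
    - by move=> x _; rewrite !sqr_vnorm !mxE/= normcN addrC.
  elim/ord2_ind; split; under [X in weak_derivative _ X]eq_fun do rewrite mxE/=.
  + by apply: primitive_weak; exact: p0.1.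
  + by apply: primitive_weak; exact: p0.2.
  + by apply: primitive_weak; exact: p1.1.
  + by apply: primitive_weak; exact: p1.2.
- exists psi; split=> //; last by apply: aeW.
  by move=> i j; rewrite (ord1 j); elim/ord2_ind: i.
- apply: aeW => x _; rewrite /dpsi !mxE/= -/M; clear -cC; clearbody M.
  by split; field; exact: cC.
Qed.
End Domain.

(** * The potential and the a priori bound *)

Section Potential.
Variable R : realType.
Local Notation C := R[i].
Local Notation nc := (@Normc.normc R).
Local Notation mu := (@lebesgue_measure R).
Local Notation intg D f := (mu.-integrable D (EFin \o f)).
Local Notation H := (@halfline R).
Implicit Types (psi g h delta : R -> 'cV[C]_2).
Variable V : R -> 'M[C]_2.
Hypothesis V_pot : potential V.

Let mH : measurable H := @measurable_halfline R.

Lemma opnorm_distr (A B : 'M[C]_2) : `|opnorm A - opnorm B| <= entry_sum (A - B).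
Proof.
rewrite ler_norml opnorm_dist andbT lerNl opprB (le_trans (opnorm_dist _ _))//.
by rewrite /entry_sum -(opprB A B) !mxE !normcN.
Qed.

Lemma potential_entry_continuous i j : ccontinuous (fun x => V x i j).
Proof. by have [VS _] := V_pot; have [[cr _] [ci _]] := VS i j. Qed.

Lemma potential_entry_measurable i j : cmeasurable H (fun x => V x i j).
Proof. by apply: ccontinuous_measurable; exact: potential_entry_continuous. Qed.

Lemma potential_opnorm_continuous : {within @halfline_closed R, continuous (fun x => opnorm (V x))}.
Proof.
move=> x; apply/cvgrPdist_le => /= e e0.
(* Eight real coordinates of the matrix, each within e / 8. *)
have e8 : 0 < e / 8 by rewrite divr_gt0.
have ne i j : \forall y \near (x : subspace (@halfline_closed R)), nc (V x i j - V y i j) <= e / 4.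
  have [/(_ x)/cvgrPdist_le/(_ _ e8) cr /(_ x)/cvgrPdist_le/(_ _ e8) ci] :=
    potential_entry_continuous i j.
  near=> y; apply: (le_trans (nc_le_ReIm _)).
  have h1 : `|complex.Re (V x i j) - complex.Re (V y i j)| <= e / 8 by near: y; exact: cr.
  have h2 : `|complex.Im (V x i j) - complex.Im (V y i j)| <= e / 8 by near: y; exact: ci.
  rewrite !ReImE; lra.
have n00 := ne 0 0; have n01 := ne 0 1; have n10 := ne 1 0; have n11 := ne 1 1.
near=> y; apply: (le_trans (opnorm_distr _ _)); rewrite /entry_sum !mxE.
have h00 : nc (V x 0 0 - V y 0 0) <= e / 4 by near: y; exact: n00.
have h01 : nc (V x 0 1 - V y 0 1) <= e / 4 by near: y; exact: n01.
have h10 : nc (V x 1 0 - V y 1 0) <= e / 4 by near: y; exact: n10.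
have h11 : nc (V x 1 1 - V y 1 1) <= e / 4 by near: y; exact: n11.
lra.
Unshelve. all: by end_near. Qed.

Lemma potential_support : exists b, 0 < b /\ forall x, b < x -> V x = 0.
Proof.
have [_ [b Vb]] := V_pot; exists (`|b| + 1); split; first by rewrite ltr_wpDl.
by move=> x bx; apply: Vb; have := ler_norm b; lra.
Qed.

Lemma potential_bounded : exists N, 0 <= N /\ forall x, 0 <= x -> opnorm (V x) <= N.
Proof.
have [b [b0 Vb]] := potential_support.
have [x0 _ max0] := EVT_max (ltW b0) (@within_halfline_segment _ _ b potential_opnorm_continuous).
exists (opnorm (V x0)); split; first exact: opnorm_ge0.
move=> x xp; have [xb|bx] := leP x b; first by apply: max0; rewrite in_itv/= xp.
by rewrite Vb// opnorm0 opnorm_ge0.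
Qed.

Lemma potential_opnorm_integrable : intg H (fun x => opnorm (V x)).
Proof.
have [b [b0 Vb]] := potential_support.
apply: (@integrable_halfline_supp _ _ b); first exact: potential_opnorm_continuous.
by move=> x /Vb ->; rewrite opnorm0.
Qed.

Lemma potential_mul_measurable psi i : cmeasurable H (fun x => psi x 0 0) ->
  cmeasurable H (fun x => psi x 1 0) ->
  cmeasurable H (fun x => (V x *m psi x) i 0).
Proof.
move=> m0 m1; under eq_fun do rewrite mulmx2E.
by apply: cmeasurableD; apply: cmeasurableM => //; exact: potential_entry_measurable.
Qed.

Lemma potential_mul_L2 psi : L2 psi -> L2 (fun x => V x *m psi x).
Proof.
move=> /L2P[m0 m1 ip]; have [N [N0 VN]] := potential_bounded.
apply: (@L2_le _ _ (fun x => N ^+ 2 * vnorm (psi x) ^+ 2)).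
- exact: potential_mul_measurable.
- exact: potential_mul_measurable.
- exact: integrable_scale.
- move=> x; rewrite /halfline /= in_itv/= andbT => x0.
  rewrite -exprMn ler_sqr ?nnegrE ?mulr_ge0 ?vnorm_ge0//.
  apply: le_trans (vnorm_mulmx _ _) _; apply: ler_wpM2r; first exact: vnorm_ge0.
  by apply: VN; exact: ltW.
Qed.

(** As V has compact support, V psi is square integrable for psi merely bounded. *)
Lemma potential_mul_bounded_L2 psi (S : R) : 0 <= S ->
  cmeasurable H (fun x => psi x 0 0) -> cmeasurable H (fun x => psi x 1 0) ->
  (forall x, 0 < x -> vnorm (psi x) <= S) ->
  L2 (fun x => V x *m psi x) /\ forall N : R, (forall x, 0 <= x -> opnorm (V x) <= N) ->
   L2norm (fun x => V x *m psi x) ^+ 2 <= S ^+ 2 * N * norm1 V.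
Proof.
move=> S0 m0 m1 pS.
have bnd (N : R) : (forall x, 0 <= x -> opnorm (V x) <= N) -> forall x, H x ->
    vnorm (V x *m psi x) ^+ 2 <= S ^+ 2 * N * opnorm (V x).
  move=> VN x; rewrite /halfline /= in_itv/= andbT => x0.
  have n0 := opnorm_ge0 (V x); have n1 := VN x (ltW x0).
  apply: (@le_trans _ _ ((opnorm (V x) * S) ^+ 2)).
    rewrite ler_sqr ?nnegrE ?mulr_ge0 ?vnorm_ge0//.
    by apply: le_trans (vnorm_mulmx _ _) _; apply: ler_wpM2l => //; exact: pS.
  have := sqr_ge0 S; rewrite exprMn => S2.
  have := mulr_ge0 S2 (mulr_ge0 n0 (_ : 0 <= N - opnorm (V x))).
  by rewrite subr_ge0 => /(_ n1); nra.
have iN (a : R) : intg H (fun x => a * opnorm (V x)).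
  by apply: integrable_scale => //; exact: potential_opnorm_integrable.
have VL : L2 (fun x => V x *m psi x).
  have [N [N0 VN]] := potential_bounded.
  apply: (L2_le _ _ (iN (S ^+ 2 * N)) (bnd N VN)); exact: potential_mul_measurable.
split=> // N VN; rewrite sqr_L2norm /norm1 -RintegralZl//; last exact: potential_opnorm_integrable.
apply: le_Rintegral => //; first by have /L2P[] := VL.
exact: bnd.
Qed.

Variables (c M alpha : R) (z : C) (kappa K : R) (u w : R -> 'cV[C]_2) (W : C).
Hypothesis c0 : 0 < c.
Hypothesis K0 : 0 <= K.
Hypothesis G : green_pair c M alpha z kappa K u w W.

(** The bound of the supremum of the free resolvent applied to g. *)
Definition free_sup g := K / c * (L2norm g / Num.sqrt kappa).

Lemma free_sup_ge0 g : 0 <= free_sup g.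
Proof.
by apply: mulr_ge0; apply: divr_ge0; rewrite ?sqrtr_ge0 ?L2norm_ge0 ?K0 ?(ltW c0).
Qed.

(** The exponential is kept in the integral of g, which is only square integrable, and dropped in that of
V delta. The hypothesis on delta involves only the support of V, where delta is controlled. *)
Lemma green_potential_bound g delta (B : R) : L2 g -> L2 (fun x => V x *m delta x) ->
  (forall y, 0 < y -> opnorm (V y) * vnorm (delta y) <= B * opnorm (V y)) ->
  forall x, 0 <= x ->
  vnorm (green c u w W (fun y => g y - V y *m delta y) x) <= free_sup g + K / c * norm1 V * B.
Proof.
move=> gl Vl dB x x0.
have hl := L2B gl Vl.
apply: (le_trans (green_bound c0 G hl x0)).
have -> : free_sup g + K / c * norm1 V * B = K / c * (L2norm g / Num.sqrt kappa + norm1 V * B).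
  by rewrite /free_sup; ring.
apply: ler_wpM2l; first by apply: divr_ge0 => //; exact: ltW.
have [ig Eg] := decay_L2 (gp_kappa G) x0 gl.
have [ih _] := decay_L2 (gp_kappa G) x0 hl.
have iV := potential_opnorm_integrable.
apply: (@le_trans _ _ (\int[mu]_(y in H) (expR (- kappa * `|x - y|) * vnorm (g y) +
  B * opnorm (V y)))).
  apply: le_Rintegral => //.
    by apply: integrable_add => //; exact: integrable_scale.
  move=> y; rewrite /halfline /= in_itv/= andbT => y0.
  have e1 : expR (- kappa * `|x - y|) <= 1.
    by rewrite -expR0 ler_expR mulNr oppr_le0 mulr_ge0// ltW// (gp_kappa G).
  apply: (@le_trans _ _ (expR (- kappa * `|x - y|) * (vnorm (g y) + vnorm (V y *m delta y)))).
    by apply: ler_wpM2l; [exact: expR_ge0|exact: vnormB].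
  rewrite mulrDr lerD2l; apply: (@le_trans _ _ (vnorm (V y *m delta y))).
    by rewrite ler_piMl// vnorm_ge0.
  by apply: le_trans (vnorm_mulmx _ _) _; exact: dB.
rewrite RintegralD//; last exact: integrable_scale.
rewrite RintegralZl// (mulrC (norm1 V)) /norm1.
by apply: lerD.
Qed.

(** On the support of V, inside some [0, b], the maximum of |psi| is attained; there the Green formula bounds
it by the contribution of g plus K v times itself. *)
Lemma a_priori_bound g psi : K / c * norm1 V < 1 -> L2 g -> L2 psi ->
  dirac_solution c M z (fun x => g x - V x *m psi x) psi ->
  psi 0 0 0 * (cos alpha)%:C - psi 0 1 0 * (sin alpha)%:C = 0 ->
  forall x, 0 <= x -> vnorm (psi x) <= free_sup g / (1 - K / c * norm1 V).
Proof.
move=> th1 gl pl sp bc.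
have Vl := potential_mul_L2 pl; have hl := L2B gl Vl.
have rep := green_representation c0 G hl pl sp bc.
have [b [b0 Vb]] := potential_support.
have [k0 k1] := dirac_solution_continuous sp.
have [x0 x0b max0] := EVT_max (ltW b0) (@within_halfline_segment _ _ b (continuous_vnorm k0 k1)).
have dB y : 0 < y -> opnorm (V y) * vnorm (psi y) <= vnorm (psi x0) * opnorm (V y).
  move=> y0; have [yb|yb] := leP y b; last by rewrite Vb// opnorm0 mul0r mulr0.
  rewrite mulrC; apply: ler_wpM2r; first exact: opnorm_ge0.
  by apply: max0; rewrite in_itv/= yb ltW.
have bnd x (xp : 0 <= x) := green_potential_bound gl Vl dB xp.
have d0 : 0 < 1 - K / c * norm1 V by rewrite subr_gt0.
have B : vnorm (psi x0) <= free_sup g / (1 - K / c * norm1 V).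
  have x0p : 0 <= x0 by move: x0b; rewrite in_itv/= => /andP[].
  have := bnd x0 x0p; rewrite -rep// => Bx.
  by rewrite ler_pdivlMr//; lra.
have th0 : 0 <= K / c * norm1 V.
  apply: mulr_ge0; first by apply: divr_ge0 => //; exact: ltW.
  by apply: Rintegral_ge0 => y _; exact: opnorm_ge0.
move=> x xp; rewrite rep//; apply: (le_trans (bnd x xp)).
apply: (@le_trans _ _ (free_sup g + K / c * norm1 V * (free_sup g / (1 - K / c * norm1 V)))).
  by rewrite lerD2l; apply: ler_wpM2l.
move: (K / c * norm1 V) d0 => t d0.
have -> : free_sup g + t * (free_sup g / (1 - t)) = free_sup g / (1 - t).
  by field; rewrite gt_eqF.
exact: lexx.
Qed.

End Potential.

(** * The energy estimate *)

Section Energy.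
Variable R : realType.
Local Notation C := R[i].
Local Notation nc := (@Normc.normc R).
Local Notation mu := (@lebesgue_measure R).
Local Notation intg D f := (mu.-integrable D (EFin \o f)).
Local Notation H := (@halfline R).
Implicit Types (psi h : R -> 'cV[C]_2).

Lemma halfline_bigcup : H = \bigcup_n `]0, n%:R]%classic.
Proof. 
apply/seteqP; split=> x.
  rewrite /halfline /= in_itv/= andbT => x0.
  exists (Num.truncn x).+1 => //=; rewrite in_itv/= x0 ltW//.
  by have /andP[] := truncn_itv (ltW x0).
by move=> [n _]; exact: halfline_segment.
Qed.

(** Monotone convergence along the intervals (0, n]. *)
Lemma integrable_halfline_bounded (f : R -> R) (B : R) : (forall x, 0 <= f x) ->
  measurable_fun H f ->
  (forall x, 0 <= x -> intg `]0, x]%classic f /\ \int[mu]_(t in `]0, x]) f t <= B) ->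
  intg H f /\ \int[mu]_(t in H) f t <= B.
Proof.
move=> f0 mf fB.
have nd : {homo (fun n : nat => `]0, n%:R]%classic : set R) : n m / (n <= m)%N >-> (n <= m)%O}.
  by move=> n m nm; apply/subsetPset; apply: subset_itvl; rewrite bnd_simp ler_nat.
have le : (\int[mu]_(t in H) (f t)%:E <= B%:E)%E.
  have := @ge0_nondecreasing_set_cvg_integral _ _ R (fun n : nat =>
    `]0, n%:R]%classic : set (measurableTypeR R)) (EFin \o f) lebesgue_measure nd.
  rewrite -halfline_bigcup => cv.
  have m n : measurable_fun (`]0, n%:R]%classic : set R) (EFin \o f).
    apply/measurable_EFinP; apply: measurable_funS mf; first exact: measurable_halfline.
    exact: halfline_segment.
  have {}cv := cv (fun n => measurable_itv _) m (fun n x _ => f0 x).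
  apply: cvge_le cv; apply: nearW => n; have [i l] := fB n%:R (ler0n _ _).
  by rewrite -lee_fin in l; apply: le_trans l; rewrite /Rintegral fineK//;
    exact: integrable_fin_num.
have i : intg H f.
  apply/integrableP; split; first exact/measurable_EFinP.
  under eq_integral do rewrite /= ger0_norm//.
  exact: le_lt_trans le (ltry _).
split=> //; rewrite -lee_fin /Rintegral fineK//.
by apply: integrable_fin_num => //; exact: measurable_halfline.
Qed.

(** The function B = Im (conj psi_1 psi_2) satisfies c B' = - Im z |psi|^2 + r with |r| <= |h| |psi|, since M
and Re z drop out; and B 0 = 0 because the boundary condition is real. Integrating over (0, x] bounds
the integral of |psi|^2 by |B x| and the norm of h, uniformly in x. *)
Lemma energy_bound (c M alpha : R) (z : C) h psi (S : R) : 0 < c -> complex.Im z != 0 -> L2 h ->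
  dirac_solution c M z h psi ->
  psi 0 0 0 * (cos alpha)%:C - psi 0 1 0 * (sin alpha)%:C = 0 ->
  (forall x, 0 <= x -> vnorm (psi x) <= S) ->
  L2 psi /\ L2norm psi ^+ 2 <= c * S ^+ 2 / `|complex.Im z| + L2norm h ^+ 2 / complex.Im z ^+ 2.
Proof.
move=> c0 y0 hl sp bc pS.
have S0 : 0 <= S by exact: le_trans (vnorm_ge0 _) (pS 0 (lexx 0)).
have [k0 k1] := dirac_solution_continuous sp.
have [m0 m1] := dirac_solution_measurable sp.
have cv := continuous_vnorm k0 k1.
set y := complex.Im z in y0 *; set Y := `|y|.
have Y0 : 0 < Y by rewrite normr_gt0.
pose sg := Num.sg y.
have sgY : sg * y = Y by rewrite /Y normrEsg.
have sg2 : sg ^+ 2 = 1 by rewrite sqr_sg y0.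
pose a0 x := complex.Re (psi x 0 0); pose b0 x := complex.Im (psi x 0 0).
pose a1 x := complex.Re (psi x 1 0); pose b1 x := complex.Im (psi x 1 0).
pose B x := a0 x * b1 x - b0 x * a1 x.
pose r x := complex.Re (h x 1 0) * b1 x - complex.Im (h x 1 0) * a1 x - a0 x * complex.Im (h x 0
  0) + b0 x * complex.Re (h x 0 0).
have pB : primitive B (fun x => c^-1 * (- y * vnorm (psi x) ^+ 2 + r x)).
  have [[pa0 pb0] [pa1 pb1]] := sp.
  have := primitiveB (primitiveM pa0 pb1) (primitiveM pb0 pa1).
  apply: primitive_eq => x _.
  have -> : c%:C^-1 = (c^-1)%:C :> C by rewrite fmorphV.
  rewrite sqr_vnorm !sqr_nc !ReImE/= /r /a0 /a1 /b0 /b1 /y; ring.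
have B0 : B 0 = 0.
  have e0 : complex.Re (psi 0 0 0 * (cos alpha)%:C - psi 0 1 0 * (sin alpha)%:C) = 0 by rewrite bc.
  have e1 : complex.Im (psi 0 0 0 * (cos alpha)%:C - psi 0 1 0 * (sin alpha)%:C) = 0 by rewrite bc.
  move: e0 e1; rewrite !ReImE/= -/(a0 0) -/(b0 0) -/(a1 0) -/(b1 0) /B => e0 e1.
  have := cos2Dsin2 alpha.
  move: (cos alpha) (sin alpha) (a0 0) (b0 0) (a1 0) (b1 0) e0 e1 => C s x0 w0 x1 w1 e0 e1 cs.
  have f0 : x0 * C = s * x1 by lra.
  have f1 : w0 * C = s * w1 by lra.
  have g1 : C * (x0 * w1 - w0 * x1) = 0.
    transitivity ((x0 * C) * w1 - (w0 * C) * x1); first by ring.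
    by rewrite f0 f1; ring.
  have g2 : s * (x0 * w1 - w0 * x1) = 0.
    transitivity (x0 * (s * w1) - w0 * (s * x1)); first by ring.
    by rewrite -f0 -f1; ring.
  rewrite -[LHS]mul1r -cs.
  transitivity (C * (C * (x0 * w1 - w0 * x1)) + s * (s * (x0 * w1 - w0 * x1))); first by ring.
  by rewrite g1 g2; ring.
have Bx x : `|B x| <= vnorm (psi x) ^+ 2 / 2.
  rewrite sqr_vnorm !sqr_nc -/(a0 x) -/(b0 x) -/(a1 x) -/(b1 x) /B ler_norml.
  have := sqr_ge0 (a0 x - b1 x); have := sqr_ge0 (a0 x + b1 x).
  have := sqr_ge0 (b0 x - a1 x); have := sqr_ge0 (b0 x + a1 x).
  by move=> ? ? ? ?; apply/andP; split; nra.
have ig x : intg `]0, x]%classic (fun t => vnorm (psi t) ^+ 2).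
  apply: (@integrable_ext _ _ (fun t => vnorm (psi t) * vnorm (psi t))) => //.
  by apply: locally_integrable_mul => // t; exact: within_halfline_integrable.
have igh x : intg `]0, x]%classic (fun t => vnorm (h t) ^+ 2).
  have /L2P[_ _ ih] := hl; apply: integrableS ih => //; first exact: measurable_halfline.
  exact: halfline_segment.
have pw x : Y / 2 * vnorm (psi x) ^+ 2 <=
   - (sg * c) * (c^-1 * (- y * vnorm (psi x) ^+ 2 + r x)) + (2 * Y)^-1 * vnorm (h x) ^+ 2.
  have -> : - (sg * c) * (c^-1 * (- y * vnorm (psi x) ^+ 2 + r x)) =
    Y * vnorm (psi x) ^+ 2 - sg * r x.
    by rewrite -sgY; field; rewrite gt_eqF.
  (* Half of Y |psi|^2 absorbs the products in r. *)
  have am (t s : R) : sg * t * s <= Y / 2 * t ^+ 2 + (2 * Y)^-1 * s ^+ 2.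
    rewrite -subr_ge0.
    have -> : Y / 2 * t ^+ 2 + (2 * Y)^-1 * s ^+ 2 - sg * t * s =
      (2 * Y)^-1 * (Y * t - sg * s) ^+ 2.
      have -> : (Y * t - sg * s) ^+ 2 =
        Y ^+ 2 * t ^+ 2 - 2 * sg * Y * t * s + sg ^+ 2 * s ^+ 2 by ring.
      by rewrite sg2; field; rewrite gt_eqF.
    by rewrite mulr_ge0 ?sqr_ge0// invr_ge0 mulr_ge0// ltW.
  rewrite !sqr_vnorm !sqr_nc -/(a0 x) -/(b0 x) -/(a1 x) -/(b1 x) /r.
  have := am (b1 x) (complex.Re (h x 1 0)); have := am (- a1 x) (complex.Im (h x 1 0)).
  have := am (- a0 x) (complex.Im (h x 0 0)); have := am (b0 x) (complex.Re (h x 0 0)).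
  rewrite !sqrrN; lra.
have [i le] : intg H (fun t => vnorm (psi t) ^+ 2) /\
   \int[mu]_(t in H) vnorm (psi t) ^+ 2 <= c * S ^+ 2 / Y + L2norm h ^+ 2 / y ^+ 2.
  apply: integrable_halfline_bounded => [x||x x0]; first exact: sqr_ge0.
    by apply: measurable_funX; exact: measurable_vnorm.
  split; first exact: ig.
  have [igB /(_ x x0)] := pB; rewrite B0 add0r => EB.
  have Y2 : 0 < Y / 2 by rewrite divr_gt0.
  rewrite -(ler_pM2l Y2) -RintegralZl//.
  apply: (@le_trans _ _ (- (sg * c) * B x + (2 * Y)^-1 * \int[mu]_(t in `]0,
    x]) (vnorm (h t) ^+ 2))).
    rewrite EB -!RintegralZl// -RintegralD//; try exact: integrable_scale.
    apply: le_Rintegral => //; first exact: integrable_scale.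
    by apply: integrable_add => //; exact: integrable_scale.
  have h1 : \int[mu]_(t in `]0, x]) (vnorm (h t) ^+ 2) <= L2norm h ^+ 2.
    have /L2P[_ _ ih] := hl; rewrite sqr_L2norm /Rintegral fine_le//.
    - exact: integrable_fin_num.
    - by apply: integrable_fin_num => //; exact: measurable_halfline.
    apply: ge0_subset_integral => //.
    - exact: measurable_halfline.
    - by apply/measurable_EFinP; exact: integrable_measurable ih.
    - by move=> t _; rewrite lee_fin sqr_ge0.
    - exact: halfline_segment.
  have h2 : - (sg * c) * B x <= c * (S ^+ 2 / 2).
    apply: (le_trans (ler_norm _)); rewrite mulNr normrN !normrM normr_sg y0 mul1r (gtr0_norm c0).
    apply: ler_wpM2l; first exact: ltW.
    apply: (le_trans (Bx x)); apply: ler_wpM2r => //.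
    by rewrite ler_sqr ?nnegrE ?vnorm_ge0//; exact: pS.
  apply: le_trans (lerD h2 (ler_wpM2l _ h1)) _; first by rewrite invr_ge0 mulr_ge0// ltW.
  have -> : y ^+ 2 = Y ^+ 2 by rewrite /Y real_normK ?num_real.
  have -> : c * (S ^+ 2 / 2) + (2 * Y)^-1 * L2norm h ^+ 2 =
    Y / 2 * (c * S ^+ 2 / Y + L2norm h ^+ 2 / Y ^+ 2).
    by field; rewrite gt_eqF.
  exact: lexx.
split; last by rewrite sqr_L2norm.
by apply/L2P.
Qed.
End Energy.

(** * Solving the perturbed resolvent equation *)

Section Neumann.
Variable R : realType.
Local Notation C := R[i].
Local Notation nc := (@Normc.normc R).
Local Notation mu := (@lebesgue_measure R).
Local Notation intg D f := (mu.-integrable D (EFin \o f)).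
Local Notation H := (@halfline R).

Let mH : measurable H := @measurable_halfline R.

Lemma geometric_to0 (B t : R) : 0 <= t < 1 -> (fun n => B * t ^+ n) @ \oo --> (0 : R).
Proof.
move=> /andP[t0 t1]; rewrite -(mulr0 B); apply: cvgM; first exact: cvg_cst.
by apply: cvg_expr; rewrite ger0_norm.
Qed.

(** Shifted down and up by the tail B t^n / (1 - t), the sequence becomes nondecreasing and nonincreasing,
so its limit is squeezed between the two. *)
Lemma geometric_increments (a : nat -> R) (B t : R) : 0 <= t < 1 ->
  (forall n, `|a n.+1 - a n| <= B * t ^+ n) ->
  (a @ \oo --> limn a) /\ forall n, `|a n - limn a| <= B / (1 - t) * t ^+ n.
Proof.
move=> t01 aB; have /andP[t0 t1] := t01.
have d0 : 1 - t != 0 by rewrite subr_eq0 gt_eqF.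
pose e n := B / (1 - t) * t ^+ n.
have eS n : e n.+1 = e n - B * t ^+ n by rewrite /e exprS; field.
have up n : a n.+1 + e n.+1 <= a n + e n.
  by rewrite eS; have := aB n; rewrite ler_norml => /andP[_ ?]; lra.
have lo n : a n - e n <= a n.+1 - e n.+1.
  by rewrite eS; have := aB n; rewrite ler_norml => /andP[? _]; lra.
have e0 n : 0 <= e n.
  rewrite mulr_ge0 ?exprn_ge0// divr_ge0 ?subr_ge0 ?(ltW t1)//.
  by have := aB 0%N; rewrite expr0 mulr1; apply: le_trans.
have upm : {homo (fun n => a n + e n) : n m / (n <= m)%N >-> m <= n} by apply/nonincreasing_seqP.
have lom : {homo (fun n => a n - e n) : n m / (n <= m)%N >-> n <= m} by apply/nondecreasing_seqP.
have cross n m : a n - e n <= a m + e m.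
  have n1 := lom _ _ (leq_maxl n m); have m1 := upm _ _ (leq_maxr n m).
  have := e0 (maxn n m); simpl in *; lra.
pose l := sup (range (fun n => a n - e n)).
have lP n : `|a n - l| <= e n.
  have h1 : a n - e n <= l.
    apply: ub_le_sup; last by exists n.
    by exists (a n + e n) => _ [m _ <-]; exact: cross.
  have h2 : l <= a n + e n.
    apply: ge_sup; first by exists (a 0%N - e 0%N), 0%N.
    by move=> _ [m _ <-]; exact: cross.
  by rewrite ler_norml; apply/andP; split; lra.
have cv : a @ \oo --> l.
  have ce : e @ \oo --> (0 : R) by exact: geometric_to0.
  apply/cvgrPdist_le => /= eps eps0.
  have /cvgrPdist_le/(_ eps eps0) := ce; apply: filterS => n /=.
  rewrite sub0r normrN ger0_norm// => en; rewrite distrC; exact: le_trans (lP n) en.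
have -> : limn a = l by apply: cvg_lim.
by split.
Qed.

Lemma le0_geometric (x B t : R) : 0 <= t < 1 -> (forall n, x <= B * t ^+ n) -> x <= 0.
Proof.
move=> t01 xB; apply: (cvgr_to_ge (geometric_to0 B t01)); exact: nearW.
Qed.

Lemma cintB D (f h : R -> C) : measurable D -> cintegrable D f -> cintegrable D h ->
  cint D (fun x => f x - h x) = cint D f - cint D h.
Proof.
move=> mD [fr fi] [hr hi]; apply: complex_eq; rewrite !ReImE/= -RintegralB//;
  by apply: eq_Rintegral => x _; rewrite !ReImE.
Qed.

Variable V : R -> 'M[C]_2.
Hypothesis V_pot : potential V.
Variables (c M alpha : R) (z : C) (kappa K : R) (u w : R -> 'cV[C]_2) (W : C).
Hypothesis c0 : 0 < c.
Hypothesis K0 : 0 <= K.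
Hypothesis G : green_pair c M alpha z kappa K u w W.
Hypothesis th1 : K / c * norm1 V < 1.
Implicit Types (g h psi phi : R -> 'cV[C]_2).

Lemma green_sub h h' x : L2 h -> L2 h' ->
  green c u w W h x - green c u w W h' x = green c u w W (fun y => h y - h' y) x.
Proof.
move=> hl hl'.
have E (s : R -> 'cV[C]_2) : (fun y => dotv (s y) (h y - h' y)) = (fun y =>
  dotv (s y) (h y) - dotv (s y) (h' y)).
  by apply/funext => y; rewrite /dotv !mxE; ring.
rewrite /green !E (cintB mH); [|exact: (decaying_integrable G)..].
rewrite !cintB//; try exact: (solution_locally_integrable _ (gp_w G));
  try exact: (solution_locally_integrable _ (gp_u G)).
rewrite -scalerBr; congr (_ *: _).
move: (cint _ _) (cint _ _) (cint _ _) (cint _ _) (cint _ _) (cint _ _) => a1 a2 b1 b2 d1 d2.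
by apply: cV2P; rewrite !mxE; ring.
Qed.

Let th := K / c * norm1 V.

Let th0 : 0 <= th.
Proof.
apply: mulr_ge0; first by apply: divr_ge0 => //; exact: ltW.
by apply: Rintegral_ge0 => y _; exact: opnorm_ge0.
Qed.

Let th01 : 0 <= th < 1.
Proof. by rewrite th0. Qed.

(** The functions on which the fixed point iteration acts: V maps them to square integrable ones. *)
Definition bounded_measurable psi :=
  [/\ cmeasurable H (fun x => psi x 0 0), cmeasurable H (fun x => psi x 1 0) &
   exists S, 0 <= S /\ forall x, 0 < x -> vnorm (psi x) <= S].

Lemma bounded_measurable_L2 psi : bounded_measurable psi -> L2 (fun x => V x *m psi x).
Proof. by move=> [m0 m1 [S [S0 pS]]]; exact: (potential_mul_bounded_L2 V_pot S0 m0 m1 pS).1. Qed.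

Section Iteration.
Variable g : R -> 'cV[C]_2.
Hypothesis gl : L2 g.

Definition resolvent_step psi := green c u w W (fun y => g y - V y *m psi y).

Lemma resolvent_step_solution psi : bounded_measurable psi ->
  dirac_solution c M z (fun y => g y - V y *m psi y) (resolvent_step psi).
Proof.
move=> bm; apply: (green_solution G); apply: L2B => //; exact: bounded_measurable_L2.
Qed.

Lemma resolvent_step_bounded psi : bounded_measurable psi ->
  bounded_measurable (resolvent_step psi).
Proof.
move=> bm; have [m0 m1] := dirac_solution_measurable (resolvent_step_solution bm).
split=> //; have [_ _ [S [S0 pS]]] := bm.
exists (free_sup c kappa K g + th * S); split.
  by apply: addr_ge0; [exact: free_sup_ge0|exact: mulr_ge0].
move=> x x0; apply: (green_potential_bound V_pot c0 K0 G gl (bounded_measurable_L2 bm) _ (ltW x0))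
  => y y0.
by rewrite mulrC; apply: ler_wpM2r; [exact: opnorm_ge0|exact: pS].
Qed.

Lemma resolvent_step_contraction psi phi B : bounded_measurable psi -> bounded_measurable phi ->
  (forall x, 0 < x -> vnorm (psi x - phi x) <= B) ->
  forall x, 0 <= x -> vnorm (resolvent_step psi x - resolvent_step phi x) <= th * B.
Proof.
move=> bp bf pB x x0.
have Vp := bounded_measurable_L2 bp; have Vf := bounded_measurable_L2 bf.
rewrite /resolvent_step green_sub; [|exact: L2B..].
have -> : (fun y => g y - V y *m psi y - (g y - V y *m phi y)) = (fun y =>
  0 - V y *m (psi y - phi y)).
  by apply/funext => y; rewrite mulmxBr; apply: cV2P; rewrite !mxE; ring.
have Vl : L2 (fun y => V y *m (psi y - phi y)).
  have := L2B Vp Vf; congr L2; apply/funext => y; exact/esym/mulmxBr.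
have := green_potential_bound V_pot c0 K0 G (@L20 R) Vl (B := B) _ x0.
have -> : free_sup c kappa K (fun=> 0 : 'cV[C]_2) = 0.
  rewrite /free_sup /L2norm; under eq_Rintegral do rewrite vnorm0 expr0n/=.
  by rewrite Rintegral_cst// mul0r sqrtr0 mul0r mulr0.
rewrite add0r; apply => y y0.
by rewrite mulrC; apply: ler_wpM2r; [exact: opnorm_ge0|exact: pB].
Qed.

(** The partial sums of the Neumann series, as iterates of the resolvent step. *)
Definition neumann n : R -> 'cV[C]_2 := iter n resolvent_step (fun=> 0).

Lemma neumannS n : neumann n.+1 = resolvent_step (neumann n).
Proof. by []. Qed.

Lemma neumann_bounded n : bounded_measurable (neumann n).
Proof.
elim: n => [|n]; last exact: resolvent_step_bounded.
split; try by under eq_fun do rewrite mxE; exact: cmeasurable_cst.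
by exists 0; split=> // x _; rewrite vnorm0.
Qed.

Lemma neumann_increment : exists B, 0 <= B /\
  forall n x, 0 <= x -> vnorm (neumann n.+1 x - neumann n x) <= B * th ^+ n.
Proof.
pose B := free_sup c kappa K g; have B0 : 0 <= B by exact: free_sup_ge0.
exists B; split=> //; elim=> [|n IH] x x0.
  rewrite expr0 mulr1 /neumann /= subr0.
  have bm := neumann_bounded 0.
  have := green_potential_bound V_pot c0 K0 G gl (bounded_measurable_L2 bm) (B := 0) _ x0.
  by rewrite mulr0 addr0; apply => y y0; rewrite /neumann/= vnorm0 mulr0 mul0r.
rewrite exprS mulrCA.
have inc y : 0 < y -> vnorm (neumann n.+1 y - neumann n y) <= B * th ^+ n.
  by move=> y0; apply: IH; exact: ltW.
have := resolvent_step_contraction (neumann_bounded n.+1) (neumann_bounded n) inc x0.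
by rewrite -!neumannS.
Qed.

Lemma Re_vec_le (v : 'cV[C]_2) i : `|complex.Re (v i 0)| <= vnorm v.
Proof.
by elim/ord2_ind: i; apply: (le_trans (normr_Re_le _)); [exact: nc_comp0|exact: nc_comp1].
Qed.

Lemma Im_vec_le (v : 'cV[C]_2) i : `|complex.Im (v i 0)| <= vnorm v.
Proof.
by elim/ord2_ind: i; apply: (le_trans (normr_Im_le _)); [exact: nc_comp0|exact: nc_comp1].
Qed.

Lemma vnorm_le_coords (v : 'cV[C]_2) (B : R) :
  (forall i, `|complex.Re (v i 0)| <= B /\ `|complex.Im (v i 0)| <= B) -> vnorm v <= 4 * B.
Proof.
move=> vB; apply: (le_trans (vnorm_le_sum _)).
have [r0 i0] := vB 0; have [r1 i1] := vB 1.
have := nc_le_ReIm (v 0 0); have := nc_le_ReIm (v 1 0); lra.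
Qed.

(** The iterates converge uniformly; the limit is a fixed point since the step is a contraction. *)
Lemma neumann_fixpoint : exists psi, bounded_measurable psi /\
  forall x, 0 <= x -> resolvent_step psi x = psi x.
Proof.
have [B [B0 nB]] := neumann_increment.
pose lr i x := limn (fun n => complex.Re (neumann n x i 0)).
pose li i x := limn (fun n => complex.Im (neumann n x i 0)).
have cr i x : 0 <= x -> ((fun n => complex.Re (neumann n x i 0)) @ \oo --> lr i x) /\
    forall n, `|complex.Re (neumann n x i 0) - lr i x| <= B / (1 - th) * th ^+ n.
  move=> x0; apply: geometric_increments => // n.
  apply: le_trans (nB n x x0); have := Re_vec_le (neumann n.+1 x - neumann n x) i.
  by rewrite !mxE !ReImE.
have ci i x : 0 <= x -> ((fun n => complex.Im (neumann n x i 0)) @ \oo --> li i x) /\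
    forall n, `|complex.Im (neumann n x i 0) - li i x| <= B / (1 - th) * th ^+ n.
  move=> x0; apply: geometric_increments => // n.
  apply: le_trans (nB n x x0); have := Im_vec_le (neumann n.+1 x - neumann n x) i.
  by rewrite !mxE !ReImE.
pose psi x : 'cV[C]_2 := \col_i (lr i x +i* li i x).
have near n x : 0 <= x -> vnorm (neumann n x - psi x) <= 4 * (B / (1 - th) * th ^+ n).
  move=> x0; apply: vnorm_le_coords => i; rewrite !mxE !ReImE/=.
  by split; [exact: (cr i x x0).2|exact: (ci i x x0).2].
have mpsi i : cmeasurable H (fun x => psi x i 0).
  have mn n : cmeasurable H (fun x => neumann n x i 0).
    by have [m0 m1 _] := neumann_bounded n; elim/ord2_ind: i.
  split.
    apply: (@measurable_fun_cvg _ _ _ _ (fun n x => complex.Re (neumann n x i 0))) => [n|x].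
      exact: (mn n).1.
    rewrite /halfline /= in_itv/= andbT mxE/= => x0.
    exact: (cr i x (ltW x0)).1.
  apply: (@measurable_fun_cvg _ _ _ _ (fun n x => complex.Im (neumann n x i 0))) => [n|x].
    exact: (mn n).2.
  rewrite /halfline /= in_itv/= andbT mxE/= => x0.
  exact: (ci i x (ltW x0)).1.
have bm : bounded_measurable psi.
  split=> //; exists (4 * (B / (1 - th))); split.
    by rewrite mulr_ge0// divr_ge0// subr_ge0 ltW.
  move=> x x0; have := near 0%N x (ltW x0).
  by rewrite expr0 mulr1 /neumann/= sub0r vnormN.
exists psi; split=> // x x0.
apply/eqP; rewrite -subr_eq0; apply/eqP/vnorm_eq0/eqP; rewrite eq_le vnorm_ge0 andbT.
apply: (@le0_geometric _ (8 * (B / (1 - th))) th) => // n.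
have -> : resolvent_step psi x - psi x =
    (neumann n.+1 x - psi x) - (resolvent_step (neumann n) x - resolvent_step psi x).
  by rewrite neumannS opprB [RHS]addrC addrA subrK.
apply: (le_trans (vnormB _ _)).
have h1 := near n.+1 x x0.
have h2 := resolvent_step_contraction (neumann_bounded n) bm (fun y y0 => near n y (ltW y0)) x0.
have Bt : 0 <= B / (1 - th) by rewrite divr_ge0// subr_ge0 ltW.
have tn : 0 <= th ^+ n by exact: exprn_ge0.
have Btn := mulr_ge0 Bt tn.
rewrite exprS in h1.
have : th * (B / (1 - th) * th ^+ n) <= B / (1 - th) * th ^+ n by rewrite ler_piMl// ltW.
lra.
Qed.

(** The fixed point is only known to be bounded and measurable; its image under the step is the regular
solution, with the same product with V. *)
Lemma resolvent_exists : complex.Im z != 0 -> exists psi, [/\ L2 psi,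
  dirac_solution c M z (fun x => g x - V x *m psi x) psi &
  psi 0 0 0 * (cos alpha)%:C - psi 0 1 0 * (sin alpha)%:C = 0].
Proof.
move=> z0; have [phi [bm fp]] := neumann_fixpoint.
have sp := resolvent_step_solution bm.
have hl : L2 (fun y => g y - V y *m phi y) by apply: L2B => //; exact: bounded_measurable_L2.
have bc := green_boundary G (fun y => g y - V y *m phi y).
have [_ _ [S [S0 pS]]] := resolvent_step_bounded bm.
exists (resolvent_step phi); split; last exact: bc.
  have bS x : 0 <= x -> vnorm (resolvent_step phi x) <= Num.max S (vnorm (resolvent_step phi 0)).
    rewrite le_eqVlt => /predU1P[<-|/pS]; first by rewrite le_max lexx orbT.
    by move=> h; rewrite le_max h.
  by have [] := energy_bound c0 z0 hl sp bc bS.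
have [s0 s1] := sp.
by split; [apply: cprim_eq s0|apply: cprim_eq s1] => x x0; rewrite !mxE fp// ltW.
Qed.
End Iteration.
End Neumann.

(** * Weyl sequences *)

Section Weyl.
Variable R : realType.
Local Notation C := R[i].
Local Notation nc := (@Normc.normc R).
Local Notation mu := (@lebesgue_measure R).
Local Notation intg D f := (mu.-integrable D (EFin \o f)).
Local Notation H := (@halfline R).

Let mH : measurable H := @measurable_halfline R.

(** The pair (a, d) lies in the kernel of a real 2x2 matrix whose determinant is x^2 - M^2 - (c k)^2 up to
sign. When x = - M, k is 0 and the column of d vanishes. *)
Lemma plane_wave_exists (c M x : R) : 0 < c -> M ^+ 2 <= x ^+ 2 -> exists k a d : R,
  [/\ c * k * a = (x + M) * d, c * k * d = (x - M) * a & 0 < a ^+ 2 + d ^+ 2].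
Proof.
move=> c0 xM; have [xM0|xM0] := eqVneq (x + M) 0.
  exists 0, 0, 1; rewrite xM0; split; [ring|ring|].
  by rewrite expr0n/= expr1n add0r.
exists (Num.sqrt (x ^+ 2 - M ^+ 2) / c), 1, (Num.sqrt (x ^+ 2 - M ^+ 2) / (x + M)).
have s2 : Num.sqrt (x ^+ 2 - M ^+ 2) ^+ 2 = x ^+ 2 - M ^+ 2 by rewrite sqr_sqrtr// subr_ge0.
split.
- by field; rewrite xM0 gt_eqF.
- transitivity (Num.sqrt (x ^+ 2 - M ^+ 2) ^+ 2 / (x + M)).
    by field; rewrite xM0 gt_eqF.
  by rewrite s2; field.
- by rewrite expr1n ltr_wpDr ?sqr_ge0.
Qed.

(** The plane wave u = exp (i k y) (a, i d) has constant norm. Cut off by a plateau chi of width of order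
n, with slopes at most 1/n, it satisfies |chi u|^2 >= n |u|^2 and |(D_0 - x) (chi u)|^2 <= 6 c^2 |u|^2 / n. *)
Lemma weyl_sequence (c m alpha x b e : R) : 0 < c -> (m * c ^+ 2) ^+ 2 <= x ^+ 2 -> 0 <= b ->
  0 < e ->
  exists psi phi, [/\ dirac_halfline c m alpha psi phi, forall y, y <= b -> psi y = 0,
    0 < L2norm psi & L2norm (fun y => phi y - x%:C *: psi y) <= e * L2norm psi].
Proof.
move=> c0 xM b0 e0; set M := m * c ^+ 2 in xM.
have [k [a [d [ka kd ad]]]] := plane_wave_exists c0 xM.
pose r := a ^+ 2 + d ^+ 2.
(* The summand b makes the support end before 6 n, and n >= 3 c / e gives 6 c^2 <= (e n)^2. *)
pose n := b + 3 * c / e.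
have ce : 0 < 3 * c / e by rewrite divr_gt0 ?mulr_gt0.
have n0 : 0 < n by rewrite /n; lra.
have nb : b <= n by rewrite /n; lra.
have nc3 : 3 * c <= e * n.
  by rewrite [leRHS]mulrC -ler_pdivrMr// /n; lra.
pose chi y := step n (b + n) y - step n (b + 4 * n) y.
pose dchi y := bump n (b + n) y - bump n (b + 4 * n) y.
pose X := b + 5 * n.
have pchi : primitive chi dchi by apply: primitiveB; exact: primitive_step.
have cchi := primitive_continuous pchi.
have cdchi : {within @halfline_closed R, continuous dchi}.
  by apply: continuous_subspaceT => y; apply: cvgB; exact: bump_continuous.
have chi0 y : y <= b -> chi y = 0.
  by move=> yb; rewrite /chi !step_eq0 ?subrr//; lra.
have chiX y : X < y -> chi y = 0.
  by rewrite /X => yX; rewrite /chi !step_eq1 ?subrr//; lra.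
have chi1 y : b + 2 * n <= y -> y <= b + 3 * n -> chi y = 1.
  by move=> y1 y2; rewrite /chi step_eq1//; [rewrite step_eq0 ?subr0//; lra|lra].
have dchiX y : X < y -> dchi y = 0.
  rewrite /X => yX; rewrite /dchi !bump_eq0 ?subrr// ger0_norm; lra.
have dchi1 y : dchi y ^+ 2 <= (n ^+ 2)^-1.
  rewrite -exprVn -real_normK ?num_real// ler_sqr ?nnegrE ?invr_ge0 ?(ltW n0)//.
  have le1 t : 0 <= bump n t y <= n^-1.
    rewrite bump_ge0//= /bump -[leRHS]mul1r; apply: ler_wpM2r; last exact: hat_le1.
    by rewrite invr_ge0 ltW.
  have /andP[? ?] := le1 (b + n); have /andP[? ?] := le1 (b + 4 * n).
  by rewrite /dchi ler_norml; apply/andP; split; lra.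
have cC : c%:C != 0 :> C by rewrite eq_complex/= eqxx andbT gt_eqF.
pose l : C := 'i * k%:C.
pose p : C := a%:C; pose q : C := 'i * d%:C.
have ii : 'i * 'i = -1 :> C by rewrite -expr2 sqr_i.
have kaC : c%:C * k%:C * a%:C = (x%:C + M%:C) * d%:C :> C by rewrite -!rmorphM ka rmorphM rmorphD.
have kdC : c%:C * k%:C * d%:C = (x%:C - M%:C) * a%:C :> C by rewrite -!rmorphM kd rmorphM rmorphB.
have su : dirac_solution c M x%:C (fun=> 0) (fun y => cexp l y *: vec2 p q).
  apply: dirac_solution_exp => //; rewrite /l /p /q.
    transitivity ('i * (c%:C * k%:C * a%:C)); first by clearbody M; ring.
    by rewrite kaC; clearbody M; ring.
  transitivity (('i * 'i) * (c%:C * k%:C * d%:C)); first by clearbody M; ring.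
  by rewrite kdC ii; clearbody M; ring.
pose u y : 'cV[C]_2 := cexp l y *: vec2 p q.
have un y : vnorm (u y) ^+ 2 = r.
  have Rel : complex.Re l = 0 by rewrite /l ReM/=; ring.
  rewrite sqr_vnorm_vec2 nc_cexp Rel mul0r expR0 expr1n mul1r.
  by rewrite /p /q nc_real Normc.normcM normc_i mul1r nc_real !real_normK ?num_real.
pose psi y : 'cV[C]_2 := (chi y)%:C *: u y.
pose h y : 'cV[C]_2 := (c * dchi y)%:C *: vec2 (- u y 1 0) (u y 0 0).
have cpchi : cprim (fun y => (chi y)%:C) (fun y => (dchi y)%:C).
  by split => //=; exact: primitive_cst.
have sp : dirac_solution c M x%:C h psi.
  have [u0 u1] := su; split.
    have : cprim (fun y => psi y 0 0) (fun y =>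
      (dchi y)%:C * u y 0 0 + (chi y)%:C * (c%:C^-1 * ((x%:C + M%:C) * u y 1 0 +
        (0 : 'cV[C]_2) 1 0))).
      by apply: cprim_eq_fun (cprimM cpchi u0) => y _; rewrite /psi [RHS]mxE.
    apply: cprim_eq => y _; rewrite /psi /h; move: (u y) => uy.
    by rewrite !mxE/= rmorphM/=; clearbody M; field; exact: cC.
  have : cprim (fun y => psi y 1 0) (fun y =>
    (dchi y)%:C * u y 1 0 + (chi y)%:C * (c%:C^-1 * ((M%:C - x%:C) * u y 0 0 - (0 : 'cV[C]_2) 0
      0))).
    by apply: cprim_eq_fun (cprimM cpchi u1) => y _; rewrite /psi [RHS]mxE.
  apply: cprim_eq => y _; rewrite /psi /h; move: (u y) => uy.
  by rewrite !mxE/= rmorphM/=; clearbody M; field; exact: cC.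
have psin y : vnorm (psi y) ^+ 2 = chi y ^+ 2 * r.
  by rewrite /psi vnormZ exprMn un nc_real real_normK ?num_real.
have hn y : vnorm (h y) ^+ 2 = c ^+ 2 * dchi y ^+ 2 * r.
  rewrite /h sqr_vnorm_vec2 normcN nc_real real_normK ?num_real// addrC -sqr_vnorm un.
  by rewrite exprMn.
have [m0 m1] := dirac_solution_measurable sp.
have [mu0 mu1] := dirac_solution_measurable su.
have csq (f : R -> R) (t : R) : {within @halfline_closed R, continuous f} ->
    {within @halfline_closed R, continuous (fun y => t * f y ^+ 2)}.
  move=> cf y; apply: cvgM; first exact: cvg_cst.
  by under eq_fun do rewrite expr2; apply: cvgM; exact: cf.
have ipsi : intg H (fun y => r * chi y ^+ 2).
  apply: (@integrable_halfline_supp _ _ X); first exact: csq.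
  by move=> y /chiX ->; rewrite expr0n/= mulr0.
have ih : intg H (fun y => c ^+ 2 * r * dchi y ^+ 2).
  apply: (@integrable_halfline_supp _ _ X); first exact: csq.
  by move=> y /dchiX ->; rewrite expr0n/= mulr0.
have psil : L2 psi by apply: (L2_le m0 m1 ipsi) => y _; rewrite psin mulrC.
have mdchi : cmeasurable H (fun y => (c * dchi y)%:C).
  split=> /=; last exact: measurable_cst.
  apply: measurable_funM; first exact: measurable_cst.
  exact: within_halfline_measurable.
have hl : L2 h.
  have mh0 : cmeasurable H (fun y => h y 0 0).
    have -> : (fun y => h y 0 0) = (fun y => (c * dchi y)%:C * - u y 1 0) by apply/funext => y;
      rewrite /h !mxE.
    apply: cmeasurableM; first exact: mdchi.
    by apply: cmeasurableN; exact: mu1.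
  have mh1 : cmeasurable H (fun y => h y 1 0).
    have -> : (fun y => h y 1 0) = (fun y => (c * dchi y)%:C * u y 0 0) by apply/funext => y;
      rewrite /h !mxE.
    by apply: cmeasurableM; [exact: mdchi|exact: mu0].
  by apply: (L2_le mh0 mh1 ih) => y _; rewrite hn mulrAC.
have psi0 y : y <= b -> psi y = 0 by move=> yb; rewrite /psi chi0// scale0r.
have npsi : r * n <= L2norm psi ^+ 2.
  rewrite sqr_L2norm; under eq_Rintegral do rewrite psin mulrC.
  have sub : `]b + 2 * n, b + 3 * n]%classic `<=` H.
    by move=> y; rewrite /halfline /= !in_itv/= andbT => /andP[? _]; lra.
  have isub : intg `](b + 2 * n), (b + 3 * n)]%classic (fun y =>
    r * chi y ^+ 2) by apply: integrableS ipsi.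
  apply: (@le_trans _ _ (\int[mu]_(y in `]b + 2 * n, b + 3 * n]) (r * chi y ^+ 2))).
    have -> : \int[mu]_(y in `]b + 2 * n,
      b + 3 * n]) (r * chi y ^+ 2) = \int[mu]_(y in `]b + 2 * n, b + 3 * n]) r.
      apply: eq_Rintegral => y /set_mem; rewrite /= in_itv/= => /andP[y1 y2].
      by rewrite chi1 ?expr1n ?mulr1// ltW.
    have mE : mu `]b + 2 * n, b + 3 * n]%classic = n%:E.
      have lt23 : b + 2 * n < b + 3 * n by lra.
      rewrite lebesgue_measure_itv/= lte_fin lt23 -EFinB.
      have -> : b + 3 * n - (b + 2 * n) = n by ring.
      by [].
    rewrite Rintegral_cst//; rewrite le_eqVlt; apply/orP; left; apply/eqP.
    by apply: esym; apply: etrans (congr1 (fun t => r * fine t) mE) _.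
  rewrite /Rintegral fine_le//.
  - exact: integrable_fin_num.
  - exact: integrable_fin_num.
  apply: ge0_subset_integral => //.
  - by apply/measurable_EFinP; exact: integrable_measurable ipsi.
  - by move=> y _; rewrite lee_fin mulr_ge0 ?sqr_ge0// ltW.
have nh : L2norm h ^+ 2 <= e ^+ 2 * (r * n).
  rewrite sqr_L2norm (@Rintegral_halfline_supp _ X); last first.
    by move=> y /dchiX E; rewrite hn E expr0n/= mulr0 mul0r.
  have ihX : intg `]0, X]%classic (fun y => vnorm (h y) ^+ 2).
    by have /L2P[_ _ i] := hl; apply: integrableS i => //; exact: halfline_segment.
  apply: (@le_trans _ _ (\int[mu]_(y in `]0, X]) (c ^+ 2 * (n ^+ 2)^-1 * r))).
    apply: le_Rintegral => //.
      by apply: integrable_cst => //; exact: lebesgue_segment_lty.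
    move=> y _; rewrite hn; apply: ler_wpM2r; first exact: ltW.
    by apply: ler_wpM2l; rewrite ?sqr_ge0.
  have X0 : 0 < X by rewrite /X; lra.
  have mE : mu `]0, X]%classic = X%:E.
    by rewrite lebesgue_measure_itv/= lte_fin X0 -EFinB subr0.
  rewrite Rintegral_cst//; apply: (@le_trans _ _ (c ^+ 2 * (n ^+ 2)^-1 * r * X)).
    rewrite le_eqVlt; apply/orP; left; apply/eqP.
    by apply: etrans (congr1 (fun t => c ^+ 2 * (n ^+ 2)^-1 * r * fine t) mE) _.
  have r0 : 0 <= r by exact: ltW.
  have XN : X <= 6 * n by rewrite /X; lra.
  have en0 : 0 <= e * n by rewrite mulr_ge0// ltW.
  have sq : 9 * c ^+ 2 <= e ^+ 2 * n ^+ 2.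
    have : (3 * c) ^+ 2 <= (e * n) ^+ 2 by rewrite ler_sqr ?nnegrE// mulr_ge0// ltW.
    by rewrite !exprMn; lra.
  have n2 : 0 < n ^+ 2 by rewrite exprn_gt0.
  rewrite -(ler_pM2l n2).
  have -> : n ^+ 2 * (c ^+ 2 / n ^+ 2 * r * X) = r * (c ^+ 2 * X) by field; rewrite gt_eqF.
  have -> : n ^+ 2 * (e ^+ 2 * (r * n)) = r * (e ^+ 2 * n ^+ 2 * n) by ring.
  apply: ler_wpM2l => //.
  apply: (@le_trans _ _ (c ^+ 2 * (6 * n))); first by apply: ler_wpM2l => //; exact: sqr_ge0.
  apply: (@le_trans _ _ (9 * c ^+ 2 * n)); last by apply: ler_wpM2r => //; exact: ltW.
  have := mulr_ge0 (sqr_ge0 c) (ltW n0); lra.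
have rn : 0 < r * n by rewrite mulr_gt0.
exists psi, (fun y => x%:C *: psi y + h y); split=> //.
- apply: (solution_dirac_domain c0 psil hl _ sp).
  by rewrite psi0// !mxE !mul0r subrr.
- rewrite lt_neqAle L2norm_ge0 andbT eq_sym; apply/eqP => E.
  by move: npsi; rewrite E expr0n leNgt rn.
- have -> : (fun y => x%:C *: psi y + h y - x%:C *: psi y) = h by apply/funext => y;
  rewrite addrAC subrr add0r.
  rewrite -ler_sqr ?nnegrE ?mulr_ge0 ?L2norm_ge0 ?(ltW e0)//.
  rewrite exprMn (le_trans nh)//; apply: ler_wpM2l => //; exact: sqr_ge0.
Qed.

Lemma no_resolvent_bound (T : operator R) (z : C) :
  (forall e : R, 0 < e -> exists psi phi, [/\ T psi phi, 0 < L2norm psi &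
     L2norm (fun y => phi y - z *: psi y) <= e * L2norm psi]) -> spectrum T z.
Proof.
move=> weyl [_ [B TB]].
have e0 : 0 < (`|B| + 1)^-1 by rewrite invr_gt0 ltr_wpDl.
have [psi [phi [Tpp p0 le]]] := weyl _ e0.
have := TB _ _ Tpp; apply/negP; rewrite -ltNge.
have h0 := L2norm_ge0 (fun y => phi y - z *: psi y).
apply: (@le_lt_trans _ _ (`|B| * ((`|B| + 1)^-1 * L2norm psi))).
  apply: (@le_trans _ _ (`|B| * L2norm (fun y => phi y - z *: psi y))).
    by apply: ler_wpM2r => //; exact: ler_norm.
  by apply: ler_wpM2l.
rewrite mulrA gtr_pMl// ltr_pdivrMr; last by rewrite ltr_wpDl.
by rewrite mul1r ltrDl.
Qed.

Lemma real_spectrum_free (c m alpha x : R) : 0 < c -> (m * c ^+ 2) ^+ 2 <= x ^+ 2 ->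
  spectrum (dirac_halfline c m alpha) x%:C.
Proof.
move=> c0 xM; apply: no_resolvent_bound => e e0.
have [psi [phi [? _ ? ?]]] := weyl_sequence alpha c0 xM (lexx 0) e0.
by exists psi, phi.
Qed.

Lemma real_spectrum_perturbed (c m alpha x : R) (V : R -> 'M[C]_2) : 0 < c -> potential V ->
  (m * c ^+ 2) ^+ 2 <= x ^+ 2 -> spectrum (add_potential (dirac_halfline c m alpha) V) x%:C.
Proof.
move=> c0 V_pot xM; apply: no_resolvent_bound => e e0.
have [b [b0 Vb]] := potential_support V_pot.
have [psi [phi [D psi0 ? ?]]] := weyl_sequence alpha c0 xM (ltW b0) e0.
exists psi, phi; split=> //; split; first by case: D.
exists phi; split=> //; apply: aeW => y _.
by have [yb|yb] := leP y b; [rewrite psi0// mulmx0 addr0|rewrite Vb// mul0mx addr0].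
Qed.
End Weyl.

(** * Eigenvalues and resolvent set of the perturbed operator *)

Section Final.
Variable R : realType.
Local Notation C := R[i].
Local Notation nc := (@Normc.normc R).
Local Notation mu := (@lebesgue_measure R).
Local Notation intg D f := (mu.-integrable D (EFin \o f)).
Local Notation H := (@halfline R).
Let mH : measurable H := @measurable_halfline R.

Lemma dirac_solution_ae (c M : R) (z : C) (h h' psi : R -> 'cV[C]_2) :
  (forall i, cmeasurable H (fun x => h' x i 0)) ->
  {ae mu, forall x, H x -> h x = h' x} -> dirac_solution c M z h psi -> dirac_solution c M z h' psi.
Proof.
move=> mh' hh' sp; have [m0 m1] := dirac_solution_measurable sp; have [p0 p1] := sp; split.
  apply: cprim_ae p0.
    apply: cmeasurableM; first exact: cmeasurable_cst.
    by apply: cmeasurableD => //; apply: cmeasurableM => //; exact: cmeasurable_cst.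
  by apply: ae_imply hh' => x E hx; rewrite E.
apply: cprim_ae p1.
  apply: cmeasurableM; first exact: cmeasurable_cst.
  apply: cmeasurableD; last exact: cmeasurableN.
  by apply: cmeasurableM => //; exact: cmeasurable_cst.
by apply: ae_imply hh' => x E hx; rewrite E.
Qed.

Variables (c m alpha : R) (V : R -> 'M[C]_2).
Hypothesis c0 : 0 < c.
Hypothesis V_pot : potential V.

Let M := m * c ^+ 2.

Lemma perturbed_domain_solution (z : C) psi phi :
  add_potential (dirac_halfline c m alpha) V psi phi ->
  L2 (fun x => phi x - z *: psi x) /\
  exists psic, [/\ eq_ae psi psic, L2 psi, L2 psic,
    psic 0 0 0 * (cos alpha)%:C - psic 0 1 0 * (sin alpha)%:C = 0 &
    dirac_solution c M z (fun x => (phi x - z *: psi x) - V x *m psic x) psic].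
Proof.
move=> [phil [phi0 [D E]]].
have [psic [e pl pcl bc sp]] := dirac_domain_solution z c0 D.
have gl : L2 (fun x => phi x - z *: psi x) by apply: L2B => //; exact: L2Z.
split=> //; exists psic; split=> //.
apply: dirac_solution_ae sp.
  move=> i; have [mh _] := L2B gl (potential_mul_L2 V_pot pcl).
  exact: mh.
apply: ae_imply2 E e => x E e hx; rewrite -e// E//.
by rewrite addrAC addrK.
Qed.

(** An eigenfunction solves the resolvent equation with right-hand side 0, so the a priori bound makes it
vanish. *)
Lemma no_eigenvalue (z : C) (kappa K : R) u w W : 0 <= K ->
  green_pair c M alpha z kappa K u w W -> K / c * norm1 V < 1 ->
  ~ eigenvalue_of (add_potential (dirac_halfline c m alpha) V) z.
Proof.
move=> K0 G th1 [psi [D psi0]]; apply: psi0.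
have [gl [psic [e pl pcl bc sp]]] := perturbed_domain_solution z D.
have bnd := a_priori_bound V_pot c0 K0 G th1 gl pcl sp bc.
apply: ae_imply e => x e hx; rewrite e//.
apply: vnorm_eq0; apply/eqP; rewrite eq_le vnorm_ge0 andbT.
have x0 : 0 <= x by move: hx; rewrite /halfline /= in_itv/= andbT => /ltW.
apply: le_trans (bnd x x0) _.
rewrite /free_sup /L2norm; under eq_Rintegral do rewrite subrr vnorm0 expr0n/=.
by rewrite Rintegral_cst// mul0r sqrtr0 !(mul0r, mulr0).
Qed.

Lemma sqr_L2normB (f g : R -> 'cV[C]_2) : L2 f -> L2 g ->
  L2norm (fun x => f x - g x) ^+ 2 <= 2 * (L2norm f ^+ 2 + L2norm g ^+ 2).
Proof.
move=> fl gl; have /L2P[_ _ fi] := fl; have /L2P[_ _ gi] := gl; have /L2P[_ _ di] := L2B fl gl.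
rewrite !sqr_L2norm -RintegralD// -RintegralZl//; last exact: integrable_add.
apply: le_Rintegral => //.
  by apply: integrable_scale => //; exact: integrable_add.
move=> x _; apply: (@le_trans _ _ ((vnorm (f x) + vnorm (g x)) ^+ 2)).
  by rewrite ler_sqr ?nnegrE ?addr_ge0 ?vnorm_ge0// vnormB.
have := sqr_ge0 (vnorm (f x) - vnorm (g x)); nra.
Qed.

(** The constant of the resolvent combines the supremum bound S = A |g| with the energy estimate applied to
h = g - V psi. *)
Lemma in_resolvent_set (z : C) (kappa K : R) u w W : 0 <= K ->
  green_pair c M alpha z kappa K u w W -> K / c * norm1 V < 1 -> complex.Im z != 0 ->
  resolvent_set (add_potential (dirac_halfline c m alpha) V) z.
Proof.
move=> K0 G th1 z0; split.
  move=> g gl; have [psi [pl sp bc]] := resolvent_exists V_pot c0 K0 G th1 gl z0.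
  have Vl := potential_mul_L2 V_pot pl.
  exists psi; split; first by apply: L2D => //; exact: L2Z.
  exists (fun x => z *: psi x + (g x - V x *m psi x)); split.
    exact: (solution_dirac_domain c0 pl (L2B gl Vl) bc sp).
  by apply: aeW => x _; rewrite addrA subrK.
have [N [N0 VN]] := potential_bounded V_pot.
set th := K / c * norm1 V in th1.
pose A := K / c / Num.sqrt kappa / (1 - th).
set y := complex.Im z in z0.
pose B := c * A ^+ 2 / `|y| + 2 * (1 + A ^+ 2 * N * norm1 V) / y ^+ 2.
exists (Num.sqrt B) => psi phi D.
have [gl [psic [e pl pcl bc sp]]] := perturbed_domain_solution z D.
set g := fun x => phi x - z *: psi x in gl sp *.
have bnd := a_priori_bound V_pot c0 K0 G th1 gl pcl sp bc.
pose S := A * L2norm g.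
have SE : free_sup c kappa K g / (1 - th) = S by rewrite /S /A /free_sup; ring.
rewrite SE in bnd.
have S0 : 0 <= S by exact: le_trans (vnorm_ge0 _) (bnd 0 (lexx 0)).
have /L2P[mc0 mc1 _] := pcl.
have [Vl VS] := potential_mul_bounded_L2 V_pot S0 mc0 mc1 (fun x x0 => bnd x (ltW x0)).
have [_ E] := energy_bound c0 z0 (L2B gl Vl) sp bc bnd.
rewrite (L2norm_ae e pl pcl).
have y2 : 0 < y ^+ 2 by rewrite lt_neqAle sqr_ge0 andbT eq_sym sqrf_eq0.
have y1 : 0 < `|y| by rewrite normr_gt0.
have n0 : 0 <= norm1 V by apply: Rintegral_ge0 => x _; exact: opnorm_ge0.
have B0 : 0 <= B.
  apply: addr_ge0; apply: divr_ge0; rewrite ?(ltW y2) ?(ltW y1)//.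
    by apply: mulr_ge0; [exact: ltW|exact: sqr_ge0].
  apply: mulr_ge0 => //; apply: addr_ge0 => //; apply: mulr_ge0 => //; apply: mulr_ge0 => //.
  exact: sqr_ge0.
rewrite -ler_sqr ?nnegrE ?mulr_ge0 ?L2norm_ge0 ?sqrtr_ge0//.
rewrite exprMn (sqr_sqrtr B0); apply: (le_trans E).
have -> : B * L2norm g ^+ 2 =
  c * S ^+ 2 / `|y| + (2 * (L2norm g ^+ 2 + S ^+ 2 * N * norm1 V)) / y ^+ 2.
  by rewrite /B /S; ring.
rewrite lerD2l; apply: ler_wpM2r; first by rewrite invr_ge0 ltW.
apply: (le_trans (sqr_L2normB gl Vl)); apply: ler_wpM2l => //.
by rewrite lerD2l; exact: VS.
Qed.

(** A square root with imaginary part 0 would make z^2 - N^2 a nonnegative real number, hence z real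
and |z| >= N. *)
Lemma wave_number_exists (N : R) (z : C) :
  ~ (complex.Im z = 0 /\ N ^+ 2 <= complex.Re z ^+ 2) ->
  exists k : C, c%:C ^+ 2 * k ^+ 2 = z ^+ 2 - N%:C ^+ 2 /\ 0 < complex.Im k.
Proof.
move=> nz; have cC : c%:C != 0 :> C by rewrite eq_complex/= eqxx andbT gt_eqF.
pose k0 : C := sqrtc ((z ^+ 2 - N%:C ^+ 2) / c%:C ^+ 2).
have k0E : c%:C ^+ 2 * k0 ^+ 2 = z ^+ 2 - N%:C ^+ 2.
  by rewrite /k0 sqr_sqrtc mulrC divfK// expf_neq0.
have [i0|i0|i0] := ltgtP (complex.Im k0) 0.
- exists (- k0); split; first by rewrite sqrrN.
  by rewrite ImN oppr_gt0.
- by exists k0.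
exfalso; apply: nz.
have [E1 E2] : complex.Re (c%:C ^+ 2 * k0 ^+ 2) = complex.Re (z ^+ 2 - N%:C ^+ 2) /\
   complex.Im (c%:C ^+ 2 * k0 ^+ 2) = complex.Im (z ^+ 2 - N%:C ^+ 2) by rewrite k0E.
move: E1 E2; rewrite !expr2 !ReImE/= i0.
move: (complex.Re k0) (complex.Re z) (complex.Im z) => kr x y E1 E2.
have xy : x * y = 0 by lra.
have ckr : 0 <= x ^+ 2 - y ^+ 2 - N ^+ 2.
  have -> : x ^+ 2 - y ^+ 2 - N ^+ 2 = (c * kr) ^+ 2 by lra.
  exact: sqr_ge0.
have N2 := sqr_ge0 N; have y2 := sqr_ge0 y.
move/eqP: xy; rewrite mulf_eq0 => /orP[/eqP x0|/eqP y0].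
  have y00 : y ^+ 2 = 0 by move: ckr; rewrite x0 expr0n/=; lra.
  by split; [apply/eqP; rewrite -sqrf_eq0 y00|lra].
by split=> //; move: ckr; rewrite y0 expr0n/=; lra.
Qed.

End Final.

(** * The disks of Apollonius *)

Section Disks.
Variable R : realType.
Local Notation C := R[i].
Local Notation nc := (@Normc.normc R).

(** Squaring the hypothesis and dividing by 1 - 2 q completes the square, because x_0^2 - r_0^2 = 1. *)
Lemma apollonius_disk (N q : R) (z : C) : 0 <= N -> 0 <= q -> 2 * q < 1 ->
  (1 - q) * nc (z - N%:C) <= q * nc (z + N%:C) ->
  nc (z - (N * (1 + 2 * q ^+ 2 / (1 - 2 * q)))%:C) <= N * (2 * q * ((1 - q) / (1 - 2 * q))).
Proof.
move=> N0 q0 q1 le.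
have d0 : 0 < 1 - 2 * q by lra.
have le2 : (1 - q) ^+ 2 * nc (z - N%:C) ^+ 2 <= q ^+ 2 * nc (z + N%:C) ^+ 2.
  by rewrite -!exprMn ler_sqr ?nnegrE ?mulr_ge0 ?nc_ge0//; lra.
have r0 : 0 <= N * (2 * q * ((1 - q) / (1 - 2 * q))).
  have f0 : 0 <= (1 - q) / (1 - 2 * q) by apply: divr_ge0; lra.
  by apply: mulr_ge0 => //; apply: mulr_ge0 => //; apply: mulr_ge0.
rewrite -ler_sqr ?nnegrE ?nc_ge0//.
move: le2; rewrite !sqr_nc !ReImE/=.
move: (complex.Re z) (complex.Im z) => x y le2.
rewrite -subr_ge0.
set E := _ - _.
have -> : E = (1 - 2 * q)^-1 * (q ^+ 2 * ((x + N) ^+ 2 + (y + 0) ^+ 2)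
    - (1 - q) ^+ 2 * ((x - N) ^+ 2 + (y - 0) ^+ 2)).
  by rewrite /E; field; rewrite gt_eqF.
by apply: mulr_ge0; [rewrite invr_ge0; exact: ltW|rewrite subr_ge0].
Qed.
End Disks.

(** * Eigenvalue inclusion and the massless spectrum *)

Unset Implicit Arguments.

Theorem theorem2p1 (R : realType) (c m alpha : R) (V : R -> 'M[R[i]]_2)
    (c_gt0 : 0 < c) (m_ge0 : 0 <= m) (alpha_bnd : 0 <= alpha <= pi / 2)
    (V_pot : potential V) :
  let v := norm1 V / c in
  v < 1 / Num.sqrt 2 ->
  let x0 := 1 + 2 * v ^+ 4 / (1 - 2 * v ^+ 2) in
  let r0 := 2 * v ^+ 2 * ((1 - v ^+ 2) / (1 - 2 * v ^+ 2)) in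
  let D0 := dirac_halfline c m alpha in
  let D := add_potential D0 V in
  let disk_plus := closed_disk (m * c ^+ 2 * x0) (m * c ^+ 2 * r0) in
  let disk_minus := closed_disk (- (m * c ^+ 2 * x0)) (m * c ^+ 2 * r0) in
  [/\ forall z : R[i], ~ spectrum D0 z -> eigenvalue_of D z ->
        (disk_plus `|` disk_minus) z,
      0 < m -> disk_plus `&` disk_minus = set0
    & m = 0 -> spectrum D = [set z | complex.Im z = 0]].
Proof.
move=> v v1 x0 r0 D0 D disk_plus disk_minus.
set N := m * c ^+ 2.
have N0 : 0 <= N by rewrite mulr_ge0// sqr_ge0.
have v0 : 0 <= v.
  by apply: divr_ge0; [apply: Rintegral_ge0 => x _; exact: opnorm_ge0|exact: ltW].
have q1 : 2 * v ^+ 2 < 1.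
  have : v ^+ 2 < (1 / Num.sqrt 2) ^+ 2.
    rewrite ltr_sqr ?nnegrE//; exact: ltW (le_lt_trans v0 v1).
  have -> : (1 / Num.sqrt 2) ^+ 2 = 1 / 2 :> R by rewrite expr_div_n sqr_sqrtr// expr1n.
  lra.
have q0 : 0 <= v ^+ 2 by exact: sqr_ge0.
have x0E : x0 = 1 + 2 * (v ^+ 2) ^+ 2 / (1 - 2 * v ^+ 2) by rewrite /x0 -exprM.
have KE (K : R) : K / c * norm1 V = K * v by rewrite /v; ring.
split.
- move=> z zD0 ev.
  have nz : ~ (complex.Im z = 0 /\ N ^+ 2 <= complex.Re z ^+ 2).
    move=> [iz rz]; apply: zD0.
    have -> : z = (complex.Re z)%:C by apply: complex_eq.
    exact: real_spectrum_free.
  have [k [kE k0]] := wave_number_exists c_gt0 nz.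
  have [u [w [W [t [t0 tE zN0 G]]]]] := green_pair_exists c_gt0 N0 alpha_bnd kE k0.
  set K := Num.sqrt _ in G.
  have K1 : 1 <= K * v.
    rewrite leNgt; apply/negP => K1.
    apply: (no_eigenvalue c_gt0 V_pot (sqrtr_ge0 _) G) ev.
    by rewrite KE.
  have mx0 : 0 <= 1 + Num.max t t^-1 by rewrite addr_ge0// le_max ltW.
  have K2 : 1 <= (1 + Num.max t t^-1) * v ^+ 2.
    rewrite -(sqr_sqrtr mx0) -/K -exprMn -[leLHS](expr1n _ 2).
    by rewrite ler_sqr ?nnegrE// (le_trans ler01).
  have np := nc_ge0 (z + N%:C); have nm := nc_ge0 (z - N%:C).
  have [t1|t1] := leP t^-1 t.
    (* t = |zeta|^2 >= 1: here v^2 |z + N| = v^2 t |z - N| >= (1 - v^2) |z - N|. *)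
    left; rewrite max_l// in K2.
    rewrite /disk_plus /closed_disk /= x0E /r0.
    apply: apollonius_disk => //; rewrite -tE; nra.
  (* The reflection of z in 0 exchanges |z + N| and |z - N|. *)
  right; rewrite max_r in K2; last exact: ltW.
  rewrite /disk_minus /closed_disk /= x0E /r0.
  have -> : z - (- (N * (1 + 2 * (v ^+ 2) ^+ 2 / (1 - 2 * v ^+ 2))))%:C =
      - (- z - (N * (1 + 2 * (v ^+ 2) ^+ 2 / (1 - 2 * v ^+ 2)))%:C).
    by rewrite rmorphN; ring.
  rewrite normcN; apply: apollonius_disk => //.
  have -> : - z - N%:C = - (z + N%:C) by ring.
  have -> : - z + N%:C = - (z - N%:C) by ring.
  rewrite !normcN.
  have tE' : Normc.normc (z - N%:C) = t^-1 * Normc.normc (z + N%:C).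
    by rewrite -tE mulKf// gt_eqF.
  rewrite tE'; nra.
- move=> m0; have Np : 0 < N by rewrite mulr_gt0// exprn_gt0.
  apply/seteqP; split=> // z [/= zp zm].
  have d0 : 0 < 1 - 2 * v ^+ 2 by lra.
  have := le_normcD (z - (- (N * x0))%:C) (- (z - (N * x0)%:C)).
  rewrite normcN.
  have -> : z - (- (N * x0))%:C + - (z - (N * x0)%:C) = (2 * (N * x0))%:C.
    by rewrite rmorphN !rmorphM rmorph_nat; ring.
  rewrite nc_real => le.
  have xr : x0 - r0 = 1 - 2 * v ^+ 2.
    by rewrite x0E /r0; field; rewrite gt_eqF.
  have : 2 * (N * x0) <= 2 * (N * r0).
    by move: zp zm le (ler_norm (2 * (N * x0)));
      rewrite /disk_plus /disk_minus /closed_disk /= -/N; lra.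
  rewrite ler_pM2l// ler_pM2l//; lra.
- move=> m0; have N00 : N = 0 by rewrite /N m0 mul0r.
  apply/seteqP; split=> z /=.
    move=> sz; apply/eqP/negPn/negP => z0; apply: sz.
    have nz : ~ (complex.Im z = 0 /\ N ^+ 2 <= complex.Re z ^+ 2).
      by move=> [iz _]; move/eqP: z0.
    have [k [kE k0]] := wave_number_exists c_gt0 nz.
    have [u [w [W [t [t0 tE zN0 G]]]]] := green_pair_exists c_gt0 N0 alpha_bnd kE k0.
    apply: (in_resolvent_set c_gt0 V_pot (sqrtr_ge0 _) G _ z0).
    rewrite KE.
    have t1 : t = 1.
      move: tE zN0; rewrite N00 subr0 addr0 => tE zn0.
      by apply: (mulIf (x := Normc.normc z)); rewrite ?nc_eq0// mul1r.
    rewrite t1 invr1 maxxx.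
    by rewrite mulrC -ltr_pdivlMr ?sqrtr_gt0.
  move=> iz; have -> : z = (complex.Re z)%:C by apply: complex_eq.
  apply: real_spectrum_perturbed => //.
  by rewrite -/N N00 expr0n sqr_ge0.
Qed.
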